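(* Let $\pi:P\to M$ be an $S^1$-principal bundle over a manifold $M$, equipped with a connection given by the $1$-form $\varphi$, with curvature $\Omega$. Let $c:[a,b]\to M$ be a smooth closed curve that forms the boundary of a smooth triangle $T$ in $M$ (i.e. $c=\partial T$). Then the holonomy of $c$ is given by $$e^{i\int_T i^*\Omega},$$ where, in the exponent, $i^*$ denotes pullback by the inclusion $i:T\to M$ of the triangle $T$ in $M$. Moreover, the angle of holonomy is $\alpha:=\int_T i^*\Omega$.
   Context: Everything is smooth. $S^1$ acts on $P$ on the right, and $\partial_\theta$ is the vertical vector field $\partial_\theta(p)=\frac{d}{d\theta}\big|_{\theta=0}\, p\cdot e^{i\theta}$. A connection $1$-form is a real $1$-form $\varphi\in\Omega^1(P)$ with $\varphi(\partial_\theta)=1$ which is invariant under the right action $R_z(p)=p\cdot z$, i.e. $\varphi_{pz}(dR_z(X))=\varphi_p(X)$ for $z\in S^1$, $X\in T_pP$. The curvature of $\varphi$ is the $2$-form $\Omega$ on $M$ determined by $\pi^*\Omega=d\varphi$. A smooth triangle in $M$ is an embedding $\psi:T\to M$ of a (closed, planar) triangle $T$ that extends to a smooth map on an open neighborhood of $T$; $T$ is identified with its image. A $\varphi$-horizontal lift of $c:[a,b]\to M$ is a curve $\eta:[a,b]\to P$ with $\pi\circ\eta=c$ and $\varphi(\eta')=0$. For a closed curve $c$, the holonomy of $c$ is the element $e^{i\alpha}\in S^1$ with $\eta(b)=\eta(a)\cdot e^{i\alpha}$ for a $\varphi$-horizontal lift $\eta$ of $c$, and $\alpha$ (determined modulo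 $2\pi$) is the angle of holonomy.
   Formalization: The integral over T uses the orientation opposite to the usual Stokes one for c = ∂T: with the stated conventions and the standard boundary orientation the angle of holonomy is minus the integral of Ω over T, so the displayed formula has the wrong sign. *)

(* Defs.v *)
From HB Require Import structures.
From mathcomp Require Import all_boot all_order all_algebra.
From mathcomp Require Import complex.
From mathcomp Require Import all_classical all_reals all_analysis.

Set Implicit Arguments.
Unset Strict Implicit.
Unset Printing Implicit Defensive.

Import Order.TTheory GRing.Theory Num.Theory.
Import numFieldNormedType.Exports.

Local Open Scope classical_set_scope.
Local Open Scope ring_scope.
Local Open Scope complex_scope.

Section SmoothCalculus.
Context {R : realType} {E F : normedModType R}.

(* For finite-dimensional E and F and open A this is "f is of class C^k on A":
   there, 'd f x is continuous in x as soon as each 'd f x v is. *)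
Fixpoint Ck (k : nat) (A : set E) (f : E -> F) : Prop :=
  if k is k'.+1 then
    (forall x, A x -> differentiable f x) /\
    (forall v, Ck k' A (fun x => 'd f x v))
  else forall x, A x -> {for x, continuous f}.

Definition smooth_near (f : E -> F) (x : E) : Prop :=
  exists2 U : set E, open_nbhs x U & forall k, Ck k U f.

End SmoothCalculus.

(* Manifolds modelled on E.  As in Mathlib's ChartedSpace, each point carries a
   preferred chart; the atlas is the family of the preferred charts. *)

Section Manifolds.
Context {R : realType}.

Record chart (E : normedModType R) (M : topologicalType) := Chart {
  chart_dom : set M;
  chart_cod : set E;
  chart_to : M -> E;
  chart_of : E -> M }.

Record charted (E : normedModType R) := Charted {
  carrier :> topologicalType;
  chart_at : carrier -> chart E carrier }.

Record is_chart (E : normedModType R) (M : topologicalType) (h : chart E M)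
    : Prop := IsChart {
  chart_dom_open : open (chart_dom h);
  chart_cod_open : open (chart_cod h);
  chart_toP : forall p, chart_dom h p ->
    chart_cod h (chart_to h p) /\ chart_of h (chart_to h p) = p;
  chart_ofP : forall x, chart_cod h x ->
    chart_dom h (chart_of h x) /\ chart_to h (chart_of h x) = x;
  chart_to_cont : forall p, chart_dom h p -> {for p, continuous (chart_to h)};
  chart_of_cont : forall x, chart_cod h x -> {for x, continuous (chart_of h)} }.

Record is_manifold (E : normedModType R) (M : charted E) : Prop := IsManifold {
  manifold_hausdorff : hausdorff_space M;
  manifold_second_countable : @second_countable M;
  manifold_chart : forall p : M, is_chart (chart_at p);
  manifold_chart_mem : forall p : M, chart_dom (chart_at p) p;
  manifold_compat : forall (p q : M) (k : nat),
    Ck k (chart_cod (chart_at p) `&`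
          chart_of (chart_at p) @^-1` chart_dom (chart_at q))
      (chart_to (chart_at q) \o chart_of (chart_at p)) }.

Definition model_chart (E : normedModType R) : chart E E :=
  Chart setT setT id id.

Definition model (E : normedModType R) : charted E :=
  @Charted E E (fun=> model_chart E).

Definition prod_chart (E F : normedModType R) (M N : topologicalType)
    (g : chart E M) (h : chart F N) : chart (E * F)%type (M * N)%type :=
  Chart (chart_dom g `*` chart_dom h) (chart_cod g `*` chart_cod h)
    (fun p => (chart_to g p.1, chart_to h p.2))
    (fun x => (chart_of g x.1, chart_of h x.2)).

Definition mprod (E F : normedModType R) (M : charted E) (N : charted F)
    : charted (E * F)%type :=
  @Charted (E * F)%type (M * N)%type
    (fun p => prod_chart (chart_at p.1) (chart_at p.2)).

Section Maps.
Context {E F : normedModType R} {M : charted E} {N : charted F}.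

Definition in_charts (f : M -> N) (p : M) : E -> F :=
  chart_to (chart_at (f p)) \o f \o chart_of (chart_at p).

Definition smooth_at (f : M -> N) (p : M) : Prop :=
  {for p, continuous f} /\
  smooth_near (in_charts f p) (chart_to (chart_at p) p).

Definition smooth_on (f : M -> N) (A : set M) : Prop :=
  forall p, A p -> smooth_at f p.

(* The tangent space T_pM is represented by E, through the preferred chart at p;
   mdiff f p : T_pM -> T_(f p)N is the tangent map. *)
Definition mdiff (f : M -> N) (p : M) : E -> F :=
  'd (in_charts f p) (chart_to (chart_at p) p).

End Maps.

Definition velocity (F : normedModType R) (N : charted F)
    (c : model R^o -> N) (t : R) : F := mdiff c t 1.

End Manifolds.

Section Forms.
Context {R : realType}.

(* omega p is evaluated on tangent vectors at p, i.e. on elements of E *)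
Definition form1 (E : normedModType R) (M : charted E) := M -> E -> R.
Definition form2 (E : normedModType R) (M : charted E) := M -> E -> E -> R.

Definition pullback1 (E F : normedModType R) (M : charted E) (N : charted F)
    (f : M -> N) (w : form1 N) : form1 M :=
  fun p u => w (f p) (mdiff f p u).

Definition pullback2 (E F : normedModType R) (M : charted E) (N : charted F)
    (f : M -> N) (w : form2 N) : form2 M :=
  fun p u v => w (f p) (mdiff f p u) (mdiff f p v).

Context {E : normedModType R} {M : charted E}.

Definition param (p : M) : model E -> M := chart_of (chart_at p).

Definition is_form1 (w : form1 M) : Prop :=
  (forall p s u v, w p (s *: u + v) = s * w p u + w p v) /\
  (forall p v, smooth_near (fun x : E => pullback1 (param p) w x v : R^o)
                 (chart_to (chart_at p) p)).

Definition is_form2 (w : form2 M) : Prop :=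
  [/\ forall p s u v z, w p (s *: u + v) z = s * w p u z + w p v z,
      forall p s u v z, w p z (s *: u + v) = s * w p z u + w p z v,
      forall p u, w p u u = 0
    & forall p u v, smooth_near
        (fun x : E => pullback2 (param p) w x u v : R^o)
        (chart_to (chart_at p) p)].

(* (dw)(u, v) = d_u (w v) - d_v (w u) for constant coordinate fields u, v *)
Definition dform1 (w : form1 M) : form2 M := fun p u v =>
  let x := chart_to (chart_at p) p in
  'd (fun y : E => pullback1 (param p) w y v : R^o) x u -
  'd (fun y : E => pullback1 (param p) w y u : R^o) x v.

End Forms.

Section Circle.
Context {R : realType}.

Definition circle_set := {z : R[i] | `|z| == 1}.

Definition circle_coord (z : circle_set) : R^o * R^o :=
  (complex.Re (val z), complex.Im (val z)).

Definition circle := initial_topology circle_coord.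

Lemma circle_mul_subproof (z w : circle) : `|val z * val w| == 1.
Proof. by rewrite normrM (eqP (valP z)) (eqP (valP w)) mulr1. Qed.

Definition circle_mul (z w : circle) : circle :=
  exist _ (val z * val w) (circle_mul_subproof z w).

Lemma expi_subproof (t : R) : `|cos t +i* sin t| == 1 :> R[i].
Proof. by rewrite normc_def /= cos2Dsin2 sqrtr1. Qed.

Definition expi (t : R) : circle := exist _ (cos t +i* sin t) (expi_subproof t).

(* principal argument of u, in ]-pi, pi[, for u != -1 on the unit circle:
   tan (t / 2) = sin t / (1 + cos t) *)
Definition principal_arg (u : R[i]) : R :=
  2 * atan (complex.Im u / (1 + complex.Re u)).

(* S^1 with its usual smooth structure, the angle measured from z being the
   coordinate around z *)
Definition circle_chart (z : circle) : chart (R^o : normedModType R) circle :=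
  Chart [set w : circle | val w != - val z]
    [set t : R^o | - pi < t < pi]
    (fun w => principal_arg (val w / val z) : R^o)
    (fun t => circle_mul z (expi t)).

Definition S1 : charted (R^o : normedModType R) := Charted circle_chart.

End Circle.

Arguments S1 : clear implicits.

Section Bundles.
Context {R : realType} {E F : normedModType R}.
Context {P : charted F} {M : charted E}.

Definition is_circle_bundle (proj : P -> M) (act : P -> S1 R -> P) : Prop :=
  [/\ smooth_on proj setT,
      smooth_on (fun x : mprod P (S1 R) => act x.1 x.2) setT,
      forall p, act p (expi 0) = p,
      forall p z w, act p (circle_mul z w) = act (act p z) w
    & forall x : M, exists2 U : set M, open_nbhs x U &
        exists (triv : P -> mprod M (S1 R)) (inv : mprod M (S1 R) -> P),
        [/\ smooth_on triv (proj @^-1` U),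
            smooth_on inv [set y | U y.1],
            forall p, U (proj p) -> (triv p).1 = proj p /\ inv (triv p) = p,
            forall y, U y.1 -> proj (inv y) = y.1 /\ triv (inv y) = y
          & forall p z, U (proj p) ->
              triv (act p z) = (proj p, circle_mul (triv p).2 z)]].

Definition d_theta (act : P -> S1 R -> P) (p : P) : F :=
  velocity (fun t : model R^o => act p (expi t)) 0.

Definition is_connection (act : P -> S1 R -> P) (phi : form1 P) : Prop :=
  [/\ is_form1 phi,
      forall p, phi p (d_theta act p) = 1
    & forall z, pullback1 (fun p => act p z) phi = phi].

Definition is_curvature (proj : P -> M) (phi : form1 P) (Omega : form2 M)
    : Prop :=
  is_form2 Omega /\ pullback2 proj Omega = dform1 phi.

Definition is_horizontal_lift (proj : P -> M) (phi : form1 P) (a b : R)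
    (c : model R^o -> M) (eta : model R^o -> P) : Prop :=
  forall t : R, a <= t <= b ->
    [/\ smooth_at eta t, proj (eta t) = c t
      & phi (eta t) (velocity eta t) = 0].

Definition is_holonomy (proj : P -> M) (act : P -> S1 R -> P) (phi : form1 P)
    (a b : R) (c : model R^o -> M) (z : S1 R) : Prop :=
  (exists eta, is_horizontal_lift proj phi a b c eta) /\
  (forall eta, is_horizontal_lift proj phi a b c eta ->
     eta b = act (eta a) z).

Definition is_holonomy_angle (proj : P -> M) (act : P -> S1 R -> P)
    (phi : form1 P) (a b : R) (c : model R^o -> M) (alpha : R) : Prop :=
  is_holonomy proj act phi a b c (expi alpha).

End Bundles.

Section Triangles.
Context {R : realType}.

Definition plane : normedModType R := (R^o * R^o)%type.

Definition det2 (u v : plane) : R := u.1 * v.2 - u.2 * v.1.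

Definition triangle (A B C : plane) : set plane :=
  [set x | exists s : 'I_3 -> R,
     [/\ forall i, 0 <= s i, \sum_i s i = 1
       & x = s 0 *: A + s 1 *: B + s 2 *: C]].

Definition vertex (A B C : plane) (k : int) : plane :=
  if (k %% 3)%Z == 0 then A else if (k %% 3)%Z == 1 then B else C.

(* the 3-periodic circuit A -> B -> C -> A, affine between integers *)
Definition circuit (A B C : plane) (s : R) : plane :=
  let k := Num.floor s in
  vertex A B C k +
  (s - k%:~R) *: (vertex A B C (k + 1) - vertex A B C k).

Context {E : normedModType R} {M : charted E}.

(* The smoothness condition at the points of the closed set T says that psi is
   smooth on an open neighborhood of T; the values of psi away from T are
   irrelevant. *)
Definition is_embedding_on (T : set plane) (psi : model plane -> M) : Prop :=
  [/\ smooth_on psi T,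
      forall x, T x -> injective (mdiff psi x),
      {in T &, injective psi}
    & forall x U, T x -> nbhs x U -> exists2 V : set M, nbhs (psi x) V &
        forall y, T y -> V (psi y) -> U y].

Definition is_smooth_triangle (A B C : plane) (psi : model plane -> M) : Prop :=
  det2 (B - A) (C - A) != 0 /\ is_embedding_on (triangle A B C) psi.

(* c : [a, b] -> M runs once around psi (boundary of ABC), in the direction
   A -> B -> C -> A, from an arbitrary starting point. *)
Definition is_boundary_curve (A B C : plane) (psi : model plane -> M)
    (a b : R) (c : model R^o -> M) : Prop :=
  exists sigma : R -> R,
    [/\ {within `[a, b], continuous sigma},
        {in `[a, b] &, {homo sigma : s t / s <= t}},
        sigma b = sigma a + 3
      & forall t, a <= t <= b -> c t = psi (circuit A B C (sigma t))].

(* Integral over the triangle oriented by its boundary circuit A -> B -> C -> A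
   so that (direction of the circuit, outward vector) is a positive frame; on
   the edge AB such a frame is (B - A, A - C).  The "outward vector first"
   orientation would give the opposite sign: locally phi = d theta + w with
   pullback of Omega = dw, so the angle along a horizontal lift increases by
   the integral of - w along the circuit. *)
Definition triangle_integral (A B C : plane) (w : form2 (model plane)) : R :=
  Num.sg (det2 (B - A) (A - C)) *
  \int[(@lebesgue_measure R \x @lebesgue_measure R)%E]_(x in triangle A B C)
    w x (1, 0) (0, 1).

End Triangles.

(* Main.v *)
Require Import Defs.
From HB Require Import structures.
From mathcomp Require Import all_boot all_order all_algebra.
From mathcomp Require Import complex.
From mathcomp Require Import all_classical all_reals all_analysis.
From mathcomp Require Import ring lra.
From mathcomp Require Import measurable_realfun.

(** If a single section of P covered the triangle, the connection would become a
    1-form w there, a horizontal lift would be the section rotated by an angle with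
    derivative - w along the curve, and Stokes' theorem would give the total angle.
    The proof keeps this idea, but it replaces the global section and Stokes'
    theorem by a flat section.

    Everything is pulled back to the standard triangle 0 <= y <= x <= 1 by an affine
    chart; Psi denotes the resulting map to M and W the coefficient of the pullback
    of Omega by Psi. Let f be the primitive of - W in the direction y that vanishes
    on y = 0 [vertical_primitive]. Then f dx is a primitive of the pulled back
    curvature, so that the connection form minus f dx is flat: it has parallel
    sections locally, by the Poincare lemma [local_primitive, flat_exists]; two of
    them differ by a rotation [flat_overlap], and since the triangle is convex they
    can be glued to one parallel section s over the whole triangle [flat_on_exists].

    Let gam be the boundary circuit in the standard triangle. The section s along
    gam, rotated by - th with th' = f(gam) gam.1', is horizontal. The form f dx
    vanishes on the side y = 0 because f does, and on the side x = 1 because dx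
    does. Running through the diagonal from (1, 1) to (0, 0) changes th by minus the
    integral of f (x, x), which is the double integral of W, that is, minus the
    integral of Omega over the oriented triangle [boundary_closed,
    triangle_integral_std]. As s (gam) returns to its initial value, the lift has
    turned by the integral of Omega [holonomy_from_boundary].

    Two points concern regularity. The curve gam is the circuit with the times of a
    parametrization that is only continuous and monotone; it is nevertheless
    differentiable inside the interval, because c is smooth and Psi is an immersion
    [immersion_path]. And the lift built from gam is smooth, because in a local
    section of P its angle has the derivative of a smooth angle [local_lift]. The
    choice of the lift does not matter, since two lifts differ by a constant rotation
    [lift_unique]. *)

Set Implicit Arguments.
Unset Strict Implicit.
Unset Printing Implicit Defensive.

Import Order.TTheory GRing.Theory Num.Theory.
Import numFieldNormedType.Exports.

Local Open Scope classical_set_scope.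
Local Open Scope ring_scope.

(** * Calculus of C^k maps *)

Section Ck_theory.
Context {R : realType}.
Implicit Types E F G : normedModType R.

Lemma near_eq_diff E F (f g : E -> F) (x : E) :
  (\forall y \near x, f y = g y) -> differentiable f x ->
  differentiable g x /\ 'd g x = 'd f x :> (E -> F).
Proof.
move=> fg df.
have gx : g x = f x by rewrite (nbhs_singleton fg).
have cd : continuous ('d f x) by exact: diff_continuous.
have gE : g \o shift x = cst (g x) + 'd f x +o_ 0 id.
  have := diff_locally df; move=> /eqaddoP fE.
  apply/eqaddoP => e e0; near=> h.
  have -> : (g \o shift x - (cst (g x) + 'd f x)) h =
            (f \o shift x - (cst (f x) + 'd f x)) h.
    rewrite !fctE gx /=; congr (_ - _); apply/esym.
    by near: h; move: fg; rewrite (near_shift 0 x) subr0.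
  by near: h; exact: fE.
have dgE : 'd g x = 'd f x :> (E -> F) by exact: diff_unique gE.
split; last exact: dgE.
by apply/diff_locallyP; rewrite dgE.
Unshelve. all: by end_near. Qed.

Lemma Ck_sub (k : nat) E F (A B : set E) (f : E -> F) :
  A `<=` B -> Ck k B f -> Ck k A f.
Proof.
move=> AB; elim: k f => [|k IH] f /=; first by move=> h x /AB /h.
by move=> [h1 h2]; split => [x /AB /h1 //|v]; apply: IH.
Qed.

Lemma Ck_eq (k : nat) E F (A : set E) (f g : E -> F) :
  open A -> (forall x, A x -> f x = g x) -> Ck k A f -> Ck k A g.
Proof.
move=> oA; have near_A x : A x -> \forall y \near x, A y by move=> Ax; apply: open_nbhs_nbhs; split.
elim: k f g => [|k IH] f g fg /=.
  move=> cf x Ax; have gE : g x = f x by rewrite fg.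
  rewrite /prop_for /continuous_at gE.
  apply: cvg_trans (cf x Ax); apply: near_eq_cvg.
  by near=> y; apply: fg; near: y; exact: near_A.
have fg' x : A x -> \forall y \near x, f y = g y.
  by move=> Ax; near=> y; apply: fg; near: y; exact: near_A.
move=> [df dfC]; split => [x Ax|v].
  by have [] := near_eq_diff (fg' x Ax) (df x Ax).
apply: IH (dfC v) => x Ax.
by have [_ ->] := near_eq_diff (fg' x Ax) (df x Ax).
Unshelve. all: by end_near. Qed.

Lemma CkS (k : nat) E F (A : set E) (f : E -> F) : Ck k.+1 A f -> Ck k A f.
Proof.
elim: k f => [|k IH] f /= [df dfC].
  by move=> x Ax; apply: differentiable_continuous; exact: df.
by split => // v; apply: IH; exact: dfC.
Qed.

Lemma Ck_cst (k : nat) E F (A : set E) (c : F) : Ck k A (cst c : E -> F).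
Proof.
elim: k c => [|k IH] c /=; first by move=> x _; exact: cst_continuous.
split => // v.
rewrite (_ : (fun x => _) = cst 0) //.
by apply/funext => x; rewrite diff_cst.
Qed.

Lemma Ck_lin (k : nat) E F (A : set E) (f : {linear E -> F}) :
  continuous f -> Ck k A f.
Proof.
move=> cf; case: k => [|k] /=; first by move=> x _; exact: cf.
split=> [x _|v]; first exact: linear_differentiable.
rewrite (_ : (fun x => _) = cst (f v)); first exact: Ck_cst.
by apply/funext => x; rewrite diff_lin.
Qed.

Lemma CkD (k : nat) E F (A : set E) (f g : E -> F) : open A ->
  Ck k A f -> Ck k A g -> Ck k A (f + g).
Proof.
move=> oA; elim: k f g => [|k IH] f g /=.
  by move=> cf cg x Ax; apply: continuousD; [exact: cf|exact: cg].
move=> [df dfC] [dg dgC]; split=> [x Ax|v].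
  by apply: differentiableD; [exact: df|exact: dg].
apply: (Ck_eq oA _ (IH _ _ (dfC v) (dgC v))) => x Ax.
by rewrite diffD//; [exact: df|exact: dg].
Qed.

Lemma Ck_sum (k : nat) E F (A : set E) (I : finType) (f : I -> E -> F) : open A ->
  (forall i, Ck k A (f i)) -> Ck k A (\sum_i f i).
Proof.
move=> oA fC; elim/big_rec: _ => [|i g _ gC]; first exact: Ck_cst.
exact: CkD.
Qed.

Lemma Ck_lin_comp (k : nat) E F G (A : set E) (l : {linear F -> G}) (f : E -> F) :
  open A -> continuous l -> Ck k A f -> Ck k A (l \o f).
Proof.
move=> oA cl; elim: k f => [|k IH] f /=.
  by move=> cf x Ax; apply: continuous_comp; [exact: cf|exact: cl].
move=> [df dfC]; split=> [x Ax|v].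
  by apply: differentiable_comp; [exact: df|exact: linear_differentiable].
apply: (Ck_eq oA _ (IH _ (dfC v))) => x Ax /=.
have dl : differentiable l (f x) by exact: linear_differentiable.
by rewrite (diff_comp (df x Ax) dl) /= (diff_lin _ cl).
Qed.

Lemma Ck_pair (k : nat) E F G (A : set E) (f : E -> F) (g : E -> G) :
  open A -> Ck k A f -> Ck k A g -> Ck k A (fun x => (f x, g x)).
Proof.
move=> oA; elim: k f g => [|k IH] f g /=.
  by move=> cf cg x Ax; apply: cvg_pair; [exact: cf|exact: cg].
move=> [df dfC] [dg dgC]; split=> [x Ax|v].
  by apply: differentiable_pair; [exact: df|exact: dg].
apply: (Ck_eq oA _ (IH _ _ (dfC v) (dgC v))) => x Ax /=.
by rewrite diff_pair//; [exact: df|exact: dg].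
Qed.

Lemma is_diff_scalef E F (f : E -> R^o) (g : E -> F) (x : E) :
  differentiable f x -> differentiable g x ->
  is_diff x (fun y => f y *: g y) (fun v => f x *: 'd g x v + 'd f x v *: g x).
Proof.
move=> dfx dgx.
have sbil : bilinear_for *:%R *:%R (fun (a : R^o) (u : F) => a *: u).
  split=> [u a b c|u a b c] /=; first by rewrite scalerDl scalerA.
  by rewrite scalerDr !scalerA mulrC.
pose bm := bilinear_isBilinear.Build R (R^o) F F *:%R *:%R (fun (a : R^o) (u : F) => a *: u) sbil.
pose b : {bilinear (R^o) -> F -> F} := HB.pack (fun (a : R^o) (u : F) => a *: u) bm.
have bc : continuous (fun p : R^o * F => b p.1 p.2).
  by move=> p; exact: scale_continuous.
have dp := differentiable_pair dfx dgx.
have db := @differentiable_bilin _ _ _ _ b (f x, g x) bc.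
have -> : (fun y => f y *: g y) = (fun p : R^o * F => b p.1 p.2) \o (fun y => (f y, g y)) by [].
split; first exact: differentiable_comp.
rewrite (diff_comp dp db) (diff_bilin _ bc); apply/funext => v /=.
by rewrite (diff_pair dfx dgx).
Qed.

Lemma is_diff_bigsum E F (I : finType) (h : I -> E -> F) (x : E) :
  (forall j, differentiable (h j) x) ->
  is_diff x (fun y => \sum_j h j y) (fun u => \sum_j 'd (h j) x u).
Proof.
move=> dh.
have -> : (fun y => \sum_j h j y) = \sum_j h j by apply/funext => y; rewrite fct_sumE.
have -> : (fun u => \sum_j 'd (h j) x u) = \sum_j ('d (h j) x : E -> F).
  by apply/funext => y; rewrite fct_sumE.
elim/big_ind2: _ => [|f f' g g' [df fE] [dg gE]|j _].
- by apply: DiffDef; [exact: differentiable_cst|rewrite diff_cst].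
- by apply: DiffDef; [exact: differentiableD|rewrite diffD// fE gE].
- by apply: DiffDef; [exact: dh|].
Qed.

Lemma CkZ (k : nat) E F (A : set E) (f : E -> R^o) (g : E -> F) : open A ->
  Ck k A f -> Ck k A g -> Ck k A (fun x => f x *: g x).
Proof.
move=> oA; elim: k f g => [|k IH] f g.
  by move=> cf cg x Ax; apply: cvgZ; [exact: cf|exact: cg].
move=> fC gC; have fC' := CkS fC; have gC' := CkS gC.
move: fC gC => [df dfC] [dg dgC].
split=> [x Ax|v]; first by have [] := is_diff_scalef (df x Ax) (dg x Ax).
have := CkD oA (IH _ _ fC' (dgC v)) (IH _ _ (dfC v) gC').
apply: Ck_eq => // x Ax /=.
by have [_ ->] := is_diff_scalef (df x Ax) (dg x Ax).
Qed.

Lemma linear_pack E F (f : E -> F) : linear f -> {g : {linear E -> F} | g = f :> (E -> F)}.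
Proof.
move=> lf; pose m := GRing.isLinear.Build R E F *:%R f lf.
pose g : {linear E -> F} := HB.pack f m.
by exists g.
Qed.

(** Coordinates: with finitely many of them, the derivative of a composite is a
    finite sum of products, which is what makes the induction on k work. *)
Definition fin_coord (F : normedModType R) : Prop :=
  exists (I : finType) (e : I -> F) (l : I -> F -> R^o),
    (forall j, linear (l j) /\ continuous (l j)) /\
    forall v, v = \sum_j l j v *: e j.

Lemma fin_coordR : fin_coord (R^o : normedModType R).
Proof.
exists unit, (fun=> 1), (fun=> idfun); split => [_|v].
  by split => // x; exact: cvg_id.
by rewrite (big_pred1 tt) => [|[]//]; rewrite /GRing.scale /= mulr1.
Qed.

Lemma fin_coord_prod (E F : normedModType R) :
  fin_coord E -> fin_coord F -> fin_coord (E * F)%type.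
Proof.
move=> [I [e [l [lP lE]]]] [J [e' [l' [lP' lE']]]].
exists (I + J)%type, (fun j => match j with inl i => (e i, 0) | inr i => (0, e' i) end),
  (fun j v => match j with inl i => l i v.1 | inr i => l' i v.2 end).
split=> [[j|j]|[v w]].
- have [ll lc] := lP j; split; first by move=> a x y; exact: ll.
  by move=> x; apply: continuous_comp; [exact: cvg_fst|exact: lc].
- have [ll lc] := lP' j; split; first by move=> a x y; exact: ll.
  by move=> x; apply: continuous_comp; [exact: cvg_snd|exact: lc].
rewrite big_sumType /= [in LHS](lE v) [in LHS](lE' w).
have fstS (K : finType) (h : K -> E * F) : (\sum_i h i).1 = \sum_i (h i).1.
  exact: (big_morph (@fst E F)).
have sndS (K : finType) (h : K -> E * F) : (\sum_i h i).2 = \sum_i (h i).2.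
  exact: (big_morph (@snd E F)).
apply: injective_projections => /=.
  rewrite !fstS [X in _ + X]big1 ?addr0// => j _ /=; exact: scaler0.
rewrite !sndS [X in X + _]big1 ?add0r// => j _ /=; exact: scaler0.
Qed.

Lemma fin_coord_rV n : fin_coord ('rV[R]_n : normedModType R).
Proof.
exists 'I_n, (fun j => delta_mx 0 j), (fun j (v : 'rV[R]_n) => v 0 j).
split=> [j|v]; last exact: row_sum_delta.
by split=> [a x y|x]; [rewrite !mxE|exact: coord_continuous].
Qed.

Lemma Ck_comp (k : nat) E F G (A : set E) (B : set F) (f : E -> F) (g : F -> G) :
  fin_coord F -> open A -> open B -> (forall x, A x -> B (f x)) ->
  Ck k A f -> Ck k B g -> Ck k A (g \o f).
Proof.
move=> [I [e [l [lP lE]]]] oA oB AB.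
elim: k g => [|k IH] g.
  by move=> cf cg x Ax; apply: continuous_comp; [exact: cf|exact/cg/AB].
move=> fC gC; have fC' := CkS fC; move: fC gC => [df dfC] [dg dgC].
split=> [x Ax|v].
  by apply: differentiable_comp; [exact: df|exact/dg/AB].
pose h x := \sum_j (l j \o (fun y => 'd f y v)) x *: ((fun y => 'd g y (e j)) \o f) x.
have hC : Ck k A h.
  rewrite (_ : h = \sum_j
    (fun x => (l j \o (fun y => 'd f y v)) x *: ((fun y => 'd g y (e j)) \o f) x)).
    apply: Ck_sum => // j; apply: CkZ => //; last first.
      by apply: IH; [|exact: dgC].
    have [ll lc] := lP j; have [lj ljE] := linear_pack ll.
    by rewrite -ljE; apply: Ck_lin_comp; rewrite ?ljE//; exact: dfC.
  by apply/funext => x; rewrite fct_sumE.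
apply: (Ck_eq oA _ hC) => x Ax.
rewrite (diff_comp (df x Ax) (dg _ (AB _ Ax))) /= [in RHS](lE ('d f x v)) linear_sum /h.
by apply: eq_bigr => j _; rewrite linearZ.
Qed.

Lemma Ck_derive (k : nat) (A : set R^o) (f f' : R^o -> R^o) : open A ->
  (forall x, A x -> is_derive x 1 f (f' x)) -> Ck k A f' -> Ck k.+1 A f.
Proof.
move=> oA df f'C.
have dff x : A x -> differentiable f x /\ 'd f x = (fun v => v * f' x) :> (R^o -> R^o).
  move=> /df [df1 <-]; have df2 : differentiable f x by apply/derivable1_diffP.
  split => //; apply/funext => v.
  rewrite deriveE// -[in LHS](mulr1 v).
  by rewrite (_ : v * 1 = v *: (1:R^o)) // linearZ.
split=> [x /dff[]//|v].
apply: (Ck_eq oA _ (Ck_lin_comp oA (@scaler_continuous _ R^o v) f'C)).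
by move=> x /dff[_ ->].
Qed.

Lemma smooth_near_diff E F (f : E -> F) (x : E) : smooth_near f x ->
  \forall y \near x, differentiable f y.
Proof.
move=> [U Ux fC]; near=> y; have [+ _] := fC 1%N; apply.
near: y; exact: open_nbhs_nbhs.
Unshelve. all: by end_near. Qed.

Lemma smooth_near_differentiable E F (f : E -> F) (x : E) : smooth_near f x ->
  differentiable f x.
Proof. by move=> /smooth_near_diff/nbhs_singleton. Qed.

Lemma smooth_near_near E F (f : E -> F) (x : E) : smooth_near f x ->
  \forall y \near x, smooth_near f y.
Proof.
move=> [U [oU Ux] fC]; near=> y; exists U => //; split => //.
near: y; exact: open_nbhs_nbhs.
Unshelve. all: by end_near. Qed.

Lemma smooth_near_eq E F (f g : E -> F) (x : E) :
  (\forall y \near x, f y = g y) -> smooth_near f x -> smooth_near g x.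
Proof.
move=> fg0; have : nbhs x [set y | f y = g y] by exact: fg0.
rewrite nbhsE => -[V [oV Vx] fg] [U [oU Ux] fC].
exists (U `&` V); first by split => //; exact: openI.
move=> k; apply: (@Ck_eq _ _ _ _ f).
- exact: openI.
- by move=> y [_ /fg].
- by apply: Ck_sub (fC k) => y [].
Qed.

Lemma smooth_near_comp E F G (f : E -> F) (g : F -> G) (x : E) : fin_coord F ->
  smooth_near f x -> smooth_near g (f x) -> smooth_near (g \o f) x.
Proof.
move=> cF fs; have df := smooth_near_differentiable fs.
move: fs => [U [oU Ux] fC] [V [oV Vfx] gC].
have : nbhs x (f @^-1` V).
  by apply: (differentiable_continuous df); exact: open_nbhs_nbhs.
rewrite nbhsE => -[W [oW Wx] WV].
exists (U `&` W); first by split => //; exact: openI.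
move=> k; apply: (@Ck_comp _ _ _ _ _ V) => //; first exact: openI.
- by move=> y [_ /WV].
- by apply: Ck_sub (fC k) => y [].
Qed.

Lemma smooth_nearT E F (f : E -> F) (x : E) : (forall k, Ck k setT f) -> smooth_near f x.
Proof. by move=> fC; exists setT => //; split => //; exact: openT. Qed.

Lemma smooth_near_cst E F (c : F) (x : E) : smooth_near (cst c : E -> F) x.
Proof. by apply: smooth_nearT => k; exact: Ck_cst. Qed.

Lemma smooth_near_lin E F (f : {linear E -> F}) (x : E) : continuous f -> smooth_near f x.
Proof. by move=> cf; apply: smooth_nearT => k; exact: Ck_lin. Qed.

Lemma smooth_near2 E F G (H : normedModType R) (f : E -> F) (g : E -> G) (h : E -> H) x :
  (forall k A, open A -> Ck k A f -> Ck k A g -> Ck k A h) ->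
  smooth_near f x -> smooth_near g x -> smooth_near h x.
Proof.
move=> opC [U [oU Ux] fC] [V [oV Vx] gC].
exists (U `&` V); first by split => //; exact: openI.
move=> k; apply: opC; first exact: openI.
- by apply: Ck_sub (fC k) => y [].
- by apply: Ck_sub (gC k) => y [].
Qed.

Lemma smooth_nearD E F (f g : E -> F) x :
  smooth_near f x -> smooth_near g x -> smooth_near (f + g) x.
Proof. by apply: smooth_near2 => *; exact: CkD. Qed.

Lemma smooth_nearZ E F (f : E -> R^o) (g : E -> F) x :
  smooth_near f x -> smooth_near g x -> smooth_near (fun y => f y *: g y) x.
Proof. by apply: smooth_near2 => *; exact: CkZ. Qed.

Lemma smooth_near_pair E F G (f : E -> F) (g : E -> G) x :
  smooth_near f x -> smooth_near g x -> smooth_near (fun y => (f y, g y)) x.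
Proof. by apply: smooth_near2 => *; exact: Ck_pair. Qed.

Lemma smooth_near_sum E F (I : finType) (f : I -> E -> F) x :
  (forall i, smooth_near (f i) x) -> smooth_near (fun y => \sum_i f i y) x.
Proof.
move=> fs; rewrite (_ : (fun _ => _) = \sum_i f i); last first.
  by apply/funext => y; rewrite fct_sumE.
by elim/big_rec: _ => [|i g _ gs]; [exact: smooth_near_cst|exact: smooth_nearD].
Qed.

Lemma smooth_near_derive E F (f : E -> F) x v :
  smooth_near f x -> smooth_near (fun y => 'd f y v) x.
Proof. by move=> [U Ux fC]; exists U => // k; have [_ +] := fC k.+1; apply. Qed.

End Ck_theory.

(** * Smooth maps in charts *)

Section SmoothMaps.
Context {R : realType}.

(** The chart axioms alone, which pass to the circle and to products and suffice
    for the chain rule. *)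
Definition has_charts (E : normedModType R) (M : charted E) : Prop :=
  forall p : M, is_chart (chart_at p) /\ chart_dom (chart_at p) p.

Lemma has_charts_model (E : normedModType R) : has_charts (model E).
Proof.
move=> p; split=> //; split=> //.
- exact: openT.
- exact: openT.
- by move=> x _; exact: cvg_id.
- by move=> x _; exact: cvg_id.
Qed.

Lemma has_charts_manifold (E : normedModType R) (M : charted E) :
  is_manifold M -> has_charts M.
Proof. by move=> hM p; split; [exact: manifold_chart|exact: manifold_chart_mem]. Qed.

Lemma open_setX (T U : topologicalType) (A : set T) (B : set U) :
  open A -> open B -> open (A `*` B).
Proof.
move=> oA oB; rewrite openE => -[x y] [/= Ax By].
by exists (A, B) => //; split; apply: open_nbhs_nbhs.
Qed.

Lemma has_charts_prod (E F : normedModType R) (M : charted E) (N : charted F) :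
  has_charts M -> has_charts N -> has_charts (mprod M N).
Proof.
move=> cM cN [p q]; have [cp pp] := cM p; have [cq qq] := cN q; split=> //.
split=> /=.
- exact: open_setX (chart_dom_open cp) (chart_dom_open cq).
- exact: open_setX (chart_cod_open cp) (chart_cod_open cq).
- move=> [a b] [/= /(chart_toP cp)[? ->] /(chart_toP cq)[? ->]]; by split.
- move=> [a b] [/= /(chart_ofP cp)[? ->] /(chart_ofP cq)[? ->]]; by split.
- move=> [a b] [/= /(chart_to_cont cp) ca /(chart_to_cont cq) cb].
  by apply: cvg_pair; apply: cvg_comp; [exact: cvg_fst|exact: ca|exact: cvg_snd|exact: cb].
- move=> [a b] [/= /(chart_of_cont cp) ca /(chart_of_cont cq) cb].
  by apply: cvg_pair; apply: cvg_comp; [exact: cvg_fst|exact: ca|exact: cvg_snd|exact: cb].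
Qed.

Section OneMap.
Context {E F : normedModType R} {M : charted E} {N : charted F}.
Hypothesis cM : has_charts M.

Lemma chart_ofK (p : M) : chart_of (chart_at p) (chart_to (chart_at p) p) = p.
Proof. by have [cp pp] := cM p; have [] := chart_toP cp pp. Qed.

Lemma chart_of_cvg (p : M) :
  chart_of (chart_at p) x @[x --> chart_to (chart_at p) p] --> p.
Proof.
have [cp pp] := cM p; have [cod _] := chart_toP cp pp.
by have := chart_of_cont cp cod; rewrite /prop_for /continuous_at chart_ofK.
Qed.

Lemma near_chart (p : M) (Q : M -> Prop) : (\forall q \near p, Q q) ->
  \forall x \near chart_to (chart_at p) p, Q (chart_of (chart_at p) x).
Proof. by move=> nQ; exact: (chart_of_cvg nQ). Qed.

Lemma in_charts_center (f : M -> N) (p : M) :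
  in_charts f p (chart_to (chart_at p) p) = chart_to (chart_at (f p)) (f p).
Proof. by rewrite /in_charts /= chart_ofK. Qed.

Lemma smooth_at_eq (f g : M -> N) (p : M) : (\forall q \near p, f q = g q) ->
  smooth_at f p -> smooth_at g p.
Proof.
move=> fg [cf sf]; have fgp : f p = g p := nbhs_singleton fg.
split.
  rewrite /prop_for /continuous_at -fgp; apply: cvg_trans cf.
  exact: near_eq_cvg.
apply: smooth_near_eq sf; have := near_chart fg.
by apply: filterS => x fgx; rewrite /in_charts /= fgp fgx.
Qed.

Lemma mdiff_eq (f g : M -> N) (p : M) : (\forall q \near p, f q = g q) ->
  smooth_at f p -> mdiff g p = mdiff f p.
Proof.
move=> fg [cf sf]; have fgp : f p = g p := nbhs_singleton fg.
rewrite /mdiff.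
have [|//] := @near_eq_diff _ _ _ (in_charts f p) (in_charts g p) _ _
  (smooth_near_differentiable sf).
have := near_chart fg.
by apply: filterS => x fgx; rewrite /in_charts /= fgp fgx.
Qed.

Lemma smooth_at_differentiable (f : M -> N) p : smooth_at f p ->
  differentiable (in_charts f p) (chart_to (chart_at p) p).
Proof. by move=> [_ /smooth_near_differentiable]. Qed.

Lemma mdiffD (f : M -> N) p u v : mdiff f p (u + v) = mdiff f p u + mdiff f p v.
Proof. by rewrite /mdiff linearD. Qed.

Lemma mdiffZ (f : M -> N) p a v : mdiff f p (a *: v) = a *: mdiff f p v.
Proof. by rewrite /mdiff linearZ. Qed.

End OneMap.

Section Composition.
Context {E F G : normedModType R} {M : charted E} {N : charted F} {Q : charted G}.
Hypotheses (cM : has_charts M) (cN : has_charts N).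
Variables (f : M -> N) (g : N -> Q) (p : M).
Hypotheses (sf : smooth_at f p) (sg : smooth_at g (f p)).

Lemma in_charts_comp : \forall x \near chart_to (chart_at p) p,
  (in_charts g (f p) \o in_charts f p) x = in_charts (g \o f) p x.
Proof.
have [cfp fp] := cN (f p).
have : \forall q \near p, chart_dom (chart_at (f p)) (f q).
  by apply: sf.1; apply: open_nbhs_nbhs; split => //; exact: chart_dom_open.
move=> /(near_chart cM); apply: filterS => x dx.
by rewrite /in_charts /=; have [_ ->] := chart_toP cfp dx.
Qed.

Lemma smooth_at_comp : fin_coord F -> smooth_at (g \o f) p.
Proof.
move=> cF; split.
  by apply: continuous_comp; [exact: sf.1|exact: sg.1].
apply: smooth_near_eq in_charts_comp _.
apply: smooth_near_comp => //; first exact: sf.2.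
by rewrite in_charts_center//; exact: sg.2.
Qed.

Lemma mdiff_comp : mdiff (g \o f) p = mdiff g (f p) \o mdiff f p.
Proof.
have df := smooth_at_differentiable sf; have dg := smooth_at_differentiable sg.
rewrite -in_charts_center // in dg.
have [_ dE] := near_eq_diff in_charts_comp (differentiable_comp df dg).
rewrite {1}/mdiff dE.
by rewrite (diff_comp df dg) /mdiff in_charts_center.
Qed.

End Composition.

Section ModelSource.
Context {E F : normedModType R} {N : charted F}.
Hypothesis hN : is_manifold N.
Let cN := has_charts_manifold hN.

Lemma open_transition (p q : N) :
  open (chart_cod (chart_at p) `&` chart_of (chart_at p) @^-1` chart_dom (chart_at q)).
Proof.
have [cp _] := cN p; have [cq _] := cN q.
rewrite openE => x [cx dx].
rewrite /interior; near=> y; split.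
  near: y; apply: open_nbhs_nbhs; split => //; exact: chart_cod_open.
rewrite /=; near: y; apply: (chart_of_cont cp cx).
by apply: open_nbhs_nbhs; split => //; exact: chart_dom_open.
Unshelve. all: by end_near. Qed.

Lemma smooth_near_transition (p q : N) (x : F) :
  chart_cod (chart_at p) x -> chart_dom (chart_at q) (chart_of (chart_at p) x) ->
  smooth_near (chart_to (chart_at q) \o chart_of (chart_at p)) x.
Proof.
move=> cx dx; eexists; last by move=> k; exact: (manifold_compat hN).
by split; first exact: open_transition.
Qed.

Lemma param_smooth_at (p : N) (x : model F) :
  chart_cod (chart_at p) x -> smooth_at (param p : model F -> N) x.
Proof.
have [cp _] := cN p => cx; split; first exact: (chart_of_cont cp cx).
apply: smooth_near_transition => //.
by have [] := cN (param p x).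
Qed.

Hypothesis cF : fin_coord F.

(** The preferred chart at f y varies with y: in_charts f y is in_charts f x
    followed by a change of charts. *)
Lemma smooth_at_near (f : model E -> N) (x : model E) : smooth_at f x ->
  \forall y \near x, smooth_at f y.
Proof.
move=> [cf sf]; have [cfx dfx] := cN (f x).
have nd : nbhs x (f @^-1` chart_dom (chart_at (f x))).
  by apply: cf; apply: open_nbhs_nbhs; split => //; exact: chart_dom_open.
have := smooth_near_near sf.
move: nd; rewrite nbhsE => -[U [oU Ux] Ud] nsf.
have nU : nbhs x U by apply: open_nbhs_nbhs.
near=> y.
have Uy : U y by near: y.
have nUy : nbhs y U by apply: open_nbhs_nbhs.
have sfy : smooth_near (in_charts f x) y by near: y.
have cfy : {for y, continuous (in_charts f x)}.
  exact: differentiable_continuous (smooth_near_differentiable sfy).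
have [cody fyE] := chart_toP cfx (Ud _ Uy).
have fE : \forall z \near y, (chart_of (chart_at (f x)) \o in_charts f x) z = f z.
  near=> z; rewrite /in_charts /=.
  have Uz : U z by near: z.
  by have [_] := chart_toP cfx (Ud _ Uz).
split.
  have h : {for y, continuous (chart_of (chart_at (f x)) \o in_charts f x)}.
    by apply: continuous_comp => //; exact: (chart_of_cont cfx).
  rewrite /prop_for /continuous_at -(nbhs_singleton fE).
  by apply: cvg_trans h; exact: near_eq_cvg.
apply: (@smooth_near_eq _ _ _
   ((chart_to (chart_at (f y)) \o chart_of (chart_at (f x))) \o in_charts f x)).
  near=> z; rewrite [in RHS]/in_charts /=; congr chart_to.
  by near: z; exact: fE.
apply: smooth_near_comp => //; apply: smooth_near_transition => //.
by rewrite /in_charts /= fyE; have [] := cN (f y).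
Unshelve. all: by end_near. Qed.

(** The chart at f x is kept fixed while y moves, so that the coefficients on the
    right are those whose smoothness is part of the definition of a 1-form. *)
Lemma pullback1_in_chart (w : form1 N) (f : model E -> N) (x : model E) :
  smooth_at f x ->
  \forall y \near x, forall v,
    pullback1 f w y v = pullback1 (param (f x)) w (in_charts f x y) ('d (in_charts f x) y v).
Proof.
move=> sfx; have [cf sf] := sfx; have [cfx dfx] := cN (f x).
have nd : nbhs x (f @^-1` chart_dom (chart_at (f x))).
  by apply: cf; apply: open_nbhs_nbhs; split => //; exact: chart_dom_open.
have := smooth_near_near sf.
move: nd; rewrite nbhsE => -[U [oU Ux] Ud] nsf.
have nU : nbhs x U by apply: open_nbhs_nbhs.
near=> y => v.
have Uy : U y by near: y.
have nUy : nbhs y U by apply: open_nbhs_nbhs.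
have sfy : smooth_near (in_charts f x) y by near: y.
have [cody fyE] := chart_toP cfx (Ud _ Uy).
pose g : model E -> model F := in_charts f x.
have sg : smooth_at g y.
  split; last exact: sfy.
  exact: differentiable_continuous (smooth_near_differentiable sfy).
have sp : smooth_at (param (f x) : model F -> N) (g y) by exact: param_smooth_at.
have fE : \forall z \near y, (param (f x) \o g) z = f z.
  near=> z; rewrite /param /g /in_charts /=.
  have Uz : U z by near: z.
  by have [_] := chart_toP cfx (Ud _ Uz).
have cE := @has_charts_model E.
rewrite /pullback1 (mdiff_eq cE fE) -?(nbhs_singleton fE)//; last first.
  apply: smooth_at_comp => //; exact: has_charts_model.
by rewrite (mdiff_comp cE (@has_charts_model F) sg sp).
Unshelve. all: by end_near. Qed.

Lemma is_form1_sum (w : form1 N) (hw : is_form1 w) p (I : finType) (a : I -> R) (e : I -> F) :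
  w p (\sum_i a i *: e i) = \sum_i a i * w p (e i).
Proof.
have w0 : w p 0 = 0.
  have := hw.1 p 1 0 0; rewrite scaler0 add0r mul1r; lra.
elim/big_ind2: _ => // [x u y v <- <-|i _].
  by have := hw.1 p 1 u v; rewrite scale1r mul1r.
by have := hw.1 p (a i) (e i) 0; rewrite !addr0 w0 addr0.
Qed.

Lemma pullback1_sum (w : form1 N) (hw : is_form1 w) (f : model E -> N) x
    (I : finType) (a : I -> R) (e : I -> E) :
  pullback1 f w x (\sum_i a i *: e i) = \sum_i a i * pullback1 f w x (e i).
Proof.
rewrite /pullback1 -(is_form1_sum hw); congr w.
by rewrite /mdiff linear_sum; apply: eq_bigr => i _; rewrite linearZ.
Qed.

End ModelSource.
End SmoothMaps.

(** * The circle as a manifold *)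

Section CircleTheory.
Context {R : realType}.
Local Open Scope complex_scope.
Local Notation circle := (@circle R).
Implicit Types (z w : circle) (s t : R).

Definition cre (z : circle) : R := complex.Re (val z).
Definition cim (z : circle) : R := complex.Im (val z).

Lemma circle_eqP z w : cre z = cre w -> cim z = cim w -> z = w.
Proof.
move=> zr zi; apply: val_inj; apply/eqP; rewrite eq_complex.
by apply/andP; split; apply/eqP; [exact: zr|exact: zi].
Qed.

Lemma circle_sqr z : cre z ^+ 2 + cim z ^+ 2 = 1.
Proof.
have /eqP := valP z; rewrite normc_def => /eqP.
rewrite eq_complex /= eqxx andbT => /eqP h.
by rewrite -[LHS]sqr_sqrtr ?h ?expr1n// addr_ge0// sqr_ge0.
Qed.

Lemma expiD s t : expi (s + t) = circle_mul (expi s) (expi t).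
Proof. by apply: circle_eqP; rewrite /cre /cim /= ?cosD ?sinD; ring. Qed.

Lemma circle_mulC z w : circle_mul z w = circle_mul w z.
Proof. by apply: val_inj; rewrite /= mulrC. Qed.

Lemma circle_mulA z w v : circle_mul z (circle_mul w v) = circle_mul (circle_mul z w) v.
Proof. by apply: val_inj; rewrite /= mulrA. Qed.

Lemma circle_mul1 z : circle_mul z (expi 0) = z.
Proof.
by apply: circle_eqP; rewrite /cre /cim /= cos0 sin0; case: (val z) => a b /=; ring.
Qed.

Lemma polar_angle (x y : R) : x ^+ 2 + y ^+ 2 = 1 ->
  exists2 t, - pi <= t <= pi & x = cos t /\ y = sin t.
Proof.
move=> xy.
have x1 : -1 <= x <= 1 by apply/andP; split; nra.
have cx : cos (acos x) = x by apply: acosK; rewrite in_itv.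
have sx : sin (acos x) = `|y|.
  by rewrite sin_acos// -sqrtr_sqr; congr Num.sqrt; lra.
have := acos_ge0 x1; have := acos_lepi x1 => ap a0.
case: (lerP 0 y) => y0.
  by exists (acos x); [lra|rewrite cx sx ger0_norm].
by exists (- acos x); [lra|rewrite cosN sinN cx sx ltr0_norm// opprK].
Qed.

Lemma expi_surj z : exists2 t, - pi <= t <= pi & z = expi t.
Proof.
by have [t tpi [ct st]] := polar_angle (circle_sqr z); exists t => //; apply: circle_eqP.
Qed.

Lemma expi_cancel s t : circle_mul (expi s) (expi (t - s)) = expi t.
Proof. by rewrite -expiD addrC subrK. Qed.

Lemma principal_arg_expi t : - pi < t < pi -> principal_arg (val (expi t)) = t.
Proof.
move=> tpi; rewrite /principal_arg /=.
have ch : 0 < cos (t / 2) by apply: cos_gt0_pihalf; lra.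
have -> : sin t / (1 + cos t) = tan (t / 2).
  have {1 2}-> : t = (t / 2) *+ 2 by rewrite mulr2n; lra.
  by rewrite sin_mulr2n cos_mulr2n /tan; field; rewrite gt_eqF//; nra.
by rewrite tanK ?in_itv /=; lra.
Qed.

Lemma expi_pi : val (expi pi) = -1 :> R[i].
Proof. by apply/eqP; rewrite eq_complex /= cospi sinpi oppr0 !eqxx. Qed.

Lemma expi_Npi : val (expi (- pi)) = -1 :> R[i].
Proof. by apply/eqP; rewrite eq_complex /= cosN sinN cospi sinpi oppr0 !eqxx. Qed.

Lemma expi_surj_neq z : val z != -1 -> exists2 t, - pi < t < pi & z = expi t.
Proof.
move=> z1; have [t tpi zt] := expi_surj z; exists t => //.
move: tpi; rewrite !le_eqVlt => /andP[] /orP[/eqP h|->] /orP[/eqP h'|->] //;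
  move: z1; rewrite zt; by rewrite -?h ?h' ?expi_pi ?expi_Npi eqxx.
Qed.

Lemma principal_arg_bound (u : R[i]) : - pi < principal_arg u < pi.
Proof.
rewrite /principal_arg.
have := atan_gtNpi2 (complex.Im u / (1 + complex.Re u)).
have := atan_ltpi2 (complex.Im u / (1 + complex.Re u)); lra.
Qed.

Lemma expi_neqN1 t : - pi < t < pi -> val (expi t) != -1 :> R[i].
Proof.
move=> tpi; apply/eqP => h.
have := principal_arg_expi tpi; rewrite h /principal_arg /= oppr0 mul0r atan0 mulr0 => t0.
by have := congr1 (@complex.Re R) h; rewrite -t0 /= cos0; lra.
Qed.

Lemma circle_div z w : exists v : circle, circle_mul z v = w.
Proof.
have [s _ ->] := expi_surj z; have [t _ ->] := expi_surj w.
by exists (expi (t - s)); rewrite expi_cancel.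
Qed.

Lemma circle_neq0 z : val z != 0 :> R[i].
Proof. by apply: contraTneq (valP z) => /= ->; rewrite normr0 eq_sym oner_eq0. Qed.

Lemma circle_divE z w v : circle_mul z v = w -> val w / val z = val v :> R[i].
Proof. by move=> <-; rewrite /= mulrAC mulfV ?mul1r//; exact: circle_neq0. Qed.

Lemma expi_div s t : val (expi s) / val (expi t) = val (expi (s - t)) :> R[i].
Proof.
by apply: circle_divE; exact: expi_cancel.
Qed.

Lemma circle_neq_opp z w v : circle_mul z v = w -> (val w != - val z) = (val v != -1).
Proof.
move=> <- /=.
have -> : - sval z = sval z * -1 by rewrite mulrN1.
by rewrite (inj_eq (mulfI (circle_neq0 z))).
Qed.

Lemma cvg_circle (T : Type) (F : set_system T) (f : T -> circle) z : Filter F ->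
  (cre (f x) @[x --> F] --> cre z) ->
  (cim (f x) @[x --> F] --> cim z) ->
  f x @[x --> F] --> z.
Proof.
move=> FF fr fi.
have fp : circle_coord (f x) @[x --> F] --> circle_coord z.
  by apply: (@cvg_pair _ _ _ F (nbhs (cre z : R^o)) (nbhs (cim z : R^o))).
move=> A; rewrite nbhsE => -[B [[C oC <-] Cz] BA].
apply: (@filterS _ F _ (f @^-1` (circle_coord @^-1` C))) => [x /BA//|].
by apply: fp; apply: open_nbhs_nbhs.
Qed.

Lemma circle_Re_continuous : continuous (fun z => cre z : R).
Proof.
move=> z; apply: (@continuous_comp circle (R^o * R^o)%type R^o (circle_coord (R := R)) fst z).
  exact: initial_continuous.
exact: cvg_fst.
Qed.

Lemma circle_Im_continuous : continuous (fun z => cim z : R).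
Proof.
move=> z; apply: (@continuous_comp circle (R^o * R^o)%type R^o (circle_coord (R := R)) snd z).
  exact: initial_continuous.
exact: cvg_snd.
Qed.

Lemma expi_continuous : continuous (expi : R -> circle).
Proof.
by move=> t; apply: cvg_circle => /=; [exact: continuous_cos|exact: continuous_sin].
Qed.

Lemma circle_mulRe z w : cre (circle_mul z w) =
  cre z * cre w - cim z * cim w.
Proof. by case: z => -[a b] za; case: w => -[c d] wc. Qed.

Lemma circle_mulIm z w : cim (circle_mul z w) =
  cre z * cim w + cim z * cre w.
Proof. by case: z => -[a b] za; case: w => -[c d] wc. Qed.

Lemma circle_mul_continuous (T : topologicalType) (f g : T -> circle) x :
  {for x, continuous f} -> {for x, continuous g} ->
  {for x, continuous (fun y => circle_mul (f y) (g y))}.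
Proof.
move=> cf cg.
have rf := continuous_comp cf (@circle_Re_continuous (f x)).
have if_ := continuous_comp cf (@circle_Im_continuous (f x)).
have rg := continuous_comp cg (@circle_Re_continuous (g x)).
have ig := continuous_comp cg (@circle_Im_continuous (g x)).
apply: cvg_circle.
  rewrite circle_mulRe; under eq_fun do rewrite circle_mulRe.
  by apply: cvgB; apply: cvgM.
rewrite circle_mulIm; under eq_fun do rewrite circle_mulIm.
by apply: cvgD; apply: cvgM.
Qed.

Lemma principal_arg_continuous (T : topologicalType) (q : T -> circle) x :
  {for x, continuous q} -> 1 + cre (q x) != 0 ->
  {for x, continuous (fun y => principal_arg (val (q y)) : R)}.
Proof.
move=> cq nq.
have rq := continuous_comp cq (@circle_Re_continuous (q x)).
have iq := continuous_comp cq (@circle_Im_continuous (q x)).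
have cr : cim (q y) / (1 + cre (q y)) @[y --> x] -->
    cim (q x) / (1 + cre (q x)).
  apply: cvgM => //; apply: cvgV => //; apply: cvgD => //; exact: cvg_cst.
apply: cvgM; first exact: cvg_cst.
apply: cvg_comp cr _; exact: continuous_atan.
Qed.

Lemma circle_oppE z w : (val w == - val z) =
  (cre w == - cre z) && (cim w == - cim z).
Proof. by rewrite eq_complex; case: z => -[a b] za. Qed.

(** Rotating by the inverse of z reduces the chart at z to the principal argument,
    which is continuous away from -1. *)
Lemma has_charts_S1 : has_charts (S1 R).
Proof.
move=> z; split; last first.
  have h := circle_neq_opp (circle_mul1 z); rewrite /= h.
  by apply: expi_neqN1; have := @pi_gt0 R; lra.
split => /=.
- rewrite openE => w; rewrite /= circle_oppE negb_and => /orP[rz|iz].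
    have : \forall y \near w, cre y != - cre z.
      have := @circle_Re_continuous w; move=> /(_ [set x | x != - cre z]); apply.
      exact: open_nbhs_nbhs (conj (@open_neq _ _) rz).
    by apply: filterS => y yz; rewrite /= circle_oppE (negbTE yz).
  have : \forall y \near w, cim y != - cim z.
    have := @circle_Im_continuous w; move=> /(_ [set x | x != - cim z]); apply.
    exact: open_nbhs_nbhs (conj (@open_neq _ _) iz).
  by apply: filterS => y yz; rewrite /= circle_oppE (negbTE yz) andbF.
- rewrite (_ : [set t : R^o | _] = `](- pi), pi[%classic); last first.
    by apply/seteqP; split => t /=; rewrite in_itv.
  exact: interval_open.
- move=> w wz; split; first exact: principal_arg_bound.
  have [v vE] := circle_div z w; rewrite (circle_divE vE).
  move: wz; rewrite (circle_neq_opp vE) => /expi_surj_neq[t tpi vt].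
  by rewrite vt principal_arg_expi// -vt.
- move=> t tpi; split.
    exact: (etrans (circle_neq_opp (erefl (circle_mul z (expi t)))) (expi_neqN1 tpi)).
  have -> : sval z * (cos t +i* sin t) / sval z = val (expi t).
    exact: (circle_divE (erefl (circle_mul z (expi t)))).
  exact: principal_arg_expi.
- move=> w wz.
  have [s _ zs] := expi_surj z.
  pose q w' := circle_mul w' (expi (- s)).
  have qE w' : val w' / val z = val (q w').
    by have [t _ ->] := expi_surj w'; rewrite zs expi_div /q -expiD.
  rewrite (_ : (fun _ => _) = fun w' => principal_arg (val (q w')) : R^o); last first.
    by apply/funext => w'; rewrite qE.
  have cq : {for w, continuous q}.
    apply: (@circle_mul_continuous circle id (cst (expi (- s))) w).
      by move=> A.
    exact: cst_continuous.
  have nq : 1 + cre (q w) != 0.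
    have qw : circle_mul z (q w) = w.
      by rewrite zs circle_mulC /q -circle_mulA -expiD addNr circle_mul1.
    move: wz; rewrite (circle_neq_opp qw) => qN.
    apply/eqP => h; move/negP: qN; apply; rewrite eq_complex /=.
    have := circle_sqr (q w); rewrite (_ : complex.Re _ = -1); last by lra.
    move=> h2; rewrite eqxx /= oppr0; apply/eqP; nra.
  exact: principal_arg_continuous.
- move=> t _; apply: (@circle_mul_continuous R^o (cst z) expi t); first exact: cst_continuous.
  exact: expi_continuous.
Qed.

End CircleTheory.

(** * Elementary smooth maps and tangent maps *)

Section SmoothExamples.
Context {R : realType}.

Lemma smooth_at_model (E F : normedModType R) (f : model E -> model F) (x : E) :
  smooth_near (f : E -> F) x -> smooth_at f x.
Proof.
move=> sf; split; last exact: sf.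
exact: (differentiable_continuous (smooth_near_differentiable sf)).
Qed.

Lemma mdiff_model (E F : normedModType R) (f : model E -> model F) (x : E) :
  mdiff f x = 'd (f : E -> F) x.
Proof. by []. Qed.

Section Maps.
Context {E F G : normedModType R} {M : charted E} {N : charted F} {Q : charted G}.
Hypotheses (cM : has_charts M) (cN : has_charts N).

Lemma smooth_at_cst (q : N) (p : M) : smooth_at (cst q : M -> N) p.
Proof.
split; first exact: cst_continuous.
exact: (smooth_near_cst (chart_to (chart_at q) q)).
Qed.

Lemma smooth_at_id (p : M) : smooth_at (id : M -> M) p.
Proof.
split; first exact: cvg_id.
have [cp pp] := cM p.
apply: (@smooth_near_eq _ _ _ idfun); last by apply: smooth_near_lin => x; exact: cvg_id.
have := open_nbhs_nbhs (conj (chart_cod_open cp) (chart_toP cp pp).1).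
by apply: filterS => x /(chart_ofP cp)[_ e]; rewrite /in_charts /= e.
Qed.

Lemma mdiff_cst (q : N) (p : M) v : mdiff (cst q : M -> N) p v = 0.
Proof.
rewrite /mdiff (_ : in_charts _ _ = cst (chart_to (chart_at q) q)) //.
by rewrite diff_cst.
Qed.

Lemma smooth_at_pair (f : M -> N) (g : M -> Q) p : smooth_at f p -> smooth_at g p ->
  smooth_at (fun x => (f x, g x) : mprod N Q) p.
Proof.
move=> [cf sf] [cg sg]; split; first exact: cvg_pair.
exact: smooth_near_pair.
Qed.

Lemma mdiff_pair (f : M -> N) (g : M -> Q) p v : smooth_at f p -> smooth_at g p ->
  mdiff (fun x => (f x, g x) : mprod N Q) p v = (mdiff f p v, mdiff g p v).
Proof.
move=> /smooth_at_differentiable df /smooth_at_differentiable dg.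
exact: (congr1 (fun h => h v) (diff_pair df dg)).
Qed.

Lemma smooth_at_snd (p : mprod M N) : smooth_at (snd : mprod M N -> N) p.
Proof.
split; first exact: cvg_snd.
apply: (@smooth_near_eq _ _ _ snd); last first.
  by apply: smooth_near_lin => x; exact: cvg_snd.
have [cp pp] := cN p.2.
exists (setT, chart_cod (chart_at p.2)) => /=.
  split; first exact: filterT.
  apply: open_nbhs_nbhs; split; first exact: chart_cod_open.
  by have [] := chart_toP cp pp.
by move=> [a b] [/= _ cb]; have [_ e] := chart_ofP cp cb; rewrite /in_charts /= e.
Qed.

End Maps.

Lemma smooth_near_subr (c x : R^o) : smooth_near (fun t : R^o => t - c : R^o) x.
Proof.
apply: (@smooth_nearD _ _ _ idfun (cst (- c))); last exact: smooth_near_cst.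
by apply: smooth_near_lin => t; exact: cvg_id.
Qed.

Lemma diff_subr (E : normedModType R) (w : E -> R^o) (c : R^o) x : differentiable w x ->
  'd (fun y => w y - c : R^o) x = 'd w x :> (E -> R^o).
Proof.
move=> dw; have h : is_diff x w ('d w x) by split.
by have [_ ->] := @is_diffB _ _ _ w (cst c) ('d w x) 0 x h _; rewrite subr0.
Qed.

Lemma near_abs_lt (t e : R) : 0 < e -> \forall s \near (t : R^o), `|s - t| < e.
Proof.
move=> e0; have := nbhsx_ballx (t : R^o) e e0.
by apply: filterS => s; rewrite /ball /= distrC.
Qed.

Lemma smooth_at_expi (t : model R^o) : smooth_at (expi : model R^o -> S1 R) t.
Proof.
split; first exact: expi_continuous.
apply: smooth_near_eq (smooth_near_subr t t).
have := near_abs_lt t (@pi_gt0 R); apply: filterS => s st.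
rewrite /in_charts; apply/esym.
have := expi_div s t => h.
transitivity (principal_arg (val (expi s) / val (expi t))); first by [].
by rewrite h principal_arg_expi // -ltr_norml.
Qed.

End SmoothExamples.

(** * Chaining along an interval *)

(** Cousin's principle for a property of intervals that is additive and holds for
    small intervals: the supremum of the points reached from a is reached itself,
    and a local interval around it would pass beyond it unless it is b. It does
    the work of a subdivision into finitely many small intervals. *)
Lemma interval_chain {R : realType} (Q : R -> R -> Prop) (a b : R) : a <= b ->
  (forall c d e, a <= c -> c <= d -> d <= e -> e <= b -> Q c d -> Q d e -> Q c e) ->
  (forall t, a <= t <= b -> exists2 e, 0 < e & forall c d, a <= c -> c <= t <= d ->
     d <= b -> t - e < c -> d < t + e -> Q c d) ->
  Q a b.
Proof.
move=> ab trans loc.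
have [e0 e0_gt0 h0] := loc a ltac:(by rewrite lexx ab).
pose S := [set t | a <= t <= b /\ Q a t].
have Sa : S a by split; [rewrite lexx ab|apply: h0; rewrite ?lexx//; lra].
have ubS : has_sup S by split; [exists a|exists b => t [/andP[]]].
have aS : a <= sup S by apply: sup_upper_bound.
have Sb : sup S <= b by apply: sup_le_ub; [exists a|move=> t [/andP[]]].
have [e e_gt0 he] := loc (sup S) ltac:(by rewrite aS Sb).
have [t [/andP[at_ tb] Qat] tS] := sup_adherent e_gt0 ubS.
have tleS : t <= sup S by apply: sup_upper_bound => //; split=> //; rewrite at_ tb.
have QaS : Q a (sup S).
  by apply: (trans a t (sup S)) => //; apply: he => //; rewrite ?tleS ?lexx//; lra.
have [->//|Sltb] := eqVneq b (sup S).
have {}Sltb : sup S < b by rewrite lt_neqAle eq_sym Sltb.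
pose d := Num.min b (sup S + e / 2).
have Sd : sup S < d by rewrite lt_min Sltb; lra.
have db : d <= b by rewrite ge_min lexx.
have de : d < sup S + e by rewrite gt_min; apply/orP; right; lra.
have : d <= sup S.
  apply: sup_upper_bound => //; split; first by rewrite db (le_trans aS (ltW Sd)).
  apply: (trans a (sup S) d) => //; first exact: ltW.
  by apply: he => //; rewrite ?lexx ?(ltW Sd)//; lra.
by rewrite leNgt Sd.
Qed.

(** * Circle bundles and gauge transformations *)

Section CircleBundle.
Context {R : realType} {E F : normedModType R} {M : charted E} {P : charted F}.
Variables (proj : P -> M) (act : P -> S1 R -> P) (phi : form1 P).
Hypotheses (cE0 : fin_coord E) (cF : fin_coord F).
Hypotheses (hM : is_manifold M) (hP : is_manifold P).
Hypotheses (hb : is_circle_bundle proj act) (hphi : is_connection act phi).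
Let cM := has_charts_manifold hM.
Let cP := has_charts_manifold hP.

Lemma act1 p : act p (expi 0) = p. Proof. by case: hb. Qed.

Lemma actA p z w : act (act p z) w = act p (circle_mul z w).
Proof. by case: hb => _ _ _ -> . Qed.

Lemma actD p s t : act p (expi (s + t)) = act (act p (expi s)) (expi t).
Proof. by rewrite expiD actA. Qed.

Lemma phiD p u v : phi p (u + v) = phi p u + phi p v.
Proof. by have [[h _] _ _] := hphi; have := h p 1 u v; rewrite scale1r mul1r. Qed.

Lemma phi0 p : phi p 0 = 0.
Proof. by have := phiD p 0 0; rewrite addr0; lra. Qed.

Lemma phiZ p a v : phi p (a *: v) = a * phi p v.
Proof. by have [[h _] _ _] := hphi; have := h p a v 0; rewrite !addr0 phi0 addr0. Qed.

Lemma act_smooth x : smooth_at (fun x : mprod P (S1 R) => act x.1 x.2) x.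
Proof. by case: hb => _ + _ _ _; apply. Qed.

Lemma proj_smooth p : smooth_at proj p.
Proof. by case: hb => + _ _ _ _; apply. Qed.

Lemma act_expi_smooth p (t : model R^o) :
  smooth_at (fun t : model R^o => act p (expi t)) t.
Proof.
have h : smooth_at (fun s : model R^o => (p, expi s) : mprod P (S1 R)) t.
  by apply: smooth_at_pair; [exact: smooth_at_cst|exact: smooth_at_expi].
exact: (smooth_at_comp (@has_charts_model R R^o) (has_charts_prod cP (@has_charts_S1 R))
  h (act_smooth _) (fin_coord_prod cF (@fin_coordR R))).
Qed.

(** The trivializations only see points lying over their domain, so a small
    rotation preserves the fiber by continuity, and any rotation is reached by
    small ones. *)
Lemma proj_act p z : proj (act p z) = proj p.
Proof.
have near_act q : \forall t \near (0 : R), proj (act q (expi t)) = proj q.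
  have [_ _ _ _ loc] := hb; have [U [oU Up] [triv [inv [_ _ h1 _ h3]]]] := loc (proj q).
  have c0 : proj (act q (expi t)) @[t --> (0:R)] --> proj (act q (expi 0)).
    by apply: (@continuous_comp R^o P M); [exact: (act_expi_smooth q 0).1|exact: (proj_smooth _).1].
  rewrite act1 in c0.
  have : nbhs (0 : R) [set t | U (proj (act q (expi t)))].
    by apply: c0; apply: open_nbhs_nbhs.
  apply: filterS => t Ut.
  by have [<- _] := h1 _ Ut; rewrite h3.
have near_act' (t : R) : exists2 e, 0 < e & forall s, `|s - t| < e ->
    proj (act p (expi s)) = proj (act p (expi t)).
  have /nbhs_ballP[e /= e0 he] := near_act (act p (expi t)).
  exists e => // s st.
  have := he (s - t); rewrite /ball /= sub0r normrN => /(_ st).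
  by rewrite -actD (addrC t) subrK.
have step (s t : R) : s <= t -> proj (act p (expi t)) = proj (act p (expi s)).
  move=> st; pose Q (c d : R) := proj (act p (expi d)) = proj (act p (expi c)).
  apply: (@interval_chain R Q s t st) => [c d e _ _ _ _ q1 q2|u _]; first by rewrite /Q q2.
  have [e e0 he] := near_act' u; exists e => // c d _ cud _ uc du.
  by rewrite /Q !he// ltr_norml; lra.
have [t _ ->] := expi_surj z; rewrite -[in RHS](act1 p).
by case: (lerP 0 t) => [/step//|/ltW/step/esym].
Qed.

Lemma circle_mul_inj (z w w' : S1 R) : circle_mul z w = circle_mul z w' -> w = w'.
Proof.
have [t _ ->] := expi_surj z => /(congr1 (circle_mul (expi (- t)))).
by rewrite !circle_mulA -expiD addNr ![circle_mul (expi 0) _]circle_mulC !circle_mul1.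
Qed.

Lemma act_free p z w : act p z = act p w -> z = w.
Proof.
have [_ _ _ _ loc] := hb; have [U [oU Up] [triv [inv [_ _ _ _ h3]]]] := loc (proj p).
move=> /(congr1 triv); rewrite !h3// => e; exact: circle_mul_inj (congr1 snd e).
Qed.

(** The angle is the difference of the circle coordinates of f and h in a local
    trivialization, lifted to the line by charts of the circle. Only points where
    the projections agree are compared, so that curves that lie over each other on
    a closed interval can be compared at its endpoints as well. *)
Lemma local_angle (E' : normedModType R) (f h : model E' -> P) (x : model E') :
  smooth_at f x -> smooth_at h x -> proj (f x) = proj (h x) ->
  exists2 k : E' -> R^o, smooth_near k x &
    \forall y \near x, proj (f y) = proj (h y) -> f y = act (h y) (expi (k y)).
Proof.
move=> sf sh fhx.
have [_ _ _ _ loc] := hb; have [U [oU Up] [triv [inv [st _ h1 _ h3]]]] := loc (proj (f x)).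
have cE := @has_charts_model R E'.
have angle (g : model E' -> P) : smooth_at g x -> U (proj (g x)) ->
    exists2 a : E' -> R^o, smooth_near a x & \forall y \near x,
      U (proj (g y)) /\ (triv (g y)).2 = circle_mul (triv (g x)).2 (expi (a y)).
  move=> sg Ug.
  have s1 : smooth_at (triv \o g) x.
    by apply: (smooth_at_comp cE cP sg _ cF); exact: st.
  have s2 : smooth_at (snd \o (triv \o g) : model E' -> S1 R) x.
    apply: (smooth_at_comp cE (has_charts_prod cM (@has_charts_S1 R)) s1).
      by apply: smooth_at_snd; exact: has_charts_S1.
    exact: (fin_coord_prod cE0 (@fin_coordR R)).
  exists (in_charts (snd \o (triv \o g) : model E' -> S1 R) x); first exact: s2.2.
  have n1 : nbhs x [set y | U (proj (g y))].
    have : {for x, continuous (proj \o g)}.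
      by apply: continuous_comp; [exact: sg.1|exact: (proj_smooth _).1].
    by apply; apply: open_nbhs_nbhs.
  have [ct dt] := @has_charts_S1 R (triv (g x)).2.
  have n2 : nbhs x [set y | chart_dom (chart_at (triv (g x)).2) (triv (g y)).2].
    by apply: s2.1; apply: open_nbhs_nbhs; split => //; exact: (chart_dom_open ct).
  apply: filterS2 n1 n2 => y Ugy dy; split => //.
  by have [_ e] := chart_toP ct dy; exact: (esym e).
have [af saf naf] := angle f sf Up.
have [ah sah nah] := angle h sh ltac:(by rewrite -fhx).
have [v vE] := circle_div (triv (h x)).2 (triv (f x)).2.
have [k0 _ vk0] := expi_surj v.
exists (fun y => (k0 + af y) + (- 1) *: ah y : R^o).
  apply: smooth_nearD; first by apply: smooth_nearD => //; exact: (smooth_near_cst (k0 : R^o)).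
  by apply: smooth_nearZ => //; exact: (smooth_near_cst (-1 : R^o)).
apply: filterS2 naf nah => y [Uf ef] [Uh eh] fhy.
have [tf1 tfK] := h1 _ Uf.
have Ua : U (proj (act (h y) (expi (k0 + af y + - 1 *: ah y)))) by rewrite proj_act.
have [_ taK] := h1 _ Ua.
rewrite -tfK -taK h3// eh -fhy -tf1.
rewrite -circle_mulA -expiD (_ : ah y + (k0 + af y + - 1 *: ah y) = k0 + af y); last first.
  by rewrite scaleN1r addrC subrK.
by rewrite expiD circle_mulA -vk0 vE -ef; case: (triv _).
Qed.

Section Twist.
Context {E' : normedModType R}.
Variables (f : model E' -> P) (w : E' -> R^o) (x : model E').
Hypotheses (sf : smooth_at f x) (sw : smooth_near w x).

Let cME' := @has_charts_model R E'.
Let cMR := @has_charts_model R R^o.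
Let cPS := has_charts_prod cP (@has_charts_S1 R).
Let fR := @fin_coordR R.

Let swm : smooth_at (w : model E' -> model R^o) x := smooth_at_model sw.

Let sexp : smooth_at (fun y : model E' => expi (w y) : S1 R) x.
Proof.
exact: (smooth_at_comp cME' cMR swm (smooth_at_expi (w x)) fR).
Qed.

Lemma twist_smooth_at : smooth_at (fun y : model E' => act (f y) (expi (w y))) x.
Proof.
apply: (smooth_at_comp cME' cPS (smooth_at_pair sf sexp) (act_smooth _)).
exact: fin_coord_prod.
Qed.

Lemma twist_mdiff v : mdiff (fun y : model E' => act (f y) (expi (w y))) x v =
  mdiff (fun y : model E' => act (f y) (expi (w x))) x v +
  mdiff (fun y : model E' => act (f x) (expi (w y))) x v.
Proof.
have sc : smooth_at (fun y : model E' => expi (w x) : S1 R) x by exact: (smooth_at_cst (N := S1 R)).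
have sd : smooth_at (fun y : model E' => f x) x by exact: (smooth_at_cst (N := P)).
have e1 := mdiff_comp cME' cPS (smooth_at_pair sf sexp) (act_smooth _).
have e2 := mdiff_comp cME' cPS (smooth_at_pair sf sc) (act_smooth _).
have e3 := mdiff_comp cME' cPS (smooth_at_pair sd sexp) (act_smooth _).
have /= -> := congr1 (fun h => h v) e1.
have /= -> := congr1 (fun h => h v) e2.
have /= -> := congr1 (fun h => h v) e3.
rewrite !mdiff_pair// -mdiffD.
by rewrite /= !mdiff_cst; congr mdiff; congr pair; rewrite ?addr0 ?add0r.
Qed.

(** The gauge transformation rule. The map factors through the action: the
    derivative in the direction of P leaves phi unchanged by invariance, and the
    derivative in the direction of the fiber is 'd w times the fundamental vector
    field, on which phi is 1. *)
Lemma twist_pullback v :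
  pullback1 (fun y : model E' => act (f y) (expi (w y))) phi x v =
  pullback1 f phi x v + 'd w x v.
Proof.
have [_ hd hinv] := hphi.
rewrite /pullback1 twist_mdiff phiD; congr (_ + _).
  have sa q : smooth_at (fun p => act p (expi (w x))) q.
    have h : smooth_at (fun p : P => (p, expi (w x)) : mprod P (S1 R)) q.
      apply: (@smooth_at_pair _ _ _ _ P P (S1 R) id (cst (expi (w x)))).
        exact: smooth_at_id.
      exact: smooth_at_cst.
    exact: (smooth_at_comp cP cPS h (act_smooth _) (fin_coord_prod cF fR)).
  have /= -> := congr1 (fun h => h v) (mdiff_comp cME' cP sf (sa _)).
  have := congr1 (fun h => h (f x) (mdiff f x v)) (hinv (expi (w x))).
  by rewrite /pullback1.
pose q := act (f x) (expi (w x)).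
pose k (s : model R^o) := act q (expi s).
pose w' : model E' -> model R^o := fun y => w y - w x.
have kE : (fun y : model E' => act (f x) (expi (w y))) = k \o w'.
  by apply/funext => y; rewrite /k /q /= -actD; congr (act _ (expi _)); rewrite /w'; lra.
have sw' : smooth_at w' x.
  apply: smooth_at_model; rewrite /w'.
  by apply: (@smooth_nearD _ _ _ w (cst (- w x))) => //; exact: smooth_near_cst.
have w'x : w' x = 0 by rewrite /w' subrr.
have sk : smooth_at k 0.
  have h : smooth_at (fun s : model R^o => (q, expi s) : mprod P (S1 R)) 0.
    by apply: smooth_at_pair; [exact: smooth_at_cst|exact: smooth_at_expi].
  exact: (smooth_at_comp cMR cPS h (act_smooth _) (fin_coord_prod cF fR)).
have sk' : smooth_at k (w' x) by rewrite w'x.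
rewrite kE (mdiff_comp cME' cMR sw' sk') /= w'x mdiff_model.
have -> : 'd w' x v = 'd w x v.
  by rewrite (diff_subr (w x) (smooth_near_differentiable sw)).
rewrite -[in LHS](mulr1 ('d w x v)) -[_ * 1]/(_ *: (1 : R^o)) mdiffZ phiZ.
have := hd q; rewrite /d_theta /velocity -/k => ->.
by rewrite mulr1.
Qed.

End Twist.
End CircleBundle.

(** * Exterior derivative of a pullback *)

Section Schwarz.
Context {R : realType}.
Implicit Types (E : normedModType R).

Lemma is_derive_path E (f : E -> R^o) (c : R -> E) (t : R) (v : E) :
  differentiable f (c t) -> is_diff (t : R^o) (c : R^o -> E) (fun s : R^o => s *: v) ->
  is_derive (t : R^o) 1 (f \o c : R^o -> R^o) ('d f (c t) v).
Proof.
move=> df [dc dcE].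
have dfc : differentiable (f \o c : R^o -> R^o) (t : R^o) by exact: differentiable_comp.
apply: DeriveDef; first by apply/derivable1_diffP.
by rewrite deriveE// (diff_comp dc df) /= dcE scale1r.
Qed.

Lemma is_diff_line E (p u : E) (t : R^o) :
  is_diff t (fun s : R^o => p + s *: u) (fun s : R^o => s *: u).
Proof.
have h : is_diff t (fun s : R^o => s *: u) (fun s : R^o => s *: u).
  exact: (@is_diff_scalel R E t u).
have [d1 d2] := @is_diffD _ _ _ (cst p) (fun s : R^o => s *: u) 0 (fun s : R^o => s *: u) t _ h.
apply: DiffDef; first exact: d1.
by rewrite [LHS]d2 add0r.
Qed.

Lemma is_derive_line E (f : E -> R^o) (p u : E) (t : R) :
  differentiable f (p + t *: u) ->
  is_derive (t : R^o) 1 (fun s : R^o => f (p + s *: u) : R^o) ('d f (p + t *: u) u).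
Proof. by move=> df; apply: (is_derive_path df); exact: is_diff_line. Qed.

Lemma mvt_line E (f : E -> R^o) (p u : E) (h : R) : 0 < h ->
  (forall t, 0 <= t <= h -> differentiable f (p + t *: u)) ->
  exists2 t, 0 <= t <= h & f (p + h *: u) - f p = 'd f (p + t *: u) u * h.
Proof.
move=> h0 df.
have dfl t : 0 <= t <= h -> is_derive (t : R^o) 1 (fun s : R^o => f (p + s *: u) : R^o) ('d f (p + t *: u) u).
  by move=> /df; exact: is_derive_line.
have [||t th] := @MVT_segment R (fun s => f (p + s *: u)) (fun t => 'd f (p + t *: u) u) 0 h (ltW h0).
- by move=> t; rewrite in_itv /= => /andP[t0 t1]; apply: dfl; rewrite !ltW.
- apply: derivable_within_continuous => t; rewrite in_itv /= => th.
  by have [] := dfl t th.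
by rewrite scale0r addr0 subr0 => ->; exists t => //; move: th; rewrite in_itv.
Qed.

(** The mean value theorem twice, in the direction u and then in the direction v. *)
Lemma second_difference E (f : E -> R^o) (x u v : E) (h : R) : 0 < h ->
  (forall s t, 0 <= s <= h -> 0 <= t <= h ->
     differentiable f (x + s *: u + t *: v) /\
     differentiable (fun y => 'd f y u) (x + s *: u + t *: v)) ->
  exists s t, [/\ 0 <= s <= h, 0 <= t <= h &
    f (x + h *: u + h *: v) - f (x + h *: u) - (f (x + h *: v) - f x) =
    'd (fun y => 'd f y u) (x + s *: u + t *: v) v * h * h].
Proof.
move=> h0 df.
have hh : 0 <= h <= h by rewrite lexx ltW.
have h00 : (0:R) <= 0 <= h by rewrite lexx ltW.
pose g y := f (y + h *: v) - f y.
have dg (s : R) : 0 <= s <= h -> is_diff (x + s *: u) (g : E -> R^o)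
    (fun w => 'd f (x + s *: u + h *: v) w - 'd f (x + s *: u) w).
  move=> sh.
  have [d1 _] := df s h sh hh; have [d0 _] := df s 0 sh h00.
  rewrite scale0r addr0 in d0.
  have sd : is_diff (x + s *: u) (fun y => y + h *: v) id.
    have [a1 a2] := @is_diffD _ _ _ id (cst (h *: v)) id 0 (x + s *: u) _ _.
    by apply: DiffDef; [exact: a1|rewrite [LHS]a2 addr0].
  have [sd1 sd2] := sd.
  have dc := differentiable_comp sd1 d1.
  have dcE := diff_comp sd1 d1.
  apply: DiffDef; first exact: (differentiableB dc d0).
  transitivity ('d (f \o (fun y => y + h *: v)) (x + s *: u) \- 'd f (x + s *: u) : E -> R^o).
    exact: (diffB dc d0).
  by rewrite dcE sd2.
have [|s sh gE] := @mvt_line E g x u h h0; first by move=> t /dg[].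
have [_ dgE] := dg s sh; rewrite dgE in gE.
have [|t th aE] := @mvt_line E (fun y => 'd f y u) (x + s *: u) v h h0.
  by move=> t th; have [] := df s t sh th.
by exists s, t; split => //; rewrite -aE -gE /g.
Qed.

(** Both sides are limits of the second difference quotient over a small square. *)
Lemma diff_sym E (f : E -> R^o) (x u v : E) : smooth_near f x ->
  'd (fun y => 'd f y u) x v = 'd (fun y => 'd f y v) x u.
Proof.
move=> sf.
have su := smooth_near_derive u sf; have sv := smooth_near_derive v sf.
have cu := differentiable_continuous (smooth_near_differentiable (smooth_near_derive v su)).
have cv := differentiable_continuous (smooth_near_differentiable (smooth_near_derive u sv)).
set a := LHS; set b := RHS.
apply/eqP; rewrite -subr_eq0 -normr_le0; apply/ler_addgt0Pl => e e0; rewrite addr0.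
have e20 : 0 < e / 2 by lra.
have : \forall y \near x, [/\ differentiable f y, differentiable (fun y => 'd f y u) y,
    differentiable (fun y => 'd f y v) y,
    `|a - 'd (fun y => 'd f y u) y v| < e / 2 &
    `|b - 'd (fun y => 'd f y v) y u| < e / 2].
  near=> y; split; near: y.
  - exact: smooth_near_diff.
  - exact: smooth_near_diff.
  - exact: smooth_near_diff.
  - by move/cvgrPdist_lt: cu; apply.
  - by move/cvgrPdist_lt: cv; apply.
move=> /nbhs_ballP[r /= r0 rP].
pose h := r / 2 / (1 + `|u| + `|v|).
have nuv : 0 < 1 + `|u| + `|v| by have := normr_ge0 u; have := normr_ge0 v; lra.
have h0 : 0 < h by rewrite /h !divr_gt0.
have near_sq s t : 0 <= s <= h -> 0 <= t <= h -> ball x r (x + s *: u + t *: v).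
  move=> /andP[s0 sh] /andP[t0 th].
  rewrite -ball_normE /ball_ /= opprD opprD addrA addrA subrr add0r -opprD normrN.
  apply: le_lt_trans (ler_normD _ _) _.
  rewrite !normrZ (ger0_norm s0) (ger0_norm t0).
  apply: (@le_lt_trans _ _ (h * (1 + `|u| + `|v|))).
    by have := normr_ge0 u; have := normr_ge0 v; nra.
  by rewrite /h divfK ?gt_eqF//; lra.
have [s [t [sh th E1]]] := @second_difference E f x u v h h0
  (fun s t sh th => let: And5 p1 p2 p3 p4 p5 := rP _ (near_sq s t sh th) in conj p1 p2).
have [|t' [s' [th' sh' E2]]] := @second_difference E f x v u h h0.
  by move=> t' s' th' sh'; rewrite addrAC; have [] := rP _ (near_sq s' t' sh' th').
rewrite (addrAC x (h *: v)) (addrAC x (t' *: v)) in E2.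
have hE : 'd (fun y => 'd f y u) (x + s *: u + t *: v) v = 'd (fun y => 'd f y v) (x + s' *: u + t' *: v) u.
  apply: (mulIf (lt0r_neq0 h0)); apply: (mulIf (lt0r_neq0 h0)).
  by rewrite -E1 -E2; ring.
have [_ _ _ A1 _] := rP _ (near_sq s t sh th).
have [_ _ _ _ A2] := rP _ (near_sq s' t' sh' th').
rewrite hE in A1.
have := ler_distD ('d (fun y => 'd f y v) (x + s' *: u + t' *: v) u) a b.
rewrite [X in _ <= _ + X -> _]distrC => H; apply: (le_trans H); lra.
Unshelve. all: by end_near. Qed.

End Schwarz.

Section PullbackOfForms.
Context {R : realType} {E F G : normedModType R} {N : charted F} {M : charted G}.
Hypotheses (cF : fin_coord F) (hN : is_manifold N).
Let cN := has_charts_manifold hN.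

Variable (w : form1 N).
Hypothesis (hw : is_form1 w).

Section AtPoint.
Variables (f : model E -> N) (x : model E).
Hypothesis (sf : smooth_at f x).

Let f' : E -> F := in_charts f x.
Let y0 := chart_to (chart_at (f x)) (f x).
Lemma in_chartsx : f' x = y0. Proof. exact: (in_charts_center (@has_charts_model R E) f x). Qed.

Lemma param_sum (I : finType) (l : I -> F -> R^o) (e : I -> F) : (forall v, v = \sum_j l j v *: e j) ->
  forall y v, pullback1 (param (f x)) w y v = \sum_j l j v * pullback1 (param (f x)) w y (e j).
Proof. by move=> lE y v; rewrite {1}(lE v) (pullback1_sum hw). Qed.

Lemma near_pullback (I : finType) (l : I -> F -> R^o) (e : I -> F) :
  (forall v, v = \sum_j l j v *: e j) ->
  \forall y \near x, forall v, pullback1 f w y v =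
    \sum_j l j ('d f' y v) *: (pullback1 (param (f x)) w (f' y) (e j) : R^o).
Proof.
move=> lE; have := pullback1_in_chart hN cF w sf; apply: filterS => y h v.
by rewrite h (param_sum lE).
Qed.

Lemma coord_diff_smooth (j : F -> R^o) (lj : linear j /\ continuous j) v :
  smooth_near (fun y => j ('d f' y v) : R^o) x.
Proof.
have [ll lc] := lj; have [g gE] := linear_pack ll.
rewrite -gE; apply: (@smooth_near_comp _ _ _ _ (fun y => 'd f' y v) g) => //.
  by apply: smooth_near_derive; exact: sf.2.
by apply: smooth_near_lin; rewrite gE.
Qed.

Lemma coef_smooth e : smooth_near (fun y => pullback1 (param (f x)) w (f' y) e : R^o) x.
Proof.
apply: (@smooth_near_comp _ _ _ _ f' (fun y => pullback1 (param (f x)) w y e : R^o)) => //.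
  exact: sf.2.
by rewrite in_chartsx; have [_] := hw; apply.
Qed.

Lemma pullback1_smooth v : smooth_near (fun y => pullback1 f w y v : R^o) x.
Proof.
have [I [e [l [lP lE]]]] := cF.
apply: (@smooth_near_eq _ _ _
  (fun y => \sum_j l j ('d f' y v) *: (pullback1 (param (f x)) w (f' y) (e j) : R^o))).
  by apply: filterS (near_pullback lE) => y ->.
by apply: smooth_near_sum => j; apply: smooth_nearZ; [exact: coord_diff_smooth|exact: coef_smooth].
Qed.

(** In the chart at f x the pullback is a sum of coefficients times derivatives of
    coordinates of f. The second derivatives of f cancel by symmetry, and the
    derivatives of the coefficients are those in the definition of dform1. *)
Lemma pullback_dform1 u v :
  'd (fun y => pullback1 f w y v : R^o) x u - 'd (fun y => pullback1 f w y u : R^o) x v =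
  pullback2 f (dform1 w) x u v.
Proof.
have [I [e [l [lP lE]]]] := cF.
pose a j := fun y => pullback1 (param (f x)) w y (e j) : R^o.
have da j : differentiable (a j) y0.
  by have [_ h] := hw; exact: smooth_near_differentiable (h (f x) (e j)).
have df : differentiable f' x := smooth_near_differentiable sf.2.
have daf j : 'd (a j \o f') x = 'd (a j) y0 \o 'd f' x :> (E -> R^o).
  by have dj := da j; rewrite -in_chartsx in dj *; exact: diff_comp.
have dl j u1 v1 : 'd (fun y => l j ('d f' y v1) : R^o) x u1 = l j ('d (fun y => 'd f' y v1) x u1).
  have [ll lc] := lP j; have [g gE] := linear_pack ll.
  rewrite -gE in lc *.
  have dd : differentiable (fun y => 'd f' y v1) x.
    by apply: smooth_near_differentiable; apply: smooth_near_derive; exact: sf.2.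
  have dg : differentiable g ('d f' x v1) by exact: linear_differentiable.
  have := diff_comp dd dg.
  by rewrite (diff_lin _ lc) => /(congr1 (fun h => h u1)).
have sym u1 v1 j : l j ('d (fun y => 'd f' y v1) x u1) = l j ('d (fun y => 'd f' y u1) x v1).
  rewrite -!dl.
  have [ll lc] := lP j; have [g gE] := linear_pack ll.
  have gc : continuous g by rewrite gE.
  have sgf : smooth_near (g \o f' : E -> R^o) x.
    by apply: (@smooth_near_comp _ _ _ _ f' g) => //; [exact: sf.2|exact: smooth_near_lin].
  have gd : \forall y \near x, forall v, 'd (g \o f') y v = l j ('d f' y v).
    apply: filterS (smooth_near_diff sf.2) => y dy v2.
    have dg : differentiable g (f' y) by exact: linear_differentiable.
    by rewrite (diff_comp dy dg) (diff_lin _ gc) /= gE.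
  have gd1 v2 u2 : 'd (fun y => 'd (g \o f') y v2) x u2 = 'd (fun y => l j ('d f' y v2) : R^o) x u2.
    have [|_ h] := @near_eq_diff _ _ _ (fun y => l j ('d f' y v2) : R^o) (fun y => 'd (g \o f') y v2) x _ (smooth_near_differentiable (coord_diff_smooth (lP j) v2)).
      by apply: filterS gd => y ->.
    by rewrite h.
  rewrite -(gd1 v1 u1) -(gd1 u1 v1); exact: diff_sym.
have dP u1 v1 : 'd (fun y => pullback1 f w y v1 : R^o) x u1 =
    \sum_j (l j ('d f' x v1) * 'd (a j) y0 ('d f' x u1) +
            l j ('d (fun y => 'd f' y v1) x u1) * a j y0).
  pose b j y := l j ('d f' y v1) : R^o.
  have db j : differentiable (b j) x by apply: smooth_near_differentiable; exact: coord_diff_smooth.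
  have daj j : differentiable (a j \o f') x by apply: smooth_near_differentiable; exact: coef_smooth.
  have dz j := is_diff_scalef (db j) (daj j).
  have [d1 d2] := @is_diff_bigsum _ _ _ _ (fun j y => b j y *: (a j \o f') y) x (fun j => let: DiffDef p _ := dz j in p).
  have nE : \forall y \near x, \sum_j b j y *: (a j \o f') y = pullback1 f w y v1.
    by have := near_pullback lE; apply: filterS => y ->.
  have [_ h] := near_eq_diff nE d1.
  rewrite h d2; apply: eq_bigr => j _; have [_ ->] := dz j.
  rewrite daf dl /= in_chartsx /b /GRing.scale /=; ring.
rewrite !dP -sumrB /pullback2 /dform1.
have dcoef U V : 'd (fun y => pullback1 (param (f x)) w y V : R^o) y0 U = \sum_j l j V * 'd (a j) y0 U.
  have dz j := is_diff_scalef (differentiable_cst (l j V) y0) (da j).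
  have [d1 d2] := @is_diff_bigsum _ _ _ _ (fun j y => cst (l j V) y *: a j y) y0 (fun j => let: DiffDef p _ := dz j in p).
  rewrite (_ : (fun y => _) = fun y => \sum_j cst (l j V) y *: a j y); last first.
    by apply/funext => y; rewrite (param_sum lE).
  rewrite d2; apply: eq_bigr => j _; have [_ ->] := dz j.
  by rewrite diff_cst /GRing.scale /= mul0r addr0.
rewrite -[RHS]/('d (fun y => pullback1 (param (f x)) w y ('d f' x v) : R^o) y0 ('d f' x u) -
  'd (fun y => pullback1 (param (f x)) w y ('d f' x u) : R^o) y0 ('d f' x v)).
apply: etrans (esym (congr2 (fun r s : R => r - s)
  (dcoef ('d f' x u) ('d f' x v)) (dcoef ('d f' x v) ('d f' x u)))).
rewrite -sumrB.
apply: eq_bigr => j _; rewrite (sym v u j).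
move: (l j _) (l j _) (l j _) ('d (a j) y0 _) ('d (a j) y0 _) (a j y0) => r1 r2 r3 r4 r5 r6; ring.
Qed.

End AtPoint.

Lemma pullback2_comp (g : N -> M) (w2 : form2 M) (f : model E -> N) (x : model E) u v :
  smooth_at f x -> smooth_at g (f x) ->
  pullback2 f (pullback2 g w2) x u v = pullback2 (g \o f) w2 x u v.
Proof.
move=> sf sg; rewrite /pullback2.
by rewrite (mdiff_comp (@has_charts_model R E) cN sf sg).
Qed.

End PullbackOfForms.

(** * Areas in the plane *)

Section PlaneMeasure.
Context {R : realType}.
Local Notation mu := (@lebesgue_measure R).
Local Notation mu2 := (mu \x mu)%E.
Local Notation T2 := (measurableTypeR R * measurableTypeR R)%type.

(** An open set is a countable union of products of balls with rational data. *)
Lemma open_prod_measurable (U : set (R * R)) : open U -> measurable (U : set T2).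
Proof.
move=> oU.
pose F (a b r : rat) : set T2 :=
  if `[< ball ((ratr a, ratr b) : R * R) (ratr r) `<=` U >]
  then (ball (ratr a : R) (ratr r)) `*` (ball (ratr b : R) (ratr r)) else set0.
have -> : (U : set T2) = \bigcup_a \bigcup_b \bigcup_r F a b r.
  apply/seteqP; split => [[x y] Uxy|[x y] [a _ [b _ [r _]]]]; last first.
    by rewrite /F; case: asboolP => // sub [/= ? ?]; apply: sub; split.
  have /nbhs_ballP[e /= e0 eU] : nbhs (x, y) U by apply: open_nbhs_nbhs.
  have e20 : 0 < e / 2 by rewrite divr_gt0.
  have [r] := rat_in_itvoo e20; rewrite in_itv /= => /andP[r0 re].
  have near_rat (z : R) : exists a : rat, `|ratr a - z| < ratr r.
    have [a] := @rat_in_itvoo R (z - ratr r) (z + ratr r) ltac:(lra).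
    by rewrite in_itv /= => az; exists a; rewrite ltr_distl.
  have [a ax] := near_rat x; have [b bY] := near_rat y.
  exists a => //; exists b => //; exists r => //; rewrite /F.
  rewrite asboolT; first by split; rewrite /ball /=.
  move=> [u v] [/= au bv]; apply: eU; split; rewrite /ball /= in au bv *.
    apply: le_lt_trans (ler_distD (ratr a) _ _) _; rewrite distrC in ax; lra.
  apply: le_lt_trans (ler_distD (ratr b) _ _) _; rewrite distrC in bY; lra.
apply: bigcupT_measurable_rat => a; apply: bigcupT_measurable_rat => b.
apply: bigcupT_measurable_rat => r; rewrite /F; case: asboolP => // _.
by apply: measurableX; rewrite ball_itv; exact: measurable_itv.
Qed.

Lemma continuous_prod_measurable (E : R * R -> R) : continuous E ->
  measurable_fun setT (E : T2 -> measurableTypeR R).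
Proof.
move=> /continuousP cE mD; apply: (measurability _ (RGenOpens.measurableE R)) => //.
move=> _ [_ [a [b ->] <-]]; rewrite setTI; apply: open_prod_measurable.
exact/cE/interval_open.
Qed.

Lemma affine_lebesgue (p a : R) (A : set (measurableTypeR R)) : a != 0 -> measurable A ->
  mu ((fun x => p + a * x) @^-1` A) = (`|a|^-1%:E * mu A)%E.
Proof.
move=> a0 mA.
have na : 0 < `|a| by rewrite normr_gt0.
pose f : measurableTypeR R -> measurableTypeR R := fun x => p + a * x.
have mf : measurable_fun setT f.
  apply: continuous_measurable_fun => x; rewrite /f.
  by apply: cvgD; [exact: cvg_cst|apply: cvgM; [exact: cvg_cst|exact: cvg_id]].
have /(_ mf) H := @lebesgue_measure_unique R (mscale (NngNum (normr_ge0 a)) (pushforward mu f)).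
suff hyp : forall X, ocitv X -> mu X = (`|a|%:E * mu (f @^-1` X))%E.
  have -> : mu A = (`|a|%:E * mu (f @^-1` A))%E := H hyp A mA.
  by rewrite muleA -EFinM mulVf ?gt_eqF// mul1e.
move=> _ [[u v] _ <-] /=.
have [ap|an] : 0 < a \/ a < 0 by apply/orP; rewrite -neq_lt eq_sym.
  rewrite (_ : f @^-1` _ = `](u - p) / a, (v - p) / a]%classic); last first.
    apply/seteqP; split => x; rewrite /f /= !in_itv /= ltr_pdivrMr// ler_pdivlMr// ltrBlDl lerBrDl mulrC;
    by rewrite mulrC.
  rewrite !lebesgue_measure_itv /= !lte_fin ltr_pM2r ?invr_gt0// ltrD2r.
  case: ifPn => uv; last by rewrite mule0.
  by rewrite -!EFinB -EFinM gtr0_norm//; congr EFin; field; rewrite gt_eqF.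
rewrite (_ : f @^-1` _ = `[(v - p) / a, (u - p) / a[%classic); last first.
  by apply/seteqP; split => x; rewrite /f /= !in_itv /= ltr_ndivlMr// ler_ndivrMr// ltrBlDl lerBrDl andbC mulrC.
rewrite !lebesgue_measure_itv /= !lte_fin ltr_nM2r ?invr_lt0// ltrD2r.
case: ifPn => uv; last by rewrite mule0.
by rewrite -!EFinB -EFinM ltr0_norm//; congr EFin; field; rewrite lt_eqF.
Qed.

(** Stated on preimages, for which measurability of L is enough. *)
Definition rescales (c : R) (L : T2 -> T2) : Prop :=
  measurable_fun setT L /\
  forall X, measurable X -> (c%:E * mu2 (L @^-1` X) = mu2 X)%E.

Lemma rescales_comp c1 c2 L1 L2 :
  rescales c1 L1 -> rescales c2 L2 -> rescales (c1 * c2) (L2 \o L1).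
Proof.
move=> [m1 h1] [m2 h2]; split; first exact: measurableT_comp.
move=> X mX; rewrite -(h2 X mX) mulrC EFinM -muleA; congr (_ * _)%E.
apply: (h1 (L2 @^-1` X)).
by rewrite -[X in measurable X]setTI; exact: m2.
Qed.

Lemma rescales_swap : rescales 1 (fun z : T2 => (z.2, z.1)).
Proof.
have ms : measurable_fun setT (fun z : T2 => (z.2, z.1) : T2).
  by apply/measurable_fun_pairP; split; [exact: measurable_snd|exact: measurable_fst].
split => // X mX; rewrite mul1e.
have /(_ ms) H := @product_measure_unique _ _ _ _ R mu mu (pushforward mu2 (fun z : T2 => (z.2, z.1) : T2)).
apply/esym/H => // A B mA mB.
have pe : (fun z : T2 => (z.2, z.1) : T2) @^-1` (A `*` B) = B `*` A.
  by apply/seteqP; split => -[x y] [].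
transitivity (mu2 (B `*` A)); first by rewrite -pe.
by rewrite product_measure1E// muleC.
Qed.

(** The slices of the preimage of a rectangle are preimages under affine maps of
    the line; uniqueness of the product measure does the rest. *)
Lemma rescales_triangular (p q a b k : R) : a != 0 -> b != 0 ->
  rescales `|a * b| (fun z : T2 => (p + a * z.1, q + k * z.1 + b * z.2)).
Proof.
move=> a0 b0.
have na : 0 < `|a| by rewrite normr_gt0. have nb : 0 < `|b| by rewrite normr_gt0.
set L := (fun z : T2 => _ : T2).
have mL : measurable_fun setT L.
  apply/measurable_fun_pairP; split; apply: continuous_prod_measurable => z /=.
    by apply: cvgD; [exact: cvg_cst|apply: cvgM; [exact: cvg_cst|exact: cvg_fst]].
  apply: cvgD; last by apply: cvgM; [exact: cvg_cst|exact: cvg_snd].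
  by apply: cvgD; [exact: cvg_cst|apply: cvgM; [exact: cvg_cst|exact: cvg_fst]].
split => // X mX.
have := @product_measure_unique _ _ _ _ R mu mu
  (mscale (NngNum (normr_ge0 (a * b))) (pushforward mu2 L)).
move=> /(_ mL) H; apply/esym/H => // A B mA mB.
have mA' : measurable ((fun x : measurableTypeR R => p + a * x) @^-1` A).
  have mf : measurable_fun setT (fun x : measurableTypeR R => p + a * x : measurableTypeR R).
    apply: continuous_measurable_fun => x.
    by apply: cvgD; [exact: cvg_cst|apply: cvgM; [exact: cvg_cst|exact: cvg_id]].
  by rewrite -[X in measurable X]setTI; exact: mf.
transitivity (`|a * b|%:E * \int[mu]_x mu (xsection (L @^-1` (A `*` B)) x))%E; first by [].
rewrite (eq_integral (fun x : measurableTypeR R => (\1_((fun x => p + a * x) @^-1` A) x)%:E * (`|b|^-1%:E * mu B))%E); last first.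
  move=> x _; rewrite indicE; case: (boolP (x \in _)) => [xA|xA].
    rewrite mul1e -(affine_lebesgue (q + k * x) b0 mB); congr (mu _).
    apply/seteqP; split => y; rewrite /xsection /= inE; first by case.
    by move=> By; split => //; move: xA; rewrite inE.
  rewrite mul0e (_ : xsection _ _ = set0) ?measure0//.
  apply/seteqP; split => y //; rewrite /xsection /= inE /= => -[Ax _].
  by move: xA; rewrite notin_setE; apply.
rewrite ge0_integralZr//; first last.
- by rewrite mule_ge0// lee_fin invr_ge0.
- by apply/measurable_EFinP; exact: measurable_indic.
rewrite integral_indic// setIT; have e := affine_lebesgue p a0 mA.
transitivity (`|a * b|%:E * ((`|a|^-1%:E * mu A) * (`|b|^-1%:E * mu B)))%E.
  by rewrite -e.
rewrite (muleACA `|a|^-1%:E) -!EFinM !muleA -EFinM.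
have -> : `|a * b| * (`|a|^-1 / `|b|) = 1.
  by rewrite normrM; field; rewrite !gt_eqF.
by rewrite mul1e.
Qed.

Lemma rescales_affine (p q u1 u2 v1 v2 : R) : u1 * v2 - u2 * v1 != 0 ->
  rescales `|u1 * v2 - u2 * v1|
    (fun z : T2 => (p + u1 * z.1 + v1 * z.2, q + u2 * z.1 + v2 * z.2)).
Proof.
(* For x1 != 0 the matrix is a product of two triangular ones, one of which is
   conjugated by the exchange of coordinates; for u1 = 0 the rows are exchanged. *)
have main p' q' x1 x2 y1 y2 : x1 != 0 -> x1 * y2 - x2 * y1 != 0 ->
  rescales `|x1 * y2 - x2 * y1|
    (fun z : T2 => (p' + x1 * z.1 + y1 * z.2, q' + x2 * z.1 + y2 * z.2)).
  move=> x0 d0.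
  have dx : (x1 * y2 - x2 * y1) / x1 != 0 by rewrite mulf_neq0// invr_eq0.
  have r1 := rescales_comp (rescales_comp rescales_swap
    (@rescales_triangular 0 0 1 x1 y1 (oner_neq0 _) x0)) rescales_swap.
  have r2 := rescales_comp r1
    (@rescales_triangular p' q' 1 ((x1 * y2 - x2 * y1) / x1) (x2 / x1) (oner_neq0 _) dx).
  rewrite (_ : `|_| = 1 * `|1 * x1| * 1 * `|1 * ((x1 * y2 - x2 * y1) / x1)|); last first.
    rewrite !mul1r mulr1 -normrM; congr `|_|; field; exact: x0.
  rewrite (_ : (fun z => _) = (fun z : T2 =>
        (p' + 1 * z.1, q' + x2 / x1 * z.1 + (x1 * y2 - x2 * y1) / x1 * z.2)) \o
      ((fun z : T2 => (z.2, z.1)) \o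
       ((fun z : T2 => (0 + 1 * z.1, 0 + y1 * z.1 + x1 * z.2)) \o (fun z => (z.2, z.1))))); last first.
    apply/funext => -[x y] /=; congr pair; first by ring.
    by field; exact: x0.
  exact: r2.
move=> d0; have [u0|u0] := eqVneq u1 0; last exact: main.
have u20 : u2 != 0 by apply: contraNneq d0 => ->; rewrite u0 !mul0r subrr.
have d0' : u2 * v1 - u1 * v2 != 0 by rewrite -oppr_eq0 opprB.
have := rescales_comp (main q p u2 u1 v2 v1 u20 d0') rescales_swap.
by rewrite mulr1 distrC.
Qed.

Lemma emulrB (c : R) (x y : \bar R) : x \is a fin_num -> y \is a fin_num ->
  (c%:E * x - c%:E * y = c%:E * (x - y))%E.
Proof. by case: x => [x| |] //; case: y => [y| |] // _ _; congr EFin; rewrite mulrBr. Qed.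

Lemma integral_mscale (c : {nonneg R}) (D : set T2) (f : T2 -> \bar R) : measurable D ->
  mu2.-integrable D f ->
  (\int[mscale c mu2]_(x in D) f x = c%:num%:E * \int[mu2]_(x in D) f x)%E.
Proof.
move=> mD fi; have mf := measurable_int _ fi.
rewrite integralE [in RHS]integralE !ge0_integral_mscale//.
- have p := integrable_fin_num mD (integrable_funepos mD fi).
  have q := integrable_fin_num mD (integrable_funeneg mD fi).
  exact: (@emulrB c%:num _ _ p q).
- exact: measurable_funeneg.
- exact: measurable_funepos.
Qed.

Lemma rescales_integral (c : R) (L : T2 -> T2) (D : set T2) (f : T2 -> R) :
  0 <= c -> rescales c L -> measurable D -> measurable_fun setT f ->
  mu2.-integrable (L @^-1` D) (EFin \o (f \o L)) ->
  \int[mu2]_(x in D) f x = c * \int[mu2]_(x in L @^-1` D) f (L x).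
Proof.
move=> c0 [mL hL] mD mf fi.
have mLD : measurable (L @^-1` D) by rewrite -[X in measurable X]setTI; exact: mL.
rewrite /Rintegral.
transitivity (fine (\int[pushforward (mscale (NngNum c0) mu2) L]_(x in D) (f x)%:E)%E).
  by congr fine; apply: eq_measure_integral => X mX _; exact: (esym (hL X mX)).
have mfE : measurable_fun setT (EFin \o f) by apply/measurable_EFinP.
rewrite (integral_pushforward mL mfE)//; last first.
  have /integrableP[m1 m2] := fi; apply/integrableP; split => //.
  rewrite ge0_integral_mscale//; last exact: measurableT_comp.
  by apply: lte_mul_pinfty.
rewrite integral_mscale// fineM//.
exact: integrable_fin_num.
Qed.

(** The vertices are (0, 0), (1, 0) and (1, 1): the first side lies on y = 0, the
    second on x = 1 and the third on the diagonal. *)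
Definition std_triangle : set (R * R) := [set z | [/\ 0 <= z.2, z.2 <= z.1 & z.1 <= 1]].

Lemma std_triangle_measurable : measurable (std_triangle : set T2).
Proof.
have mge (h : R * R -> R) : continuous h -> measurable ([set z | 0 <= h z] : set T2).
  move=> ch; have := continuous_prod_measurable ch.
  move=> /(_ measurableT `[0, +oo[%classic (measurable_itv _)); rewrite setTI.
  congr measurable; apply/seteqP; split => z /=; by rewrite in_itv /= andbT.
have -> : std_triangle = [set z | 0 <= z.2] `&` ([set z | 0 <= z.1 - z.2] `&` [set z | 0 <= 1 - z.1]).
  by apply/seteqP; split => z /=; rewrite !subr_ge0; [move=> [? ? ?]|move=> [? [? ?]]].
apply: measurableI; [|apply: measurableI]; apply: (@mge (fun z => _)) => z.
- exact: cvg_snd.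
- by apply: cvgB; [exact: cvg_fst|exact: cvg_snd].
- by apply: cvgB; [exact: cvg_cst|exact: cvg_fst].
Qed.

Lemma std_triangle_sub : std_triangle `<=` `[0, 1]%classic `*` `[0, 1]%classic.
Proof. by move=> z [z0 z1 z2]; split; rewrite /= in_itv /=; apply/andP; split; lra. Qed.

Lemma std_triangle_lty : (mu2 (std_triangle : set T2) < +oo)%E.
Proof.
have mS : measurable (`[0 : R, 1]%classic `*` `[0 : R, 1]%classic : set T2).
  by apply: measurableX; exact: measurable_itv.
apply: (@le_lt_trans _ _ (mu2 (`[0 : R, 1]%classic `*` `[0 : R, 1]%classic : set T2))).
  apply: le_measure; rewrite ?inE//; first exact: std_triangle_measurable.
  exact: std_triangle_sub.
rewrite product_measure1E//; try exact: measurable_itv.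
have e1 : mu (`[0 : R, 1]%classic) = 1%:E.
  by rewrite lebesgue_measure_itv /= lte_fin ltr01 sube0.
have h : (mu (`[0%R, 1%R]%classic) * mu (`[0%R, 1%R]%classic) < +oo)%E by rewrite e1 mule1 ltry.
exact: h.
Qed.

Lemma std_triangle_integrable (E : R * R -> R) : continuous E ->
  mu2.-integrable (std_triangle : set T2) (EFin \o E).
Proof.
move=> cE; apply: measurable_bounded_integrable.
- exact: std_triangle_measurable.
- exact: std_triangle_lty.
- exact: measurable_funS (continuous_prod_measurable cE).
have cS : compact (`[0 : R, 1]%classic `*` `[0 : R, 1]%classic).
  by apply: compact_setX; exact: segment_compact.
have cES : compact (E @` (`[0 : R, 1]%classic `*` `[0 : R, 1]%classic)).
  by apply: continuous_compact => //; exact: continuous_subspaceT.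
have [M [Mr hM]] := compact_bounded cES.
exists M; split => // y My z zT; apply: (hM y My); exists z => //.
exact: std_triangle_sub.
Qed.

Lemma integral_std_triangle (E : R * R -> R) : continuous E ->
  \int[mu2]_(z in (std_triangle : set T2)) E z =
  \int[mu]_(x in `[0, 1]) \int[mu]_(y in `[0, x]) E (x, y).
Proof.
move=> cE; have iE := std_triangle_integrable cE.
rewrite /Rintegral integral_mkcond.
rewrite -integral12_prod_meas1; last first.
  by apply/(integrable_mkcond _ std_triangle_measurable).
rewrite [in RHS]integral_mkcond; congr fine; apply: eq_integral => x _.
rewrite /fubini_F patchE; case: ifPn => [x01|x01].
  have x0 : 0 <= x <= 1 by move: x01; rewrite inE /= in_itv.
  have cEx : {within `[0, x], continuous (fun y => E (x, y))}.
    apply: continuous_subspaceT => y; apply: continuous_comp; last exact: cE.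
    apply: (cvg_pair (f := cst x) (g := id) (F := nbhs y) (G := nbhs x) (H := nbhs y)).
      exact: cvg_cst.
    exact: cvg_id.
  have iEx : mu.-integrable `[0, x] (EFin \o (fun y => E (x, y))).
    by apply: continuous_compact_integrable => //; exact: segment_compact.
  rewrite fineK; last exact: (integrable_fin_num _ iEx).
  rewrite [RHS]integral_mkcond; apply: eq_integral => y _.
  rewrite !patchE; congr (if _ then _ else _).
  apply/idP/idP; rewrite !inE /= in_itv /=.
    by case=> /= -> ->.
  by move=> /andP[y0 yx]; split => //; case/andP: x0.
rewrite integral0_eq// => y _; rewrite patchE; case: ifPn => // /[!inE] -[/= y0 yx x1].
by move: x01; rewrite notin_setE /= in_itv /= x1 (le_trans y0 yx).
Qed.

(** The affine map with (0, 0), (1, 0), (1, 1) sent to A, B, C. *)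
Definition tri_chart (A B C : R * R) (z : R * R) : R * R :=
  (A.1 + (B.1 - A.1) * z.1 + (C.1 - B.1) * z.2,
   A.2 + (B.2 - A.2) * z.1 + (C.2 - B.2) * z.2).

Lemma linear_system2 (u1 u2 v1 v2 x y : R) : u1 * v2 - u2 * v1 != 0 ->
  u1 * x + v1 * y = 0 -> u2 * x + v2 * y = 0 -> x = 0 /\ y = 0.
Proof.
set D := (X in X != 0) => D0 e1 e2.
have x0 : D * x = 0.
  transitivity (v2 * (u1 * x + v1 * y) - v1 * (u2 * x + v2 * y)); first by rewrite /D; ring.
  by rewrite e1 e2 !mulr0 subrr.
have y0 : D * y = 0.
  transitivity (u1 * (u2 * x + v2 * y) - u2 * (u1 * x + v1 * y)); first by rewrite /D; ring.
  by rewrite e1 e2 !mulr0 subrr.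
by split; apply: (mulfI D0); rewrite mulr0.
Qed.
Lemma tri_chart_preimage (A B C : R * R) :
  (B.1 - A.1) * (C.2 - B.2) - (B.2 - A.2) * (C.1 - B.1) != 0 ->
  tri_chart A B C @^-1` (triangle (A : plane) B C) = std_triangle.
Proof.
set D := (X in X != 0) => D0.
apply/seteqP; split => -[x y] /=.
  move=> [s [s0 s1 [e1 e2]]].
  rewrite !big_ord_recl big_ord0 addr0 in s1.
  have s10 := s0 ord0; have s11 := s0 (lift ord0 ord0); have s12 := s0 (lift ord0 (lift ord0 ord0)).
  have q1 : s 1 = s (lift ord0 ord0) by congr s; apply: val_inj.
  have q2 : s 2 = s (lift ord0 (lift ord0 ord0)) by congr s; apply: val_inj.
  rewrite q1 q2 in e1 e2.
  move: s10 s11 s12 s1 e1 e2.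
  move: (s ord0) (s (lift ord0 ord0)) (s (lift ord0 (lift ord0 ord0))) => a b c a0 b0 c0 abc.
  rewrite /GRing.scale /= => e1 e2.
  have ea : a = 1 - b - c by lra.
  have [||hx hy] := linear_system2 (x := x - (b + c)) (y := y - c) D0.
  - by move: e1; rewrite ea => e1; lra.
  - by move: e2; rewrite ea => e2; lra.
  by rewrite /std_triangle /=; split; lra.
move=> [/= y0 yx x1].
exists (fun i : 'I_3 => nth 0 [:: 1 - x; x - y; y] i); split.
- by case=> -[|[|[|//]]] /= _; lra.
- by rewrite !big_ord_recl big_ord0 /=; lra.
- have -> : nat_of_ord (0 : 'I_3) = 0%N by [].
  have -> : nat_of_ord (1 : 'I_3) = 1%N by [].
  have -> : nat_of_ord (2 : 'I_3) = 2%N by [].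
  transitivity ((1 - x) * A.1 + (x - y) * B.1 + y * C.1,
                (1 - x) * A.2 + (x - y) * B.2 + y * C.2); last by [].
  by rewrite /tri_chart /=; congr pair; ring.
Qed.

(** Change of variables and Fubini. The orientation sign is that of
    det2 (B - A) (A - C) = - det2 (B - A) (C - A), which is why a minus sign is
    left once W has absorbed the determinant of the chart. *)
Lemma triangle_integral_std (A B C : plane) (w : form2 (model plane)) (W : R * R -> R) :
  det2 (B - A) (C - A) != 0 -> continuous W ->
  (forall z, std_triangle z ->
     W z = det2 (B - A) (C - A) * w (tri_chart A B C z) (1, 0) (0, 1)) ->
  triangle_integral A B C w = - \int[mu]_(x in `[0, 1]) \int[mu]_(y in `[0, x]) W (x, y).
Proof.
move=> D0 cW WE; set D := det2 (B - A) (C - A) in D0 WE *.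
have DE : D = (B.1 - A.1) * (C.2 - B.2) - (B.2 - A.2) * (C.1 - B.1).
  by rewrite /D /det2 /=; ring.
pose Li (z : R * R) : R * R :=
  (((C.2 - B.2) * (z.1 - A.1) - (C.1 - B.1) * (z.2 - A.2)) / D,
   ((B.1 - A.1) * (z.2 - A.2) - (B.2 - A.2) * (z.1 - A.1)) / D).
have LiK : cancel (tri_chart A B C) Li.
  by move=> [x y]; rewrite /Li /tri_chart /= DE; congr pair; field; rewrite -DE.
have cLi : continuous Li.
  have c1 : continuous (fun z => (Li z).1).
    move=> z; apply: cvgM; last exact: cvg_cst.
    apply: cvgB; (apply: cvgM; first exact: cvg_cst); apply: cvgB; try exact: cvg_cst.
      exact: cvg_fst.
    exact: cvg_snd.
  have c2 : continuous (fun z => (Li z).2).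
    move=> z; apply: cvgM; last exact: cvg_cst.
    apply: cvgB; (apply: cvgM; first exact: cvg_cst); apply: cvgB; try exact: cvg_cst.
      exact: cvg_snd.
    exact: cvg_fst.
  move=> z; apply: (cvg_pair (F := nbhs z) (G := nbhs (Li z).1) (H := nbhs (Li z).2)).
    exact: c1.
  exact: c2.
have cw' : continuous (fun z => W (Li z) / D).
  move=> z; apply: cvgM; last exact: cvg_cst.
  by apply: continuous_comp; [exact: cLi|exact: cW].
have rL : rescales `|D| (tri_chart A B C).
  by rewrite DE; apply: rescales_affine; rewrite -DE.
have pre : tri_chart A B C @^-1` (triangle A B C) = std_triangle.
  by apply: tri_chart_preimage; rewrite -DE.
have LiK' z : tri_chart A B C (Li z) = z.
  by case: z => x y; rewrite /Li /tri_chart /= DE; congr pair; field; rewrite -DE.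
have imT z : triangle A B C z -> exists2 y, std_triangle y & z = tri_chart A B C y.
  by move=> Tz; exists (Li z); rewrite ?LiK'// -pre /= LiK'.
have mT : measurable (triangle A B C : set T2).
  have -> : triangle A B C = Li @^-1` std_triangle.
    apply/seteqP; split => z.
      by move=> /imT[y yT ->] /=; rewrite LiK.
    by rewrite -pre /= LiK'.
  have mLi : measurable_fun setT (Li : T2 -> T2).
    apply/measurable_fun_pairP; split; apply: continuous_prod_measurable => z.
      exact: cvg_comp (cLi z) cvg_fst.
    exact: cvg_comp (cLi z) cvg_snd.
  by rewrite -[X in measurable X]setTI; apply: mLi => //; exact: std_triangle_measurable.
rewrite /triangle_integral.
have -> : \int[mu2]_(x in (triangle A B C : set T2)) w x (1, 0) (0, 1) =
    \int[mu2]_(x in (triangle A B C : set T2)) (W (Li x) / D).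
  apply: eq_Rintegral => z; rewrite inE => /imT[y yT ->].
  by rewrite LiK WE// mulrC mulKf.
rewrite (rescales_integral (normr_ge0 D) rL mT (continuous_prod_measurable cw')); last first.
  rewrite pre; apply: std_triangle_integrable => z.
  apply: cvgM; last exact: cvg_cst.
  rewrite (_ : (fun x => _) = W) ?LiK; first exact: cW.
  by apply/funext => y; rewrite LiK.
rewrite pre.
have -> : \int[mu2]_(x in (std_triangle : set T2)) (W (Li (tri_chart A B C x)) / D) =
    D^-1 * \int[mu2]_(x in (std_triangle : set T2)) W x.
  rewrite -RintegralZl; [|exact: std_triangle_measurable|exact: std_triangle_integrable].
  by apply: eq_Rintegral => z _; rewrite LiK mulrC.
rewrite integral_std_triangle// !mulrA.
have -> : det2 (B - A) (A - C) = - D by rewrite /D /det2 /=; ring.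
by rewrite sgrN !mulNr -numEsg divff// mul1r.
Qed.

End PlaneMeasure.

(** * Primitives in the plane *)

Section PlaneCalculus.
Context {R : realType}.
Local Notation mu := (@lebesgue_measure R).
Implicit Types (q : R -> R).

Lemma mvt_abs (h dh : R -> R) (a b M : R) :
  (forall t, Num.min a b <= t <= Num.max a b -> is_derive t 1 h (dh t) /\ `|dh t| <= M) ->
  `|h b - h a| <= M * `|b - a|.
Proof.
wlog ab : a b / a <= b => [hw|].
  have [ab|ba] : a <= b \/ b <= a by apply/orP; exact: le_total.
    exact: hw.
  move=> H; rewrite distrC (distrC b); apply: hw => //.
  by move=> t tab; apply: H; rewrite minC maxC.
rewrite (min_idPl ab) (max_idPr ab) => H.
have H1 t : t \in `]a, b[%R -> is_derive t 1 h (dh t).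
  by rewrite in_itv /= => /andP[at_ tb]; apply: (H t _).1; rewrite !ltW.
have H2 : {within `[a, b], continuous h}.
  by apply: derivable_within_continuous => u; rewrite in_itv /= => /H[[]].
have [t tab ->] := MVT_segment ab H1 H2.
by rewrite normrM ler_wpM2r//; apply: (H t _).2; move: tab; rewrite in_itv.
Qed.

Lemma derive0_const (k : R -> R) (a b : R) : a <= b -> {within `[a, b], continuous k} ->
  (forall t, a < t < b -> is_derive t 1 k 0) -> k b = k a.
Proof.
move=> ab ck dk.
have dk' t : t \in `]a, b[%R -> is_derive t 1 k (cst 0 t).
  by rewrite in_itv; exact: dk.
have [t _] := MVT_segment ab dk' ck.
by rewrite mul0r => /eqP; rewrite subr_eq0 => /eqP.
Qed.

Lemma continuous_itv_integrable q a b : continuous q -> mu.-integrable `[a, b] (EFin \o q).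
Proof.
move=> cq; apply: continuous_compact_integrable; first exact: segment_compact.
exact: continuous_subspaceT.
Qed.

Lemma antiderivative q (a x : R) : continuous q -> a < x ->
  is_derive x 1 (fun x => \int[mu]_(t in `[a, x]) q t) (q x).
Proof.
move=> cq ax.
have [|d1 d2] := @continuous_FTC1_closed R q a x (x + 1) ltac:(lra) _ ax (cq x).
  exact: continuous_itv_integrable.
by apply: DeriveDef; [exact: d1|rewrite -derive1E; exact: d2].
Qed.

Lemma Rintegral_derive (F q : R -> R) (a b : R) : a < b -> continuous q ->
  (forall t, a <= t <= b -> is_derive t 1 F (q t)) ->
  \int[mu]_(t in `[a, b]) q t = F b - F a.
Proof.
move=> ab cq dF.
have cF t : a <= t <= b -> {for t, continuous F}.
  move=> /dF[d _]; apply: differentiable_continuous; exact/derivable1_diffP.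
rewrite /Rintegral (@continuous_FTC2 _ q F)//.
- exact: continuous_subspaceT.
- split.
  + by move=> t; rewrite in_itv /= => /andP[/ltW at_ /ltW tb]; have [] := dF t ltac:(by rewrite at_ tb).
  + by apply: cvg_at_right_filter; apply: cF; rewrite lexx ltW.
  + by apply: cvg_at_left_filter; apply: cF; rewrite lexx ltW.
- move=> t; rewrite in_itv /= => /andP[/ltW at_ /ltW tb]; rewrite derive1E.
  by have [] := dF t ltac:(by rewrite at_ tb).
Qed.

Lemma pair_continuous (T : topologicalType) (f g : T -> R) (z : T) :
  {for z, continuous f} -> {for z, continuous g} -> {for z, continuous (fun x => (f x, g x))}.
Proof.
move=> cf cg.
exact: (cvg_pair (f := f) (g := g) (F := nbhs z) (G := nbhs (f z)) (H := nbhs (g z))).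
Qed.

Lemma section_continuous (b : R * R -> R) (x : R) : continuous b -> continuous (fun y => b (x, y)).
Proof.
move=> cb y; apply: continuous_comp; last exact: cb.
by apply: pair_continuous; [exact: cst_continuous|move=> A].
Qed.

Lemma section_continuous1 (b : R * R -> R) (y : R) : continuous b -> continuous (fun x => b (x, y)).
Proof.
move=> cb x; apply: continuous_comp; last exact: cb.
by apply: pair_continuous; [move=> A|exact: cst_continuous].
Qed.

Lemma continuous_box_bounded (b : R * R -> R) (x0 x1 y0 y1 : R) : continuous b ->
  exists M, forall x y, x0 <= x <= x1 -> y0 <= y <= y1 -> `|b (x, y)| <= M.
Proof.
move=> cb.
have cS : compact (`[x0, x1]%classic `*` `[y0, y1]%classic).
  by apply: compact_setX; exact: segment_compact.
have cES : compact (b @` (`[x0, x1]%classic `*` `[y0, y1]%classic)).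
  by apply: continuous_compact => //; exact: continuous_subspaceT.
have [M [Mr hM]] := compact_bounded cES.
exists (M + 1) => x y xx yy; apply: (hM (M + 1)); first by lra.
by exists (x, y) => //; split; rewrite /= in_itv.
Qed.

Lemma param_integral_continuous (b : R * R -> R) (c d : R) : continuous b ->
  continuous (fun x => \int[mu]_(s in `[c, d]) b (x, s)).
Proof.
move=> cb x0.
have [M bM] := continuous_box_bounded (x0 - 1) (x0 + 1) c d cb.
have I0 : x0 \in (`]x0 - 1, x0 + 1[%classic : set R) by rewrite inE /= in_itv /=; apply/andP; split; lra.
have := @continuity_under_integral R _ (measurableTypeR R) mu (fun x s => b (x, s))
  `[c, d]%classic (measurable_itv _) (x0 - 1) (x0 + 1) _ _ (cst M) _ _ x0 I0.
apply.
- by move=> x _; apply: continuous_itv_integrable; exact: section_continuous.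
- apply: aeW => s _ x _ ; apply: continuous_comp; last exact: cb.
  by apply: pair_continuous; [move=> A|exact: cst_continuous].
- exact: (continuous_itv_integrable c d (fun x => @cst_continuous _ _ M x)).
- move=> x; rewrite /= in_itv /= => /andP[/ltW xa /ltW xb]; apply: aeW => s.
  by rewrite /= in_itv /= => scd; apply: bM => //; rewrite xa xb.
Qed.

Lemma is_derive_subl (h : R -> R) (d c t : R) : is_derive t 1 h d ->
  is_derive t 1 (fun x => h x - c * x) (d - c).
Proof.
move=> dh; have dc : is_derive t 1 (fun x : R => c * x) (c * 1).
  exact: (@is_deriveZ _ _ _ id c t 1 1 (is_derive_id t 1)).
by rewrite mulr1 in dc; exact: is_deriveB.
Qed.

Lemma lerNnorm (x : R) : - x <= `|x|. Proof. by rewrite -normrN ler_norm. Qed.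

Lemma max_contract (c x y : R) : `|Num.max c x - Num.max c y| <= `|x - y|.
Proof.
rewrite ler_norml; have := ler_norm (x - y); have := lerNnorm (x - y).
by case: (lerP c x) => cx; case: (lerP c y) => cy; lra.
Qed.

Lemma near_fst (x y : R) (A : R -> Prop) : (\forall u \near x, A u) ->
  \forall z \near ((x, y) : R * R), A z.1.
Proof.
move=> nA; exists (A, setT) => //=; last by move=> [u v] [].
by split => //; exact: filterT.
Qed.

Lemma near_snd (x y : R) (A : R -> Prop) : (\forall u \near y, A u) ->
  \forall z \near ((x, y) : R * R), A z.2.
Proof.
move=> nA; exists (setT, A) => //=; last by move=> [u v] [].
by split => //; exact: filterT.
Qed.

(** f dx is a primitive of the 2-form with coefficient b. The cut-off at y = -1
    and the base point -2 make f continuous on the whole plane and leave a margin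
    around the axis, on which f vanishes. *)
Lemma vertical_primitive (b : R * R -> R) : continuous b ->
  exists f : R * R -> R, [/\ continuous f, forall x, f (x, 0) = 0,
    forall x y : R, -1 < y -> is_derive y 1 (fun y : R => f (x, y)) (- b (x, y))
  & forall x, 0 <= x -> f (x, x) = - \int[mu]_(s in `[0, x]) b (x, s)].
Proof.
move=> cb.
pose m (y : R) := Num.max (-1) y.
pose F (x y : R) := \int[mu]_(s in `[-2, y]) b (x, s).
pose f (z : R * R) := F z.1 0 - F z.1 (m z.2).
have dF (x y : R) : -2 < y -> is_derive y 1 (F x) (b (x, y)).
  by move=> y2; apply: antiderivative => //; exact: section_continuous.
exists f; split.
- have cm : continuous m.
    move=> y; apply: (@max_fun_continuous _ R R (cst (-1)) id); first exact: cst_continuous.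
    by move=> z A.
  have cF : continuous (fun z : R * R => F z.1 (m z.2)).
    move=> -[x0 y0]; apply/cvgrPdist_lt => e e0.
    have [M bM] := continuous_box_bounded (x0 - 1) (x0 + 1) (-1) (`|y0| + 1) cb.
    have M0 : 0 <= M.
      apply: le_trans (normr_ge0 (b (x0, 0))) (bM x0 0 _ _); first by lra.
      by have := normr_ge0 y0; lra.
    have e2 : 0 < e / 2 by lra.
    have eM : 0 < e / 2 / (M + 1) by rewrite divr_gt0//; lra.
    have c1 := @param_integral_continuous b (-2) (m y0) cb.
    have := c1 x0 => /cvgrPdist_lt /(_ _ e2) n1.
    have n1' : \forall z \near ((x0, y0) : R * R), `|F x0 (m y0) - F z.1 (m y0)| < e / 2.
      exact: (near_fst y0 n1).
    have n2 : \forall z \near ((x0, y0) : R * R), `|x0 - z.1| < 1.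
      have h : nbhs x0 [set x : R | `|x0 - x| < 1] by apply: nbhsx_ballx.
      exact: (near_fst y0 h).
    have n3 : \forall z \near ((x0, y0) : R * R), `|y0 - z.2| < Num.min 1 (e / 2 / (M + 1)).
      have h : nbhs y0 [set x : R | `|y0 - x| < Num.min 1 (e / 2 / (M + 1))].
        by apply: nbhsx_ballx; rewrite lt_min ltr01.
      exact: (near_snd x0 h).
    near=> z => /=.
    have z1 : `|F x0 (m y0) - F z.1 (m y0)| < e / 2 by near: z.
    have z2 : `|x0 - z.1| < 1 by near: z.
    have : `|y0 - z.2| < Num.min 1 (e / 2 / (M + 1)) by near: z.
    rewrite lt_min => /andP[z3 z4].
    have mz : `|m y0 - m z.2| <= `|y0 - z.2|.
      exact: max_contract.
    have key : `|F z.1 (m y0) - F z.1 (m z.2)| <= M * `|m y0 - m z.2|.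
      apply: (@mvt_abs _ (fun y => b (z.1, y))) => t tb.
      have mt : -1 <= t <= `|y0| + 1.
        have my : -1 <= m y0 <= `|y0| + 1.
          rewrite /m le_max lexx /= ge_max; have := ler_norm y0; have := normr_ge0 y0; lra.
        have my' : -1 <= m z.2 <= `|y0| + 1.
          rewrite /m le_max lexx /= ge_max; have := ler_norm y0; have := normr_ge0 y0.
          by clear - z3; move: z3; rewrite ltr_norml; lra.
        clear - tb my my'; move: (m y0) (m z.2) my my' tb => r s my my'.
        rewrite ge_min le_max => /andP[/orP[] t1 /orP[] t2]; lra.
      split; first by apply: dF; lra.
      by apply: bM => //; move: z2; rewrite ltr_norml; lra.
    apply: le_lt_trans (ler_distD (F z.1 (m y0)) _ _) _.
    have : M * `|m y0 - m z.2| <= M * (e / 2 / (M + 1)).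
      by rewrite ler_wpM2l// (le_trans mz)// ltW.
    have : M * (e / 2 / (M + 1)) <= e / 2.
      have kE : e / 2 / (M + 1) * (M + 1) = e / 2 by rewrite divfK // gt_eqF// ltr_wpDl.
      move: kE eM; move: (e / 2 / (M + 1)) => k kE k0; clear - kE k0.
      by rewrite -kE mulrC ler_wpM2l ?(ltW k0)//; lra.
    by move=> h1 h2; clear - z1 key h1 h2; lra.
  move=> z; apply: cvgB; last exact: cF.
  apply: (@continuous_comp _ _ _ fst (fun x => F x 0)); first exact: cvg_fst.
  exact: (@param_integral_continuous b (-2) 0 cb).
- by move=> x; rewrite /f /= /m (max_idPr _) ?subrr//; lra.
- move=> x y y1.
  have d1 : is_derive y 1 (fun y : R => F x 0 - F x y) (0 - b (x, y)).
    by apply: is_deriveB; apply: dF; lra.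
  rewrite sub0r in d1; apply: near_eq_is_derive d1.
  near=> t; rewrite /f /= /m (max_idPr _)//; apply: ltW.
  by near: t; exact: lt_nbhsr.
- move=> x x0; rewrite /f /= /m (max_idPr _); last by lra.
  have iF := continuous_itv_integrable (-2) x (@section_continuous b x cb).
  have := @Rintegral_itvB R (fun s => b (x, s)) (BLeft (-2)) (BRight x) 0 iF.
  rewrite !bnd_simp => h; have h' := h ltac:(lra) x0.
  rewrite /F -opprB h'.
  rewrite Rintegral_itv_obnd_cbnd//.
  have := continuous_itv_integrable 0 x (@section_continuous b x cb).
  by apply: integrableS => //; exact: subset_itv_oc_cc.
Unshelve. all: by end_near. Qed.

Definition has_partials (g D Q : R * R -> R) (z : R * R) : Prop :=
  is_derive z.1 1 (fun x : R => g (x, z.2)) (D z) /\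
  is_derive z.2 1 (fun y : R => g (z.1, y)) (Q z).

(** The increment of g is split along the two axes; on each of them the mean value
    inequality is applied to g minus its linear part. *)
Lemma is_diff_partials (g D Q : R * R -> R) (p : R * R) :
  (\forall z \near p, has_partials g D Q z) ->
  {for p, continuous D} -> {for p, continuous Q} ->
  is_diff (p : R^o * R^o) (g : R^o * R^o -> R^o)
    (fun v : R^o * R^o => D p * v.1 + Q p * v.2 : R^o).
Proof.
move=> dg cD cQ.
pose l (v : R^o * R^o) : R^o := D p * v.1 + Q p * v.2.
have ll : linear (l : R^o * R^o -> R^o).
  move=> a [u1 u2] [v1 v2].
  transitivity (D p * (a * u1 + v1) + Q p * (a * u2 + v2)); first by [].
  transitivity (a * (D p * u1 + Q p * u2) + (D p * v1 + Q p * v2)); last by [].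
  by ring.
have [L LE] := linear_pack ll.
have cl : continuous l.
  by move=> v; apply: cvgD; (apply: cvgM; first exact: cvg_cst); [exact: cvg_fst|exact: cvg_snd].
have cL : continuous L by rewrite LE.
have gE : (g : R^o * R^o -> R^o) \o shift (p : R^o * R^o) = cst (g p : R^o) + L +o_ (0 : R^o * R^o) id.
  apply/eqaddoP => e e0.
  have e2 : 0 < e / 2 by lra.
  have : \forall z \near p, [/\ has_partials g D Q z, `|D p - D z| < e / 2 & `|Q p - Q z| < e / 2].
    near=> z.
    split; near: z => //.
    - by move/cvgrPdist_lt: cD; apply.
    - by move/cvgrPdist_lt: cQ; apply.
  move=> /nbhs_ballP[r /= r0 rP].
  apply/nbhs_ballP; exists r => //= -[h k].
  rewrite /ball /= /prod_ball /ball /= !sub0r !normrN => -[hr kr].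
  case: p @l ll L LE cl cL cD cQ rP dg => p1 p2 l ll L LE cl cL cD cQ rP dg.
  rewrite !fctE /= LE /l /=.
  have in_ball x y : `|x| <= `|h| -> `|y| <= `|k| -> ball ((p1, p2) : R * R) r (x + p1, y + p2).
    move=> xh yk; split; rewrite /ball /= opprD addrCA subrr addr0 normrN; exact: le_lt_trans hr || exact: le_lt_trans kr.
  pose G1 x := g (x, k + p2) - D (p1, p2) * x.
  pose G2 y := g (p1, y) - Q (p1, p2) * y.
  have step (a c t : R) : Num.min a (c + a) <= t <= Num.max a (c + a) -> `|t - a| <= `|c|.
    rewrite ge_min le_max => /andP[/orP[] t1 /orP[] t2]; rewrite ler_norml;
    have := ler_norm c; have := lerNnorm c; lra.
  have b1 : `|G1 (h + p1) - G1 p1| <= e / 2 * `|h + p1 - p1|.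
    apply: (@mvt_abs _ (fun x => D (x, k + p2) - D (p1, p2))) => t tb.
    have := in_ball (t - p1) k (step _ _ _ tb) (lexx _); rewrite subrK => /rP[[d1 _] d2 _].
    split; last by rewrite distrC ltW.
    exact: is_derive_subl.
  have b2 : `|G2 (k + p2) - G2 p2| <= e / 2 * `|k + p2 - p2|.
    apply: (@mvt_abs _ (fun y => Q (p1, y) - Q (p1, p2))) => t tb.
    have := in_ball 0 (t - p2) _ (step _ _ _ tb); rewrite normr0 subrK add0r => /(_ (normr_ge0 _))/rP[[_ d1] _ d2].
    split; last by rewrite distrC ltW.
    exact: is_derive_subl.
  rewrite !addrK in b1 b2.
  have -> : g (h + p1, k + p2) - (g (p1, p2) + (D (p1, p2) * h + Q (p1, p2) * k)) =
     (G1 (h + p1) - G1 p1) + (G2 (k + p2) - G2 p2) by rewrite /G1 /G2; ring.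
  apply: le_trans (ler_normD _ _) _; apply: le_trans (lerD b1 b2) _.
  have n1 : `|h| <= `|((h, k) : R^o * R^o)| by rewrite prod_normE le_max lexx.
  have n2 : `|k| <= `|((h, k) : R^o * R^o)| by rewrite prod_normE le_max lexx orbT.
  nra.
have dE : 'd (g : R^o * R^o -> R^o) (p : R^o * R^o) = L :> (R^o * R^o -> R^o) by exact: diff_unique gE.
apply: DiffDef; last by rewrite [LHS]dE LE.
by apply/diff_locallyP; rewrite dE.
Unshelve. all: by end_near. Qed.

Definition clamp (a b x : R) : R := Num.max a (Num.min b x).

Lemma clamp_continuous (a b : R) : continuous (clamp a b).
Proof.
move=> x; apply: (@max_fun_continuous _ R R (cst a) (fun x => Num.min b x)).
  exact: cst_continuous.
move=> y; apply: (@min_fun_continuous _ R R (cst b) id); first exact: cst_continuous.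
by move=> z A.
Qed.

Lemma clamp_id (a b x : R) : a <= x <= b -> clamp a b x = x.
Proof. by move=> /andP[ax xb]; rewrite /clamp (min_idPr xb) (max_idPr ax). Qed.

Lemma clamp_itv (a b x : R) : a <= b -> a <= clamp a b x <= b.
Proof. by move=> ab; rewrite /clamp le_max lexx /= ge_max ab ge_min lexx. Qed.

Lemma clamp_near (a b d x : R) : 0 <= d -> a <= b -> a - d <= x <= b + d -> `|clamp a b x - x| <= d.
Proof.
move=> d0 ab xd; rewrite /clamp ler_norml; case: (lerP b x) => bx; first by rewrite (max_idPr ab); lra.
by case: (lerP a x) => ax; lra.
Qed.

(** By compactness some margin around the triangle is contained in U, and clamping
    the coordinates to a slightly larger triangle stays within that margin. This
    turns functions given near the triangle into functions on the plane. *)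
Lemma std_triangle_retraction (U : set (R * R)) : open U -> std_triangle `<=` U ->
  exists rho : R * R -> R * R, [/\ continuous rho, forall z, U (rho z) &
    forall z, std_triangle z -> \forall y \near z, rho y = y].
Proof.
move=> oU TU.
have cT : compact (std_triangle : set (R * R)).
  (* the image of the square under (u, v) |-> (u, u v) *)
  have -> : (std_triangle : set (R * R)) =
      (fun z : R * R => (z.1, z.1 * z.2)) @` (`[0, 1]%classic `*` `[0, 1]%classic).
    apply/seteqP; split => [[x y] [/= y0 yx x1]|z [[u v] [/=]]].
      have [x0|x0] := eqVneq x 0.
        exists (0, 0); first by split; rewrite /= in_itv /= lexx ler01.
        by rewrite /= mul0r x0; congr pair; lra.
      have xp : 0 < x by rewrite lt_neqAle eq_sym x0 (le_trans y0 yx).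
      exists (x, y / x); last by rewrite /= mulrC divfK.
      split; rewrite /= in_itv /=; first by rewrite (ltW xp).
      by rewrite divr_ge0 ?(ltW xp)//= ler_pdivrMr// mul1r.
    rewrite !in_itv /= => /andP[u0 u1] /andP[v0 v1] <-; split => //=; nra.
  apply: continuous_compact; last by apply: compact_setX; exact: segment_compact.
  apply: continuous_subspaceT => z; apply: pair_continuous; first exact: cvg_fst.
  by apply: cvgM; [exact: cvg_fst|exact: cvg_snd].
have /compact_near_coveringP ncT := cT.
have : \forall e \near (0 : R)^'+, (std_triangle : set (R * R)) `<=` [set z | ball z e `<=` U].
  apply: ncT => z Tz.
  have /nbhs_ballP[r /= r0 rU] : nbhs z U by apply: open_nbhs_nbhs; split => //; exact: TU.
  have r2 : 0 < r / 2 by lra.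
  exists (ball z (r / 2), [set e | e < r / 2]) => /=.
    split; first exact: nbhsx_ballx.
    exact: nbhs_right_lt.
  move=> [y e] [/= zy er] w yw; apply: rU.
  have := ball_triangle zy (le_ball (ltW er) yw).
  by rewrite -splitr.
move=> H.
have [e [e0 eU]] : exists e : R, 0 < e /\ (std_triangle : set (R * R)) `<=` [set z | ball z e `<=` U].
  near ((0 : R)^'+) => e; exists e; split; near: e; [exact: nbhs_right_gt|exact: H].
(* the first coordinate moves by at most d, the second by at most 3 d *)
pose d := e / 4; have d0 : 0 < d by rewrite /d; lra.
pose rho (z : R * R) : R * R :=
  let x := clamp (- d) (1 + d) z.1 in (x, clamp (- d) (x + d + d) z.2).
exists rho; split.
- move=> z.
  have c1 : {for z, continuous (fun z : R * R => clamp (- d) (1 + d) z.1)}.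
    by apply: continuous_comp; [exact: cvg_fst|exact: clamp_continuous].
  apply: (@pair_continuous _ (fun z : R * R => clamp (- d) (1 + d) z.1)
    (fun z : R * R => clamp (- d) (clamp (- d) (1 + d) z.1 + d + d) z.2)) => //.
  apply: (@max_fun_continuous _ (R * R)%type R (cst (- d))
    (fun z => Num.min (clamp (- d) (1 + d) z.1 + d + d) z.2)) => [y|y]; first exact: cst_continuous.
  apply: (@min_fun_continuous _ (R * R)%type R _ snd) => u; last exact: cvg_snd.
  apply: cvgD; last exact: cvg_cst.
  apply: cvgD; last exact: cvg_cst.
  by apply: continuous_comp; [exact: cvg_fst|exact: clamp_continuous].
- move=> z; rewrite /rho; set x := clamp _ _ z.1.
  have xI : - d <= x <= 1 + d by apply: clamp_itv; lra.
  have yI := @clamp_itv (- d) (x + d + d) z.2 ltac:(lra).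
  set y := clamp _ _ z.2 in yI *.
  pose x' := clamp 0 1 x.
  have x'I := @clamp_itv 0 1 x ler01; rewrite -/x' in x'I.
  have x'd : `|x' - x| <= d.
    by apply: clamp_near; [exact: ltW|exact: ler01|lra].
  pose y' := clamp 0 x' y.
  have y'I := @clamp_itv 0 x' y ltac:(lra); rewrite -/y' in y'I.
  apply: (eU (x', y')); first by split; rewrite /=; lra.
  split; rewrite /ball /=; first by apply: le_lt_trans x'd _; rewrite /d; lra.
  have : `|y' - y| <= d + d + d.
    have := x'd; rewrite ler_norml => h; apply: clamp_near; lra.
  by move=> h; apply: le_lt_trans h _; rewrite /d; lra.
- move=> z [z0 z1 z2].
  have nz : \forall y \near z, `|z.1 - y.1| < d /\ `|z.2 - y.2| < d.
    exists (ball z.1 d, ball z.2 d) => //=.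
    by split; apply: nbhsx_ballx.
  near=> y.
  have [] : `|z.1 - y.1| < d /\ `|z.2 - y.2| < d by near: y.
  rewrite !ltr_norml => h1 h2.
  have e1 : clamp (- d) (1 + d) y.1 = y.1 by apply: clamp_id; lra.
  rewrite /rho /= e1 clamp_id; last by lra.
  by case: (y).
Unshelve. all: by end_near. Qed.

(** Poincare lemma, with the primitive obtained by integrating D along a horizontal
    segment and then Q along a vertical one. The coefficient D will contain the
    function f of vertical_primitive, which is differentiable in y only; therefore
    only the two cross derivatives are assumed to exist, and differentiation under
    the integral sign gives the derivative in x. *)
Lemma local_primitive (D Q E : R * R -> R) (p : R * R) :
  (\forall z \near p, [/\ {for z, continuous D}, {for z, continuous Q}, {for z, continuous E},
     is_derive z.1 1 (fun x : R => Q (x, z.2)) (E z) &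
     is_derive z.2 1 (fun y : R => D (z.1, y)) (E z)]) ->
  exists g : R * R -> R, \forall z \near p,
    is_diff (z : R^o * R^o) (g : R^o * R^o -> R^o) (fun v : R^o * R^o => D z * v.1 + Q z * v.2 : R^o).
Proof.
case: p => p1 p2 /nbhs_ballP[r /= r0 rP].
pose d := r / 2; have d0 : 0 < d by rewrite /d; lra.
pose x0 := p1 - d; pose x1 := p1 + d; pose y0 := p2 - d; pose y1 := p2 + d.
have xx : x0 <= x1 by rewrite /x0 /x1; lra.
have yy : y0 <= y1 by rewrite /y0 /y1; lra.
have boxP x y : x0 <= x <= x1 -> y0 <= y <= y1 -> [/\ {for (x, y), continuous D},
   {for (x, y), continuous Q}, {for (x, y), continuous E},
     is_derive x 1 (fun x : R => Q (x, y)) (E (x, y)) &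
     is_derive y 1 (fun y : R => D (x, y)) (E (x, y))].
  move=> xI yI; apply: rP; split; rewrite /ball /= ltr_norml; move: xI yI;
  rewrite /x0 /x1 /y0 /y1 /d; lra.
pose c (z : R * R) : R * R := (clamp x0 x1 z.1, clamp y0 y1 z.2).
have cc : continuous c.
  move=> z; apply: (@pair_continuous _ (fun z : R * R => clamp x0 x1 z.1)
    (fun z : R * R => clamp y0 y1 z.2)); (apply: continuous_comp; last exact: clamp_continuous);
  [exact: cvg_fst|exact: cvg_snd].
have cfun (h : R * R -> R) : (forall x y, x0 <= x <= x1 -> y0 <= y <= y1 -> {for (x, y), continuous h}) ->
    continuous (h \o c).
  move=> ch z; apply: continuous_comp; first exact: cc.
  by apply: ch; apply: clamp_itv.
have cD : continuous (D \o c) by apply: cfun => x y xI /(boxP _ _ xI)[].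
have cQ : continuous (Q \o c) by apply: cfun => x y xI /(boxP _ _ xI)[].
have cE : continuous (E \o c) by apply: cfun => x y xI /(boxP _ _ xI)[].
pose g (z : R * R) := \int[mu]_(u in `[x0, z.1]) (D \o c) (u, y0) +
                      \int[mu]_(v in `[y0, z.2]) (Q \o c) (z.1, v).
exists g.
have cid (x y : R) : x0 <= x <= x1 -> y0 <= y <= y1 -> c (x, y) = (x, y).
  by move=> xI yI; rewrite /c /= !clamp_id.
have gP z : x0 < z.1 < x1 -> y0 < z.2 < y1 -> has_partials g D Q z.
  case: z => x y /= xI yI.
  have xI' : x0 <= x <= x1 by move/andP: xI => [/ltW-> /ltW->].
  have yI' : y0 <= y <= y1 by move/andP: yI => [/ltW-> /ltW->].
  split; rewrite /g /=; last first.
    have <- : (0 + (Q \o c) (x, y)) = Q (x, y) by rewrite add0r /= cid.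
    apply: is_deriveD.
    apply: (antiderivative (q := fun v => (Q \o c) (x, v))); first exact: section_continuous.
    by case/andP: yI.
  pose I := (`]x0, x1[%classic : set R).
  have Ix : I x by rewrite /I /= in_itv.
  have IE u : I u -> x0 <= u <= x1 by rewrite /I /= in_itv /= => /andP[/ltW-> /ltW->].
  have BE v : (`[y0, y]%classic : set R) v -> y0 <= v <= y1.
    by rewrite /= in_itv /= => /andP[v0 vy]; rewrite v0 (le_trans vy)//; case/andP: yI'.
  have dQ u v : I u -> (`[y0, y]%classic : set R) v ->
      is_derive u 1 (fun u : R => (Q \o c) (u, v)) ((E \o c) (u, v)).
    move=> Iu Bv; have [_ _ _ dQ _] := boxP _ _ (IE _ Iu) (BE _ Bv).
    rewrite /= (cid _ _ (IE _ Iu) (BE _ Bv)); apply: near_eq_is_derive dQ.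
    have : nbhs u I by apply: open_nbhs_nbhs; split => //; exact: interval_open.
    by apply: filterS => t It; rewrite /= (cid _ _ (IE _ It) (BE _ Bv)).
  have [B BB] := continuous_box_bounded x0 x1 y0 y1 cE.
  have B0 : 0 <= B by apply: le_trans (normr_ge0 _) (BB x y xI' yI').
  have iQ u : I u -> mu.-integrable `[y0, y] (EFin \o (fun v => (Q \o c) (u, v))).
    by move=> _; apply: continuous_itv_integrable; exact: section_continuous.
  have iB : mu.-integrable `[y0, y] (EFin \o cst B).
    by apply: continuous_itv_integrable => t; exact: cst_continuous.
  have dQ1 u v : I u -> (`[y0, y]%classic : set R) v -> derivable (fun u : R => (Q \o c) (u, v)) u 1.
    by move=> Iu Bv; have [] := dQ u v Iu Bv.
  have dQ2 u v : I u -> (`[y0, y]%classic : set R) v ->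
      partial1of2 (fun u v : R => (Q \o c) (u, v)) u v = (E \o c) (u, v).
    by move=> Iu Bv; rewrite partial1of2E; have [] := dQ u v Iu Bv.
  have dQb u v : I u -> (`[y0, y]%classic : set R) v ->
      `|partial1of2 (fun u v : R => (Q \o c) (u, v)) u v| <= cst B v.
    move=> Iu Bv; rewrite dQ2//= (cid _ _ (IE _ Iu) (BE _ Bv)).
    by have := BB u v (IE _ Iu) (BE _ Bv); rewrite /= (cid _ _ (IE _ Iu) (BE _ Bv)).
  have e1 := @derivable_under_integral R _ (measurableTypeR R) mu
    (fun u v : R => (Q \o c) (u, v)) _ (measurable_itv `[y0, y]) x x0 x1 Ix iQ dQ1 (cst B)
    (fun _ => B0) iB dQb.
  have e2 := @differentiation_under_integral R _ (measurableTypeR R) mu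
    (fun u v : R => (Q \o c) (u, v)) _ (measurable_itv `[y0, y]) x x0 x1 Ix iQ dQ1 (cst B)
    (fun _ => B0) iB dQb.
  have fE : \int[mu]_(v in `[y0, y]) (E \o c) (x, v) = D (x, y) - D (x, y0).
    apply: (@Rintegral_derive (fun v => D (x, v)) (fun v => (E \o c) (x, v)) y0 y); first by case/andP: yI.
      exact: section_continuous.
    move=> v vI; have vI' : y0 <= v <= y1 by apply: BE; rewrite /= in_itv.
    by rewrite /= (cid _ _ xI' vI'); have [] := boxP _ _ xI' vI'.
  have -> : D (x, y) = (D \o c) (x, y0) + (D (x, y) - D (x, y0)).
    by rewrite /= cid//; [ring|rewrite lexx].
  apply: is_deriveD.
    apply: (antiderivative (q := fun u => (D \o c) (u, y0))); last by case/andP: xI.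
    exact: (@section_continuous1 (D \o c) y0 cD).
  apply: DeriveDef; first exact: e1.
  rewrite -derive1E -fE [LHS]e2; apply: eq_Rintegral => v; rewrite inE => Bv.
  exact: dQ2.
have near_box : \forall z \near ((p1, p2) : R * R), x0 < z.1 < x1 /\ y0 < z.2 < y1.
  exists (ball p1 d, ball p2 d) => //=.
    by split; apply: nbhsx_ballx.
  by move=> [u v] [/=]; rewrite /ball /= !ltr_norml /x0 /x1 /y0 /y1 => h1 h2; split; lra.
have near_box2 : \forall z \near ((p1, p2) : R * R), \forall y \near z, x0 < y.1 < x1 /\ y0 < y.2 < y1.
  by apply: near_join.
near=> z.
have boxz : [/\ {for z, continuous D}, {for z, continuous Q} & True].
  have [xI yI] : x0 < z.1 < x1 /\ y0 < z.2 < y1 by near: z.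
  case: (z) xI yI => x y /= /andP[/ltW a1 /ltW a2] /andP[/ltW b1 /ltW b2].
  by have [] := boxP x y ltac:(by rewrite a1) ltac:(by rewrite b1).
apply: is_diff_partials.
- have : \forall y \near z, x0 < y.1 < x1 /\ y0 < y.2 < y1 by near: z.
  by apply: filterS => y [? ?]; exact: gP.
- by have [] := boxz.
- by have [] := boxz.
Unshelve. all: by end_near. Qed.

End PlaneCalculus.

(** * Local flat sections *)

Lemma pullback1_eq {R : realType} (E F : normedModType R) (N : charted F) (f1 f2 : model E -> N)
  (w : form1 N) y v : smooth_at f1 y -> (\forall x \near y, f1 x = f2 x) ->
  pullback1 f1 w y v = pullback1 f2 w y v.
Proof.
move=> sf nE; rewrite /pullback1 (nbhs_singleton nE).
by rewrite (mdiff_eq (@has_charts_model R E) nE sf).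
Qed.

Lemma pullback2_eq {R : realType} (E F : normedModType R) (N : charted F) (f1 f2 : model E -> N)
  (w : form2 N) y u v : smooth_at f1 y -> (\forall x \near y, f1 x = f2 x) ->
  pullback2 f1 w y u v = pullback2 f2 w y u v.
Proof.
move=> sf nE; rewrite /pullback2 (nbhs_singleton nE).
by rewrite (mdiff_eq (@has_charts_model R E) nE sf).
Qed.

Section FlatGerms.
Context {R : realType} {E F : normedModType R} {M : charted E} {P : charted F}.
Variables (proj : P -> M) (act : P -> S1 R -> P) (phi : form1 P) (Omega : form2 M).
Hypotheses (cE0 : fin_coord E) (cF : fin_coord F).
Hypotheses (hM : is_manifold M) (hP : is_manifold P).
Hypotheses (hb : is_circle_bundle proj act) (hphi : is_connection act phi).
Hypothesis hOmega : is_curvature proj phi Omega.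
Let cM := has_charts_manifold hM.
Let cpl := @has_charts_model R (@plane R).

Variables (Psi : model (@plane R) -> M) (f : @plane R -> R).
Hypothesis cf : continuous (f : @plane R -> R^o).
Local Notation form_in S := (pullback1 (S \o Psi : model plane -> P) phi).

Definition local_section (S : M -> P) (p : M) : Prop :=
  \forall q \near p, smooth_at S q /\ proj (S q) = q.

Lemma local_section_exists p : exists S, local_section S p.
Proof.
have [_ _ _ _ loc] := hb; have [U [oU Up] [triv [inv [_ si _ h2 _]]]] := loc p.
exists (fun q => inv (q, expi 0)).
have : \forall q \near p, U q by apply: open_nbhs_nbhs.
apply: filterS => q Uq; split; last by have [] := h2 (q, expi 0) Uq.
apply: (smooth_at_comp cM (has_charts_prod cM (@has_charts_S1 R))
  (smooth_at_pair (smooth_at_id cM q) (smooth_at_cst (N := S1 R) (expi 0) q))).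
  exact: si.
exact: fin_coord_prod (@fin_coordR R).
Qed.

(** Germs of sections over Psi that are parallel for the connection form corrected
    by - f dx: g is a primitive of the corrected form in the section S of P. The
    section S is defined on M rather than on the plane, so that along the boundary
    it can be composed with the smooth curve c. *)
Definition flat (t : @plane R -> P) (z : @plane R) : Prop :=
  exists (S : M -> P) (g : @plane R -> R^o),
  [/\ smooth_at Psi z, local_section S (Psi z) &
   \forall y \near z, is_diff y g (fun v => form_in S y v - f y * v.1 : R^o)
     /\ t y = act (S (Psi y)) (expi (- g y))].

Lemma section_near (S : M -> P) z : smooth_at Psi z -> local_section S (Psi z) ->
  \forall y \near z, [/\ smooth_at Psi y, smooth_at (S \o Psi : model plane -> P) y,
    local_section S (Psi y) & proj (S (Psi y)) = Psi y].
Proof.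
move=> sz lS.
have n1 : \forall y \near z, smooth_at Psi y by exact: (smooth_at_near hM cE0 sz).
have n2 : \forall y \near z, local_section S (Psi y).
  exact: (sz.1 _ (near_join lS)).
near=> y.
have sy : smooth_at Psi y by near: y.
have ly : local_section S (Psi y) by near: y.
have [sS pS] := nbhs_singleton ly.
by split => //; exact: (smooth_at_comp cpl cM sy sS cE0).
Unshelve. all: by end_near. Qed.

Lemma flat_near t z : flat t z -> \forall y \near z, flat t y.
Proof.
move=> [S [g [sz lS gP]]].
near=> y; exists S, g.
have [? ? ? ?] : [/\ smooth_at Psi y, smooth_at (S \o Psi : model plane -> P) y,
    local_section S (Psi y) & proj (S (Psi y)) = Psi y] by near: y; exact: section_near.
by split => //; near: y; exact: near_join gP.
Unshelve. all: by end_near. Qed.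

Lemma flat_act t z w : flat t z -> flat (fun y => act (t y) w) z.
Proof.
move=> [S [g [sz lS gP]]].
have [th _ wE] := expi_surj w.
exists S, (fun y => g y - th); split => //.
apply: filterS gP => y [[dg gE] tE]; split.
  apply: DiffDef; last by rewrite -gE; exact: diff_subr.
  by apply: differentiableB => //; exact: differentiable_cst.
by rewrite tE (actA hb) wE -expiD; congr (act _ (expi _)); ring.
Qed.

Lemma is_derive_fst (h : @plane R -> R^o) y : differentiable h y ->
  is_derive (y.1 : R^o) 1 (fun s : R^o => h (s, y.2) : R^o) ('d h y (1, 0)).
Proof.
case: y => y1 y2 dh /=.
have e s : (s, y2) = (0, y2) + s *: ((1, 0) : @plane R).
  by rewrite /GRing.scale /= /GRing.add /= /add_pair /= /scale_pair /GRing.scale /= mulr1 mulr0 add0r addr0.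
rewrite e in dh *.
have -> : (fun s : R^o => h (s, y2) : R^o) = fun s : R^o => h ((0, y2) + s *: ((1, 0) : @plane R)).
  by apply/funext => s; rewrite -e.
exact: is_derive_line.
Qed.

Lemma is_derive_snd (h : @plane R -> R^o) y : differentiable h y ->
  is_derive (y.2 : R^o) 1 (fun s : R^o => h (y.1, s) : R^o) ('d h y (0, 1)).
Proof.
case: y => y1 y2 dh /=.
have e s : (y1, s) = (y1, 0) + s *: ((0, 1) : @plane R).
  by rewrite /GRing.scale /= /GRing.add /= /add_pair /= /scale_pair /GRing.scale /= mulr1 mulr0 add0r addr0.
rewrite e in dh *.
have -> : (fun s : R^o => h (y1, s) : R^o) = fun s : R^o => h ((y1, 0) + s *: ((0, 1) : @plane R)).
  by apply/funext => s; rewrite -e.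
exact: is_derive_line.
Qed.

Lemma plane_basis (v : @plane R) : v = v.1 *: ((1, 0) : plane) + v.2 *: ((0, 1) : plane).
Proof.
case: v => v1 v2.
by rewrite /GRing.scale /= /GRing.add /= /add_pair /= /scale_pair /GRing.scale /= !mulr1 !mulr0 add0r addr0.
Qed.

Lemma zero_diff_const (h : @plane R -> R^o) z :
  (\forall y \near z, is_diff y h (fun=> 0 : R^o)) -> \forall y \near z, h y = h z.
Proof.
move=> /nbhs_ballP[r /= r0 rP].
apply/nbhs_ballP; exists r => //= y zy.
have dl t : 0 <= t <= 1 -> is_diff (z + t *: (y - z)) h (fun=> 0 : R^o).
  move=> th; apply: rP; move: zy; rewrite -!ball_normE /ball_ /= opprD addNKr normrN normrZ => zy.
  rewrite ger0_norm; last by case/andP: th.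
  rewrite (le_lt_trans _ zy)// distrC ler_piMl//; by case/andP: th.
have [|t th] := @mvt_line _ _ h z (y - z) 1 ltr01; first by move=> t /dl[].
have [_ ->] := dl t th.
rewrite mul0r scale1r [z + _]addrC subrK => /eqP; rewrite subr_eq0 => /eqP; exact.
Qed.

(** By the gauge rule, the angle between the two sections of P has the same
    differential as the difference of the two primitives. *)
Lemma flat_overlap t t' z : flat t z -> flat t' z ->
  exists w, \forall y \near z, t' y = act (t y) w.
Proof.
move=> [S [g [sz lS gP]]] [S' [g' [_ lS' gP']]].
have nS := section_near sz lS; have nS' := section_near sz lS'.
have [_ sS _ pS] := nbhs_singleton nS; have [_ sS' _ pS'] := nbhs_singleton nS'.
have [k sk kE] := local_angle cE0 cF hM hP hb sS' sS (etrans pS' (esym pS)).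
have {}kE : \forall y \near z, S' (Psi y) = act (S (Psi y)) (expi (k y)).
  near=> y.
  have py : proj (S (Psi y)) = Psi y by near: y; apply: filterS nS => y [].
  have py' : proj (S' (Psi y)) = Psi y by near: y; apply: filterS nS' => y [].
  by apply: (near kE) => //=; rewrite py py'.
pose h y := g' y - g y - k y.
have hc : \forall y \near z, h y = h z.
  apply: zero_diff_const.
  apply: filterS (filterI (filterI gP gP') (filterI (filterI nS nS') (filterI (smooth_near_near sk) (near_join kE)))).
  move=> y [[[dg _] [dg' _]] [[[_ sSy _ _] [_ sSy' _ _]] [skk kk]]].
  have dk := smooth_near_differentiable skk.
  have e v : form_in S' y v = form_in S y v + 'd k y v.
    rewrite -(twist_pullback cF hP hb hphi sSy skk).
    by apply: pullback1_eq => //.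
  have dk' : is_diff y k ('d k y) by split.
  have [d1 d2] := @is_diffB _ _ _ _ _ _ _ y (@is_diffB _ _ _ _ _ _ _ y dg' dg) dk'.
  split; first exact: d1.
  rewrite [LHS]d2; apply/funext => v /=; rewrite /= !fctE e; ring.
exists (expi (- h z)).
apply: filterS (filterI (filterI gP gP') (filterI kE hc)) => y [[[_ ->] [_ ->]] [-> <-]].
rewrite !(actA hb) -!expiD; congr (act _ (expi _)).
rewrite /h; ring.
Unshelve. all: by end_near. Qed.

Let e1 : @plane R := (1, 0).
Let e2 : @plane R := (0, 1).

(** S followed by proj is the identity, so the pullback of the exterior derivative
    of phi by the section is the pullback of Omega by Psi. *)
Lemma curvature_in_section S y : smooth_at Psi y -> local_section S (Psi y) ->
  'd (fun z => form_in S z e2 : R^o) y e1 -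
  'd (fun z => form_in S z e1 : R^o) y e2 =
  pullback2 Psi Omega y e1 e2.
Proof.
move=> sy lS; have [h1 h2] := hOmega; have [w1 _ _] := hphi.
have [_ sS _ _] := nbhs_singleton (section_near sy lS).
rewrite (pullback_dform1 cF hP w1 sS) -h2.
rewrite (pullback2_comp hP Omega e1 e2 sS (proj_smooth hb _)).
have nE : \forall x \near y, (proj \o (S \o Psi)) x = Psi x.
  by apply: filterS (section_near sy lS) => x [].
symmetry; apply: pullback2_eq => //.
by apply: filterS nE.
Qed.

(** In a local section the coefficient of the curvature is a combination of
    derivatives of the smooth coefficients of phi. *)
Lemma curvature_continuous y : smooth_at Psi y ->
  {for y, continuous (fun z => pullback2 Psi Omega z e1 e2 : R^o)}.
Proof.
move=> sy; have [S lS] := local_section_exists (Psi y).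
have [w1 _ _] := hphi.
have [_ sS _ _] := nbhs_singleton (section_near sy lS).
have sP v := pullback1_smooth cF hP w1 sS v.
have sd v u := smooth_near_derive u (sP v).
have c2 := differentiable_continuous (smooth_near_differentiable (sd e2 e1)).
have c1 := differentiable_continuous (smooth_near_differentiable (sd e1 e2)).
have := continuousB c2 c1.
have nE : \forall x \near y,  pullback2 Psi Omega x e1 e2 =
  'd (fun z => form_in S z e2 : R^o) x e1 -
  'd (fun z => form_in S z e1 : R^o) x e2 :> R^o.
  by apply: filterS (section_near sy lS) => x [sx _ lx _]; rewrite curvature_in_section.
rewrite /prop_for /continuous_at (nbhs_singleton nE) /=.
apply: cvg_trans; apply: near_eq_cvg; apply: filterS nE => x ->; done.
Qed.

(** The derivative of f in y compensates the curvature, so the corrected connection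
    form is closed. *)
Lemma flat_exists z : smooth_at Psi z ->
  (\forall y \near z, is_derive (y.2 : R^o) 1 (fun s : R^o => f (y.1, s) : R^o)
     (- pullback2 Psi Omega y e1 e2)) ->
  exists t, flat t z.
Proof.
move=> sz df; have [S lS] := local_section_exists (Psi z).
have [w1 _ _] := hphi.
pose p v := fun y => form_in S y v : R^o.
have [g gP] : exists g : R * R -> R, \forall z \near (z : R * R),
    is_diff (z : R^o * R^o) (g : R^o * R^o -> R^o)
      (fun v : R^o * R^o => (p e1 z - f z) * v.1 + p e2 z * v.2 : R^o).
  apply: (@local_primitive R (fun z => p e1 z - f z) (p e2) (fun y => 'd (p e2) y e1)).
  near=> y.
  have [sy sS lSy _] : [/\ smooth_at Psi y, smooth_at (S \o Psi : model plane -> P) y,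
    local_section S (Psi y) & proj (S (Psi y)) = Psi y] by near: y; exact: section_near.
  have sP v : smooth_near (p v) y by exact: (pullback1_smooth cF hP w1 sS v).
  have dP v := smooth_near_differentiable (sP v).
  split.
  - have c1 := differentiable_continuous (dP e1); have c2 := @cf y.
    by apply: cvgB; [exact: c1|exact: c2].
  - exact: differentiable_continuous (dP e2).
  - exact: differentiable_continuous (smooth_near_differentiable (smooth_near_derive e1 (sP e2))).
  - exact: is_derive_fst (dP e2).
  - have df2 : is_derive (y.2 : R^o) 1 (fun s : R^o => f (y.1, s) : R^o) (- pullback2 Psi Omega y e1 e2) by near: y.
    have := is_deriveB (is_derive_snd (dP e1)) df2.
    have e : 'd (p e1) y (0, 1) - - pullback2 Psi Omega y e1 e2 = 'd (p e2) y e1.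
      by rewrite opprK -(curvature_in_section sy lSy) addrC subrK.
    by rewrite e.
exists (fun y => act (S (Psi y)) (expi (- g y))), S, g; split => //.
near=> y; split => //.
have [dg gE] : is_diff (y : R^o * R^o) (g : R^o * R^o -> R^o)
      (fun v : R^o * R^o => (p e1 y - f y) * v.1 + p e2 y * v.2 : R^o) by near: y.
split => //; rewrite gE; apply/funext => v.
have [sy sS lSy _] : [/\ smooth_at Psi y, smooth_at (S \o Psi : model plane -> P) y,
    local_section S (Psi y) & proj (S (Psi y)) = Psi y] by near: y; exact: section_near.
rewrite {3}(plane_basis v) /pullback1 mdiffD// !mdiffZ// (phiD hphi) !(phiZ hphi) /p /pullback1.
ring.
Unshelve. all: by end_near. Qed.

End FlatGerms.

(** * Gluing flat sections over a convex set *)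

Section Gluing.
Context {R : realType}.
Local Notation plane := (@plane R).
Variables (P : Type) (act : P -> S1 R -> P) (fl : (plane -> P) -> plane -> Prop).
Hypothesis act1 : forall p, act p (expi 0) = p.
Hypothesis act_free : forall p z w, act p z = act p w -> z = w.
Hypothesis fl_near : forall t z, fl t z -> \forall y \near z, fl t y.
Hypothesis fl_act : forall t z w, fl t z -> fl (fun y => act (t y) w) z.
Hypothesis fl_overlap : forall t t' z, fl t z -> fl t' z -> exists w, \forall y \near z, t' y = act (t y) w.

(** Below, a flat section is any section whose germs belong to a family fl that is
    open, invariant under rotations, and in which two germs differ by a rotation. *)
Definition flat_on (K : set plane) (s : plane -> P) : Prop :=
  forall z, K z -> exists2 t, fl t z & \forall y \near z, K y -> s y = t y.

Definition segment_closed (K : set plane) : Prop :=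
  forall z z' (u : R), K z -> K z' -> 0 <= u <= 1 -> K (z + u *: (z' - z)).

Lemma flat_on_sub K K' s : K' `<=` K -> flat_on K s -> flat_on K' s.
Proof.
move=> sub fs z /sub /fs[t ft st]; exists t => //.
by apply: filterS st => y h /sub; exact: h.
Qed.

Lemma flat_on_act K s w : flat_on K s -> flat_on K (fun y => act (s y) w).
Proof.
move=> fs z /fs[t ft st]; exists (fun y => act (t y) w); first exact: fl_act.
by apply: filterS st => y h /h ->.
Qed.

(** The rotation between two flat sections is locally constant, hence constant
    along segments. *)
Lemma flat_unique K s1 s2 z0 : segment_closed K -> K z0 -> flat_on K s1 -> flat_on K s2 ->
  exists w, forall z, K z -> s2 z = act (s1 z) w.
Proof.
move=> cK Kz0 f1 f2.
have loc z : K z -> exists w, \forall y \near z, K y -> s2 y = act (s1 y) w.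
  move=> Kz; have [t1 ft1 e1] := f1 z Kz; have [t2 ft2 e2] := f2 z Kz.
  have [w wE] := fl_overlap ft1 ft2; exists w.
  apply: filterS (filterI e1 (filterI e2 wE)) => y [h1 [h2 h3]] Ky.
  by rewrite h1// h2// h3.
have [w0 w0E] : exists w, s2 z0 = act (s1 z0) w.
  by have [w wE] := loc _ Kz0; exists w; exact: (nbhs_singleton wE).
exists w0 => z Kz.
pose l (u : R) : plane := z0 + u *: (z - z0).
have Kl u : 0 <= u <= 1 -> K (l u) by exact: cK.
pose Q (c d : R) := exists w, forall u, c <= u <= d -> s2 (l u) = act (s1 (l u)) w.
have [||w wE] := @interval_chain R Q 0 1 ler01.
- move=> c d e c0 cd de e1 [w wE] [w' wE']; exists w => u /andP[cu ue].
  have ww : w = w'.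
    apply: (@act_free (s1 (l d))); rewrite -wE ?cd ?lexx//.
    by rewrite -wE' ?de ?lexx.
  have [ud|du] := leP u d; first by apply: wE; rewrite cu ud.
  by rewrite ww; apply: wE'; rewrite (ltW du) ue.
- move=> u u01; have [w wE] := loc (l u) (Kl u u01).
  have cl : {for u, continuous (l : R^o -> plane)}.
    by have [dl _] := @is_diff_line R plane z0 (z - z0) u; exact: differentiable_continuous.
  have /nbhs_ballP[e /= e0 eP] := cl _ wE.
  exists e => // c d c0 /andP[cu ud] d1 ec de; exists w => v /andP[cv vd].
  apply: eP; last by apply: Kl; apply/andP; split; lra.
  by rewrite /ball /= ltr_norml; lra.
have /= w1 := wE 0 ltac:(by rewrite lexx ler01).
have /= w2 := wE 1 ltac:(by rewrite lexx ler01).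
move: w1 w2; rewrite /l scale0r addr0 scale1r [z0 + _]addrC subrK => w1 ->.
by congr act; apply: (@act_free (s1 z0)); rewrite -w1.
Qed.

(** Once the second section is rotated so as to match the first one on the
    intersection, their germs at a common point coincide because the action is
    free. *)
Lemma flat_glue K1 K2 s1 s2 : closed K1 -> closed K2 -> segment_closed (K1 `&` K2) ->
  flat_on K1 s1 -> flat_on K2 s2 -> exists s, flat_on (K1 `|` K2) s.
Proof.
move=> c1 c2 c12 f1 f2.
have [w wE] : exists w, forall z, K1 z -> K2 z -> act (s2 z) w = s1 z.
  have [[z0 Kz0]|K0] := pselect (K1 `&` K2 !=set0).
    have [w wE] := flat_unique c12 Kz0 (flat_on_sub (@subIsetr _ K1 K2) f2) (flat_on_sub (@subIsetl _ K1 K2) f1).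
    by exists w => z k1 k2; rewrite (wE z).
  by exists (expi 0) => z k1 k2; exfalso; apply: K0; exists z.
have {}f2 := flat_on_act w f2.
pose s z := if `[< K1 z >] then s1 z else act (s2 z) w.
have sE1 z : K1 z -> s z = s1 z by move=> k; rewrite /s; case: asboolP.
have sE2 z : K2 z -> s z = act (s2 z) w.
  by move=> k2; rewrite /s; case: asboolP => // k1; rewrite wE.
have away (K : set plane) (z : plane) : closed K -> ~ K z -> \forall y \near z, ~ K y.
  by move=> cK nK; apply: open_nbhs_nbhs; split => //; exact: closed_openC.
exists s => z Kz.
have [k1|k1] := pselect (K1 z); have [k2|k2] := pselect (K2 z).
- have [t1 ft1 e1] := f1 z k1; have [t2 ft2 e2] := f2 z k2.
  have [v vE] := fl_overlap ft1 ft2.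
  have v1 : v = expi 0.
    apply: (@act_free (t1 z)); rewrite act1 -(nbhs_singleton vE).
    by rewrite -(nbhs_singleton e1 k1) -(nbhs_singleton e2 k2) /= wE.
  exists t1 => //; apply: filterS (filterI e1 (filterI e2 vE)) => y [h1 [h2 h3]].
  by case=> k; [rewrite sE1// h1|rewrite sE2// h2// h3 v1 act1].
- have [t1 ft1 e1] := f1 z k1; exists t1 => //.
  apply: filterS (filterI e1 (away K2 z c2 k2)) => y [h1 h2] [k|//].
  by rewrite sE1// h1.
- have [t2 ft2 e2] := f2 z k2; exists t2 => //.
  apply: filterS (filterI e2 (away K1 z c1 k1)) => y [h1 h2] [//|k].
  by rewrite sE2// h1.
- by case: Kz.
Qed.

Section Box.
Variable K : set plane.
Hypotheses (clK : closed K) (cvK : segment_closed K).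
Hypothesis flK : forall z, K z -> exists t, fl t z.

Let box (c d c' d' : R) : set plane := K `&` [set z | c <= z.1 <= d /\ c' <= z.2 <= d'].

Let box_closed c d c' d' : closed (box c d c' d').
Proof.
apply: closedI => //.
have cf : continuous (fst : plane -> R) by move=> z; exact: cvg_fst.
have cs : continuous (snd : plane -> R) by move=> z; exact: cvg_snd.
rewrite (_ : [set z | _] = (fst @^-1` `[c, d]%classic) `&` (snd @^-1` `[c', d']%classic)).
  by apply: closedI; apply: preimage_closed => //; exact: interval_closed.
by apply/seteqP; split => z /=; rewrite !in_itv /= => -[].
Qed.

Let convex_itv (c d x y u : R) : c <= x <= d -> c <= y <= d -> 0 <= u <= 1 ->
  c <= x + u * (y - x) <= d.
Proof. by move=> /andP[? ?] /andP[? ?] /andP[? ?]; apply/andP; split; nra. Qed.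

Let box_segment c d c' d' e f e' f' : segment_closed (box c d c' d' `&` box e f e' f').
Proof.
move=> z z' u [[k1 [h1 h2]] [_ [h3 h4]]] [[k1' [h1' h2']] [_ [h3' h4']]] u01.
by split; (split; [exact: cvK|split; exact: convex_itv]).
Qed.

Let local_box z0 x y : K z0 -> exists2 e, 0 < e & exists t, flat_on (box (x - e) (x + e) (y - e) (y + e)) t.
Proof.
move=> Kz0.
have [t tP] : exists t, \forall z \near ((x, y) : plane), K z -> fl t z.
  have [k|k] := pselect (K (x, y)).
    by have [t ft] := flK k; exists t; apply: filterS (fl_near ft) => z.
  have [t _] := flK Kz0; exists t.
  have : \forall z \near ((x, y) : plane), ~ K z.
    by apply: open_nbhs_nbhs; split => //; exact: closed_openC.
  by apply: filterS => z.
have /nbhs_ballP[r /= r0 rP] := tP.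
exists (r / 2); first lra.
exists t => z [kz [/andP[z1 z2] /andP[z3 z4]]]; exists t; last by near=> q.
apply: rP => //; split; rewrite /ball /= ltr_norml; apply/andP; split; lra.
Unshelve. all: by end_near. Qed.

Let strip z0 x : K z0 -> exists2 e, 0 < e & exists t, flat_on (box (x - e) (x + e) 0 1) t.
Proof.
move=> Kz0.
pose Q (c d : R) := exists2 e, 0 < e & exists t, flat_on (box (x - e) (x + e) c d) t.
apply: (@interval_chain R Q 0 1 ler01).
- move=> c d e c0 cd de e1 [r r0 [t ft]] [r' r0' [t' ft']].
  pose q := Num.min r r'.
  have qr : q <= r by rewrite ge_min lexx.
  have qr' : q <= r' by rewrite ge_min lexx orbT.
  exists q; first by rewrite lt_min r0.
  have s1 : box (x - q) (x + q) c d `<=` box (x - r) (x + r) c d.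
    by move=> z [kz [/andP[? ?] h]]; split => //; split => //; apply/andP; split; lra.
  have s2 : box (x - q) (x + q) d e `<=` box (x - r') (x + r') d e.
    by move=> z [kz [/andP[? ?] h]]; split => //; split => //; apply/andP; split; lra.
  have [s fs] := flat_glue (@box_closed _ _ _ _) (@box_closed _ _ _ _) (@box_segment _ _ _ _ _ _ _ _)
    (flat_on_sub s1 ft) (flat_on_sub s2 ft').
  exists s; apply: flat_on_sub fs => z [kz [h1 /andP[h2 h3]]].
  by have [zd|dz] := leP z.2 d; [left|right]; split => //; split => //; apply/andP; split => //; exact: ltW.
- move=> y _; have [e e0 [t ft]] := local_box x y Kz0.
  exists e => // c d c0 /andP[cy yd] d1 ec de; exists e => //; exists t.
  by apply: flat_on_sub ft => z [kz [h1 /andP[h2 h3]]]; split => //; split => //; apply/andP; split; lra.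
Qed.

(** Chaining in y gives a flat section over a thin vertical strip around each x,
    and chaining in x assembles the strips. The intersections are convex at each
    step. *)
Lemma flat_on_exists z0 : K z0 -> K `<=` [set z | 0 <= z.1 <= 1 /\ 0 <= z.2 <= 1] ->
  exists s, flat_on K s.
Proof.
move=> Kz0 Ksub.
have [s fs] : exists t, flat_on (box 0 1 0 1) t.
  apply: (@interval_chain R (fun c d => exists t, flat_on (box c d 0 1) t) 0 1 ler01).
  - move=> c d e c0 cd de e1 [t ft] [t' ft'].
    have [s fs] := flat_glue (@box_closed _ _ _ _) (@box_closed _ _ _ _) (@box_segment _ _ _ _ _ _ _ _) ft ft'.
    exists s; apply: flat_on_sub fs => z [kz [/andP[h1 h2] h3]].
    by have [zd|dz] := leP z.1 d; [left|right]; split => //; split => //; apply/andP; split => //; exact: ltW.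
  - move=> x _; have [e e0 [t ft]] := strip x Kz0.
    exists e => // c d c0 /andP[cy yd] d1 ec de; exists t.
    by apply: flat_on_sub ft => z [kz [/andP[h1 h2] h3]]; split => //; split => //; apply/andP; split; lra.
by exists s; apply: flat_on_sub fs => z kz; split => //; exact: Ksub.
Qed.

End Box.
End Gluing.

(** * A flat section over the triangle *)

Section FlatSection.
Context {R : realType} {E F : normedModType R} {M : charted E} {P : charted F}.
Local Notation plane := (@plane R).
Local Notation mu := (@lebesgue_measure R).
Variables (proj : P -> M) (act : P -> S1 R -> P) (phi : form1 P) (Omega : form2 M).
Hypotheses (cE0 : fin_coord E) (cF : fin_coord F).
Hypotheses (hM : is_manifold M) (hP : is_manifold P).
Hypotheses (hb : is_circle_bundle proj act) (hphi : is_connection act phi).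
Hypothesis hOmega : is_curvature proj phi Omega.
Variable (Psi : model plane -> M).
Hypothesis sPsi : forall z, std_triangle z -> smooth_at Psi z.

Lemma std_triangle_closed : closed (std_triangle : set plane).
Proof.
have cf : continuous (fst : plane -> R) by move=> z; exact: cvg_fst.
have cs : continuous (snd : plane -> R) by move=> z; exact: cvg_snd.
have cd : continuous (fun z : plane => z.1 - z.2 : R).
  by move=> z; apply: cvgB; [exact: cf|exact: cs].
rewrite (_ : std_triangle = (snd @^-1` `[0, +oo[%classic) `&`
  ((fun z : plane => z.1 - z.2 : R) @^-1` `[0, +oo[%classic) `&` (fst @^-1` `]-oo, 1]%classic)).
  apply: closedI; last by apply: preimage_closed => //; exact: interval_closed.
  by apply: closedI; apply: preimage_closed => //; exact: interval_closed.
by apply/seteqP; split => z /=; rewrite !in_itv /= ?andbT subr_ge0 => -[//[]].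
Qed.

Lemma std_triangle_segment : segment_closed (std_triangle : set plane).
Proof.
move=> z z' u [a1 a2 a3] [b1 b2 b3] /andP[u0 u1]; rewrite /std_triangle /= /GRing.scale /=; split; nra.
Qed.

(** The values of f on the diagonal are minus the integrals of the curvature over
    the vertical slices of the triangle, so that the integral of f along the
    diagonal is an area integral. *)
Lemma flat_section_exists : exists (W f : R * R -> R) (s : plane -> P),
  [/\ continuous W, forall z, std_triangle z -> W z = pullback2 Psi Omega z (1, 0) (0, 1),
      continuous f /\ forall x, f (x, 0) = 0,
      forall x, 0 <= x -> f (x, x) = - \int[mu]_(y in `[0, x]) W (x, y)
    & flat_on (flat proj act phi Psi f) std_triangle s].
Proof.
pose U : set plane := [set z | smooth_at Psi z].
have oU : open U.
  by rewrite openE => z sz; exact: (smooth_at_near hM cE0 sz).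
have [rho [crho Urho rhoE]] := std_triangle_retraction oU sPsi.
pose b (z : plane) : R^o := pullback2 Psi Omega z (1, 0) (0, 1).
pose W z := b (rho z).
have cW : continuous W.
  move=> z; apply: (@continuous_comp _ _ _ rho b); first exact: crho.
  exact: (curvature_continuous cE0 cF hM hP hb hphi hOmega (Urho z)).
have WE z : std_triangle z -> W z = b z by move=> /rhoE /nbhs_singleton; rewrite /W => ->.
have [f [fc f0 df fd]] := vertical_primitive cW.
have fex z : std_triangle z -> exists t, flat proj act phi Psi f t z.
  move=> Tz; apply: (flat_exists cE0 cF hM hP hb hphi hOmega fc (sPsi Tz)).
  have z2 : -1 < z.2 by case: Tz => ? _ _; lra.
  have n2 : \forall y \near (z : plane), -1 < y.2.
    case: (z) z2 => z1 z2 /= z20.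
    by apply: (@near_snd R z1 z2 (fun u => -1 < u)); exact: lt_nbhsr.
  apply: filterS (filterI n2 (rhoE z Tz)) => -[y1 y2] /= [y20 ry].
  by have := df y1 y2 y20; rewrite /W ry.
have T0 : std_triangle ((0, 0) : plane) by split; rewrite /= ?lexx ?ler01.
have [s fs] := flat_on_exists (act1 hb) (@act_free _ _ _ _ _ _ _ hb)
  (@flat_near _ _ _ _ _ proj act phi cE0 hM Psi f)
  (@flat_act _ _ _ _ _ proj act phi hb Psi f)
  (@flat_overlap _ _ _ _ _ proj act phi cE0 cF hM hP hb hphi Psi f)
  std_triangle_closed std_triangle_segment fex T0
  (fun z h => let: And3 h1 h2 h3 := h in conj (introT andP (conj (le_trans h1 h2) h3)) (introT andP (conj h1 (le_trans h2 h3)))).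
by exists W, f, s; split.
Qed.

End FlatSection.

(** * The boundary circuit *)

Section BoundaryPath.
Context {R : realType}.
Local Notation plane := (@plane R).
Local Notation mu := (@lebesgue_measure R).

Let u (x : R) := clamp 0 1 x.

Lemma clamp_low (x : R) : x <= 0 -> clamp 0 1 x = 0.
Proof. by move=> x0; rewrite /clamp (min_idPr _) ?(max_idPl _)//; lra. Qed.

Lemma clamp_high (x : R) : 1 <= x -> clamp 0 1 x = 1.
Proof. by move=> x0; rewrite /clamp (min_idPl _) ?(max_idPr _)//; lra. Qed.

(** Coordinates of the circuit (0, 0) -> (1, 0) -> (1, 1) -> (0, 0), run twice for s
    in [0, 6] so that one round fits in for any starting point in [0, 3). As sums
    of clamped ramps they are continuous at the corners too. *)
Definition edge_x (s : R) : R := u s - u (s - 2) + u (s - 3) - u (s - 5).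
Definition edge_y (s : R) : R := u (s - 1) - u (s - 2) + u (s - 4) - u (s - 5).

Local Ltac clamps := rewrite /edge_x /edge_y /u;
  repeat (match goal with |- context [clamp 0 1 ?x] =>
    first [rewrite (@clamp_low x); [|lra] | rewrite (@clamp_high x); [|lra]
          | rewrite (@clamp_id R 0 1 x); [|lra]] end).

Lemma edge1 (s : R) : 0 <= s <= 1 -> edge_x s = s /\ edge_y s = 0.
Proof. by move=> h; clamps; split; lra. Qed.

Lemma edge2 (s : R) : 1 <= s <= 2 -> edge_x s = 1 /\ edge_y s = s - 1.
Proof. by move=> h; clamps; split; lra. Qed.

Lemma edge3 (s : R) : 2 <= s <= 3 -> edge_x s = 3 - s /\ edge_y s = 3 - s.
Proof. by move=> h; clamps; split; lra. Qed.

Lemma edge4 (s : R) : 3 <= s <= 4 -> edge_x s = s - 3 /\ edge_y s = 0.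
Proof. by move=> h; clamps; split; lra. Qed.

Lemma edge5 (s : R) : 4 <= s <= 5 -> edge_x s = 1 /\ edge_y s = s - 4.
Proof. by move=> h; clamps; split; lra. Qed.

Lemma edge6 (s : R) : 5 <= s <= 6 -> edge_x s = 6 - s /\ edge_y s = 6 - s.
Proof. by move=> h; clamps; split; lra. Qed.

Lemma six_cases (s : R) : 0 <= s < 6 ->
  [\/ 0 <= s < 1, 1 <= s < 2 | 2 <= s < 3] \/ [\/ 3 <= s < 4, 4 <= s < 5 | 5 <= s < 6].
Proof.
move=> /andP[s0 s6].
have [h1|h1] := ltP s 1; first by left; constructor 1; apply/andP.
have [h2|h2] := ltP s 2; first by left; constructor 2; apply/andP.
have [h3|h3] := ltP s 3; first by left; constructor 3; apply/andP.
have [h4|h4] := ltP s 4; first by right; constructor 1; apply/andP.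
have [h5|h5] := ltP s 5; first by right; constructor 2; apply/andP.
by right; constructor 3; apply/andP.
Qed.

Lemma circuit_edge (A B C : plane) (s : R) (q : int) : 0 <= s < 6 ->
  circuit A B C (s + (q * 3)%:~R) = tri_chart A B C (edge_x s, edge_y s).
Proof.
move=> s06.
have E (k : int) : k%:~R <= s < (k + 1)%:~R ->
   circuit A B C (s + (q * 3)%:~R) = vertex A B C k + (s - k%:~R) *: (vertex A B C (k + 1) - vertex A B C k).
  move=> ks.
  have fE : Num.floor (s + (q * 3)%:~R) = (q * 3 + k).
    apply: floor_def; rewrite !intrD in ks *; move: ks => /andP[? ?]; apply/andP; split; lra.
  have vE j : vertex A B C (q * 3 + j) = vertex A B C j by rewrite /vertex modzMDl.
  have e : s + (q * 3)%:~R - (q * 3 + k)%:~R = s - k%:~R by rewrite intrD; ring.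
  by rewrite /circuit fE e -addrA !vE.
have P (x y x' y' : R) : x = x' -> y = y' -> (x, y) = (x', y') by move=> -> ->.
have [] := six_cases s06 => -[] ks.
- rewrite (E 0); last by rewrite add0r; exact: ks.
  have [|-> ->] := @edge1 s; first lra.
  by rewrite /vertex /= /tri_chart; apply: P; rewrite /= /GRing.scale /=; ring.
- rewrite (E 1); last exact: ks.
  have [|-> ->] := @edge2 s; first lra.
  by rewrite /vertex /= /tri_chart; apply: P; rewrite /= /GRing.scale /=; ring.
- rewrite (E 2); last exact: ks.
  have [|-> ->] := @edge3 s; first lra.
  by rewrite /vertex /= /tri_chart; apply: P; rewrite /= /GRing.scale /=; ring.
- rewrite (E 3); last exact: ks.
  have [|-> ->] := @edge4 s; first lra.
  by rewrite /vertex /= /tri_chart; apply: P; rewrite /= /GRing.scale /=; ring.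
- rewrite (E 4); last exact: ks.
  have [|-> ->] := @edge5 s; first lra.
  by rewrite /vertex /= /tri_chart; apply: P; rewrite /= /GRing.scale /=; ring.
- rewrite (E 5); last exact: ks.
  have [|-> ->] := @edge6 s; first lra.
  by rewrite /vertex /= /tri_chart; apply: P; rewrite /= /GRing.scale /=; ring.
Qed.

Lemma edge_std (s : R) : 0 <= s < 6 -> std_triangle (edge_x s, edge_y s).
Proof.
move=> /six_cases[] [] ks; rewrite /std_triangle /=.
- by have [|-> ->] := @edge1 s; [lra|split; lra].
- by have [|-> ->] := @edge2 s; [lra|split; lra].
- by have [|-> ->] := @edge3 s; [lra|split; lra].
- by have [|-> ->] := @edge4 s; [lra|split; lra].
- by have [|-> ->] := @edge5 s; [lra|split; lra].
- by have [|-> ->] := @edge6 s; [lra|split; lra].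
Qed.

Lemma edge_period (s : R) : 0 <= s < 3 -> edge_x (s + 3) = edge_x s /\ edge_y (s + 3) = edge_y s.
Proof.
move=> s3.
have [] := six_cases (s := s) ltac:(lra) => -[] ks; [| | |lra|lra|lra].
- by have [|-> ->] := @edge1 s; [lra|]; have [|-> ->] := @edge4 (s + 3); [lra|split; lra].
- by have [|-> ->] := @edge2 s; [lra|]; have [|-> ->] := @edge5 (s + 3); [lra|split; lra].
- by have [|-> ->] := @edge3 s; [lra|]; have [|-> ->] := @edge6 (s + 3); [lra|split; lra].
Qed.

Lemma edge_continuous : continuous edge_x /\ continuous edge_y.
Proof.
have cu (d : R) : continuous (fun s : R => u (s - d)).
  move=> s; apply: (@continuous_comp _ _ _ (fun s : R => s - d) u); last exact: clamp_continuous.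
  by apply: cvgB; [exact: cvg_id|exact: cvg_cst].
have cu0 : continuous u by exact: clamp_continuous.
split=> s; rewrite /edge_x /edge_y.
  by apply: cvgB; [apply: cvgD; [apply: cvgB|]|]; [exact: cu0|exact: cu|exact: cu|exact: cu].
by apply: cvgB; [apply: cvgD; [apply: cvgB|]|]; exact: cu.
Qed.

Lemma within_continuous_comp (a b : R) (s g : R -> R) : {within `[a, b], continuous s} ->
  continuous g -> {within `[a, b], continuous (g \o s)}.
Proof.
move=> cs cg t; apply: (@continuous_comp (subspace `[a, b]%classic) _ _ s g); first exact: cs.
exact: cg.
Qed.

Lemma near_eq_derive (f g : R -> R) (t d : R) : (\forall x \near t, f x = g x) ->
  is_derive t 1 g d -> is_derive t 1 f d.
Proof. by move=> fg dg; apply: near_eq_is_derive dg; apply: filterS fg => x ->. Qed.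

Lemma squeeze_derive (v w : R -> R) (t : R) : (\forall x \near t, `|v x - v t| <= `|w x - w t|) ->
  is_derive t 1 w 0 -> is_derive t 1 v 0.
Proof.
move=> vw [dw dw0].
suff : h^-1 *: ((v \o shift t) (h *: 1) - v t) @[h --> 0^'] --> (0 : R).
  move=> c; have := cvg_lim (@Rhausdorff R) c => e.
  by apply: DeriveDef; [apply: cvgP; exact: c|exact: e].
have : h^-1 *: ((w \o shift t) (h *: 1) - w t) @[h --> 0^'] --> 'D_1 w t by exact: dw.
rewrite dw0.
move=> c; apply/cvgr0Pnorm_le => e e0.
have /cvgr0Pnorm_le /(_ e e0) n1 := c.
have n2 : \forall h \near (0 : R)^', `|v (h + t) - v t| <= `|w (h + t) - w t|.
  apply: cvg_within.
  have cs : {for (0 : R), continuous (fun h : R => h + t)}.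
    by apply: cvgD; [exact: cvg_id|exact: cvg_cst].
  by move: cs; rewrite /prop_for /continuous_at add0r => cs; exact: (cs _ vw).
apply: filterS (filterI n1 n2) => h [h1 h2].
apply: le_trans h1; rewrite !normrZ ler_wpM2l//=.
by rewrite /GRing.scale /= mulr1.
Qed.

Lemma near_itvoo (a b t : R) : a < t < b -> \forall x \near t, a < x < b.
Proof.
move=> tab; have : nbhs t (`]a, b[%classic : set R) by apply: near_in_itvoo; rewrite in_itv.
by apply: filterS => x; rewrite /= in_itv.
Qed.
Section Path.
Variables (sigma : R -> R) (a b : R) (f : R * R -> R).
Hypothesis ab : a < b.
Hypothesis csigma : {within `[a, b], continuous sigma}.
Hypothesis msigma : {in `[a, b] &, {homo sigma : s t / s <= t}}.
Hypothesis sigmab : sigma b = sigma a + 3.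
Hypothesis cf : continuous f.
Hypothesis f0 : forall x, f (x, 0) = 0.

Let q (x : R) := f (x, x).
Let cq : continuous q.
Proof.
move=> x; apply: (@continuous_comp _ _ _ (fun x : R => (x, x)) f); last exact: cf.
by apply: pair_continuous => z.
Qed.

Let h (x : R) := \int[mu]_(t in `[-1, x]) q t.
Let dh (x : R) : -1 < x -> is_derive x 1 h (q x).
Proof. exact: antiderivative. Qed.

Let hI : \int[mu]_(x in `[0, 1]) f (x, x) = h 1 - h 0.
Proof. by apply: (@Rintegral_derive R h q 0 1) => // t th; apply: dh; lra. Qed.

Let hu_continuous (e : R) : continuous (fun s : R => h (u (e - s))).
Proof.
have cu : continuous (fun s : R => u (e - s)).
  move=> s; apply: (@continuous_comp _ _ _ (fun s : R => e - s) u); last exact: clamp_continuous.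
  by apply: cvgB; [exact: cvg_cst|exact: cvg_id].
move=> s; apply: (@continuous_comp _ _ _ (fun s : R => u (e - s)) h); first exact: cu.
have /andP[u0 _] : 0 <= u (e - s) <= 1 by apply: clamp_itv.
have [d _] : is_derive (u (e - s)) 1 h (q (u (e - s))) by apply: dh; lra.
by apply: differentiable_continuous; apply/derivable1_diffP.
Qed.

Let theta0 (s : R) := h (u (3 - s)) + h (u (6 - s)).

Let k0 := Num.floor (sigma a / 3).
Let sh t := sigma t - (k0 * 3)%:~R.

Let sha : 0 <= sh a < 3.
Proof.
have := floor_itv (sigma a / 3); rewrite -/k0 /sh intrM intrD => h1; lra.
Qed.

Let sh_itv t : a <= t <= b -> sh a <= sh t <= sh b.
Proof.
move=> /andP[ta tb]; rewrite /sh !lerB// msigma ?in_itv /= ?lexx ?ta ?tb ?(ltW ab)//.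
Qed.

Let shb : sh b = sh a + 3. Proof. by rewrite /sh sigmab; ring. Qed.

Let sh6 t : a <= t <= b -> 0 <= sh t < 6.
Proof. by move=> /sh_itv; rewrite shb => h1; have := sha; lra. Qed.

Let csh : {within `[a, b], continuous sh}.
Proof.
apply: (@within_continuous_comp a b sigma (fun s : R => s - (k0 * 3)%:~R) csigma) => x.
by apply: cvgB; [exact: cvg_id|exact: cvg_cst].
Qed.

(** boundary_path is the circuit in the standard triangle with the time of sigma,
    and boundary_angle is a primitive of f dx along it: it is constant on the sides
    y = 0 and x = 1, and it is h x up to a constant on the diagonal. The two terms
    of theta0 belong to the runs through the diagonal for s in [2, 3] and [5, 6];
    k0 counts the rounds before the starting point. *)
Definition boundary_path t : plane := (edge_x (sh t), edge_y (sh t)).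
Definition boundary_angle t := theta0 (sh t).

Lemma boundary_path_std (A B C : plane) t : a <= t <= b -> std_triangle (boundary_path t) /\
  circuit A B C (sigma t) = tri_chart A B C (boundary_path t).
Proof.
move=> /sh6 ht; split; first exact: edge_std.
by rewrite -(circuit_edge A B C k0)// /sh subrK.
Qed.

Lemma boundary_closed : boundary_path b = boundary_path a /\
  boundary_angle b = boundary_angle a - \int[mu]_(x in `[0, 1]) f (x, x).
Proof.
have h3 := sha; split.
  by rewrite /boundary_path shb; have [-> ->] := edge_period h3.
rewrite /boundary_angle shb hI /theta0.
have -> : 6 - (sh a + 3) = 3 - sh a by ring.
have -> : u (3 - (sh a + 3)) = 0 by apply: clamp_low; lra.
have -> : u (6 - sh a) = 1 by apply: clamp_high; lra.
ring.
Qed.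

Lemma boundary_path_continuous : {within `[a, b], continuous boundary_path}.
Proof.
have [cx cy] := edge_continuous.
have := @within_continuous_comp a b sh edge_x csh cx; have := @within_continuous_comp a b sh edge_y csh cy.
move=> c2 c1 t; exact: (@pair_continuous R (subspace `[a, b]%classic) _ _ t (@c1 t) (@c2 t)).
Qed.

Lemma boundary_angle_continuous : {within `[a, b], continuous boundary_angle}.
Proof.
apply: (@within_continuous_comp a b sh theta0 csh) => s.
by apply: cvgD; exact: hu_continuous.
Qed.

Let X t := edge_x (sh t).

Hypothesis dX : forall t, a < t < b -> derivable X t 1.

Let near_sh (t c d : R) : a < t < b -> c < sh t < d -> \forall x \near t, (a < x < b) /\ (c < sh x < d).
Proof.
move=> tab cd; have [ci _ _] := (continuous_within_itvP sh ab).1 csh.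
have ct : {for t, continuous sh} by apply: ci; rewrite in_itv.
have n1 : \forall x \near t, c < sh x < d by exact: (ct _ (near_itvoo cd)).
exact: filterI (near_itvoo tab) n1.
Qed.

Let X_bounds t : a <= t <= b -> 0 <= X t <= 1.
Proof. by move=> /sh6 /edge_std[/= h1 h2 h3]; rewrite /X; lra. Qed.

Let X_extremal t : a < t < b -> X t = 0 \/ X t = 1 -> is_derive t 1 X 0.
Proof.
move=> tab e.
have hd s : s \in `]a, b[%R -> derivable X s 1 by rewrite in_itv; exact: dX.
have ti : t \in `]a, b[%R by rewrite in_itv.
have hX s : s \in `]a, b[%R -> 0 <= X s <= 1.
  by rewrite in_itv /= => sab; apply: X_bounds; lra.
case: e => e.
  by apply: (derive1_at_min (ltW ab) hd ti) => s /hX; rewrite e; lra.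
by apply: (derive1_at_max (ltW ab) hd ti) => s /hX; rewrite e; lra.
Qed.

Let derive_hX t (c : R) : a < t < b -> (\forall x \near t, boundary_angle x = h (X x) + c) ->
  is_derive t 1 boundary_angle (q (X t) * 'D_1 X t).
Proof.
move=> tab e; apply: near_eq_derive e _.
rewrite -[X in is_derive _ _ _ X]addr0; apply: is_deriveD.
have X0 : -1 < X t by have := X_bounds (t := t) ltac:(lra); lra.
have dXt : is_derive t 1 X ('D_1 X t) by apply: DeriveDef => //; exact: dX.
have := @is_derive1_comp R h X t _ _ (dh X0) dXt.
by [].
Qed.

Let derive_cst t (c : R) : (\forall x \near t, boundary_angle x = c) -> is_derive t 1 boundary_angle 0.
Proof. by move=> e; apply: near_eq_derive e _; exact: is_derive_cst. Qed.

(** On the side y = 0 the function f vanishes; on the side x = 1 the function x is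
    maximal, hence stationary; on the diagonal the angle is a function of x. At the
    corner (0, 0) the change of the angle is controlled by that of x, which is
    minimal there, hence stationary. *)
Lemma boundary_angle_derive t : a < t < b ->
  is_derive t 1 boundary_angle (f (boundary_path t) * 'D_1 (fun t => (boundary_path t).1) t).
Proof.
move=> tab; have t6 : 0 <= sh t < 6 by apply: sh6; lra.
rewrite -[fun t => _]/X.
have flat0 : edge_y (sh t) = 0 -> f (boundary_path t) = 0.
  by move=> e; rewrite /boundary_path e f0.
have extr : X t = 0 \/ X t = 1 -> 'D_1 X t = 0 by move=> e; have [] := X_extremal tab e.
have diag : edge_y (sh t) = edge_x (sh t) -> f (boundary_path t) = q (X t).
  by move=> e; rewrite /boundary_path e.
have [s1|s1] := leP (sh t) 1.
  rewrite flat0; last by have [] := @edge1 (sh t) ltac:(lra).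
  rewrite mul0r; apply: (@derive_cst t (h 1 + h 1)).
  have := near_sh (c := -1) (d := 2) tab ltac:(lra).
  apply: filterS => x [xab xs]; rewrite /boundary_angle /theta0 /u !clamp_high//; lra.
have [s3|s3] := ltP (sh t) 3.
  have dt : is_derive t 1 boundary_angle (q (X t) * 'D_1 X t).
    apply: (@derive_hX t (h 1)) => //.
    have := near_sh (c := 1) (d := 3) tab ltac:(lra).
    apply: filterS => x [xab xs]; rewrite /boundary_angle /theta0 /X.
    have -> : u (6 - sh x) = 1 by apply: clamp_high; lra.
    have [x2|x2] := leP (sh x) 2.
      by have [|-> _] := @edge2 (sh x); [lra|]; rewrite /u clamp_high//; lra.
    by have [|-> _] := @edge3 (sh x); [lra|]; rewrite /u clamp_id//; lra.
  have [s2|s2] := leP (sh t) 2.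
    have D0 : 'D_1 X t = 0 by apply: extr; right; have [] := @edge2 (sh t) ltac:(lra).
    by move: dt; rewrite D0 !mulr0.
  by rewrite diag//; have [|-> ->] := @edge3 (sh t); [lra|].
have [s3'|s3'] := eqVneq (sh t) 3.
  have X0 : X t = 0 by have [e _] := @edge4 (sh t) ltac:(lra); rewrite /X e; lra.
  have dX0 := X_extremal tab (or_introl X0).
  rewrite extr; last by left.
  rewrite mulr0.
  have du : is_derive t 1 (fun x => u (3 - sh x)) 0.
    apply: (@squeeze_derive _ X) => //.
    have := near_sh (c := 2) (d := 4) tab ltac:(lra).
    apply: filterS => x [xab xs]; rewrite X0 s3' subrr /u (@clamp_low 0)// !subr0.
    rewrite /X.
    have [x3|x3] := leP (sh x) 3.
      by have [|-> _] := @edge3 (sh x); [lra|]; rewrite clamp_id//; lra.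
    by rewrite clamp_low ?normr0//; lra.
  apply: (@near_eq_derive _ (fun x => h (u (3 - sh x)) + h 1)).
    have := near_sh (c := 2) (d := 4) tab ltac:(lra).
    apply: filterS => x [xab xs]; rewrite /boundary_angle /theta0.
    by have -> : u (6 - sh x) = 1 by apply: clamp_high; lra.
  rewrite -[X in is_derive _ _ _ X]addr0; apply: is_deriveD.
  have hh : is_derive (u (3 - sh t)) 1 h (q (u (3 - sh t))).
    by apply: dh; have := clamp_itv (3 - sh t) (@ler01 R); rewrite /u; lra.
  have := @is_derive1_comp R h (fun x => u (3 - sh x)) t _ _ hh du.
  by rewrite mulr0.
have [s4|s4] := leP (sh t) 4.
  rewrite flat0; last by have [] := @edge4 (sh t) ltac:(lra).
  rewrite mul0r; apply: (@derive_cst t (h 0 + h 1)).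
  have := near_sh (c := 3) (d := 5) tab ltac:(lra).
  apply: filterS => x [xab xs]; rewrite /boundary_angle /theta0 /u.
  by rewrite clamp_low ?clamp_high//; lra.
have dt : is_derive t 1 boundary_angle (q (X t) * 'D_1 X t).
  apply: (@derive_hX t (h 0)) => //.
  have := near_sh (c := 4) (d := 6) tab ltac:(lra).
  apply: filterS => x [xab xs]; rewrite /boundary_angle /theta0 /X addrC.
  have -> : u (3 - sh x) = 0 by apply: clamp_low; lra.
  have [x2|x2] := leP (sh x) 5.
    by have [|-> _] := @edge5 (sh x); [lra|]; rewrite /u clamp_high//; lra.
  by have [|-> _] := @edge6 (sh x); [lra|]; rewrite /u clamp_id//; lra.
have [s5|s5] := leP (sh t) 5.
  have D0 : 'D_1 X t = 0 by apply: extr; right; have [] := @edge5 (sh t) ltac:(lra).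
  by move: dt; rewrite D0 !mulr0.
by rewrite diag//; have [|-> ->] := @edge6 (sh t); [lra|].
Qed.

End Path.
End BoundaryPath.

(** * Paths through an immersion *)

Section Immersion.
Context {R : realType}.

(** Near the point, gam moves at most twice as far as its image under H, so that
    the remainder of H is negligible in comparison with the increment of time. *)
Lemma near_identity_path (E1 : normedModType R) (H : E1 -> E1) (gam : R -> E1) (t : R) :
  is_diff (gam t) H (id : E1 -> E1) -> {for t, continuous gam} ->
  derivable (H \o gam) t 1 -> derivable gam t 1.
Proof.
move=> [dH dHE] cg dHg.
pose w := 'D_1 (H \o gam) t.
pose D (h : R) := (H \o gam) (h + t) - (H \o gam) t.
pose G (h : R) := gam (h + t) - gam t.
have limD : h^-1 *: D h @[h --> 0^'] --> w.
  have : h^-1 *: ((H \o gam \o shift t) (h *: 1) - (H \o gam) t) @[h --> 0^'] --> w by exact: dHg.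
  by under eq_cvg do rewrite /= /GRing.scale /= mulr1 -/(D _).
pose C := `|w| + 1.
have C0 : 0 < C by rewrite /C ltr_wpDl.
have nD : \forall h \near 0^', `|h^-1 *: D h| <= C.
  have /cvgrPdist_le /(_ 1 ltr01) := limD.
  apply: filterS => h h1; rewrite /C addrC -lerBlDr (le_trans _ h1)//.
  by rewrite (le_trans (lerB_dist _ _))// distrC.
have ch : h + t @[h --> (0 : R)] --> t.
  by rewrite -[X in _ --> X]add0r; apply: cvgD; [exact: cvg_id|exact: cvg_cst].
have cG : G h @[h --> (0 : R)] --> (0 : E1).
  have -> : (0 : E1) = gam t - gam t by rewrite subrr.
  apply: cvgB; last exact: cvg_cst.
  by apply: (@cvg_comp _ _ _ (fun h : R => h + t) gam); [exact: ch|exact: cg].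
have remainder e : 0 < e -> \forall h \near (0 : R), `|D h - G h| <= e * `|G h|.
  move=> e0.
  have := diff_locally dH; rewrite dHE => /eqaddoP n.
  have n0 : \forall h \near (0 : R),
      `|(H \o shift (gam t) - (cst (H (gam t)) + id)) (G h)| <= e * `|G h|.
    exact: (cG _ (n e e0)).
  apply: filterS n0 => h.
  by rewrite /G /D /= !fctE /= subrK opprD addrA.
apply: (cvgP w); apply/cvgrPdist_le => e e0.
pose e1 := Num.min (1 / 2) (e / (4 * C)).
have C4 : 0 < 4 * C by rewrite mulr_gt0.
have e10 : 0 < e1 by rewrite lt_min divr_gt0// divr_gt0.
have e1h : e1 <= 1 / 2 by rewrite ge_min lexx.
have e1e : e1 * (4 * C) <= e by rewrite -ler_pdivlMr// ge_min lexx orbT.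
have n1 : \forall h \near 0^', `|D h - G h| <= e1 * `|G h| by apply: cvg_within; exact: remainder.
have e20 : 0 < e / 2 by rewrite divr_gt0.
have /cvgrPdist_le /(_ _ e20) n2 := limD.
apply: filterS (filterI n1 (filterI n2 nD)) => h [h1 [h2 h3]].
have -> : (gam \o shift t) (h *: 1) - gam t = G h by rewrite /= /GRing.scale /= mulr1.
have hG : `|G h| <= 2 * `|D h|.
  have : `|G h| <= `|D h| + `|D h - G h|.
    by rewrite addrC [`|D h - _|]distrC; have := ler_normD (G h - D h) (D h); rewrite subrK.
  have : e1 * `|G h| <= 1 / 2 * `|G h| by rewrite ler_wpM2r.
  lra.
rewrite -[w](subrK (h^-1 *: D h)) -addrA -scalerBr (le_trans (ler_normD _ _))//.
rewrite normrZ.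
have h4 : `|h^-1| * `|D h - G h| <= `|h^-1| * (e1 * (2 * `|D h|)).
  by rewrite ler_wpM2l// (le_trans h1)// ler_wpM2l// ltW.
have h5 : `|h^-1| * (e1 * (2 * `|D h|)) <= e1 * (2 * C).
  have -> : `|h^-1| * (e1 * (2 * `|D h|)) = e1 * (2 * (`|h^-1| * `|D h|)) by ring.
  rewrite -normrZ ler_wpM2l//; first exact: ltW.
  by rewrite ler_wpM2l.
lra.
Qed.

Lemma linear_left_inverse n (L : {linear @plane R -> 'rV[R]_n}) : injective L ->
  exists2 K : {linear 'rV[R]_n -> @plane R}, continuous K & forall v, K (L v) = v.
Proof.
move=> iL.
pose A : 'M[R]_(2, n) := \matrix_(i, j) (L (if i == 0 then (1, 0) else (0, 1))) 0 j.
have LA (v : 'rV[R]_2) : v *m A = L (v 0 0, v 0 1).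
  rewrite (plane_basis (v 0 0, v 0 1)) linearD !linearZ /=.
  apply/rowP => j; rewrite !mxE !big_ord_recl big_ord0 addr0 !mxE /=.
  by congr (_ * _ + v _ _ * _); apply: val_inj.
have fA : row_free A.
  apply: inj_row_free => v; rewrite LA => v0.
  have : (v 0 0, v 0 1) = (0 : @plane R) by apply: iL; rewrite v0 linear0.
  case=> v00 v01; apply/rowP => j; rewrite mxE.
  by case: j => -[|[|//]] hj; [rewrite -v00|rewrite -v01]; congr (v _ _); apply: val_inj.
pose k (w : 'rV[R]_n) : @plane R := ((w *m pinvmx A) 0 0, (w *m pinvmx A) 0 1).
have lk : linear k.
  move=> x u v; rewrite /k mulmxDl -scalemxAl !mxE; congr pair.
have [K KE] := linear_pack lk.
exists K.
  have [I [e [l [lP lE]]]] := @fin_coord_rV R n.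
  move=> w; rewrite /prop_for /continuous_at.
  have Kw u : K u = \sum_j l j u *: K (e j).
    by rewrite {1}(lE u) linear_sum; apply: eq_bigr => j _; rewrite linearZ.
  have -> : (K : 'rV[R]_n -> @plane R) = fun u => \sum_j l j u *: K (e j) by apply/funext.
  have dl j : is_diff w (fun u => l j u *: K (e j)) (fun u => l j u *: K (e j)).
    have [ll lc] := lP j; have [g gE] := linear_pack ll.
    have dg : differentiable (l j) w by rewrite -gE; apply: linear_differentiable; rewrite gE.
    have [d dE] := is_diff_scalef dg (differentiable_cst (K (e j)) w).
    split; first exact: d.
    by rewrite dE; apply/funext => u; rewrite diff_cst scaler0 add0r -gE diff_lin// gE.
  have [d _] := @is_diff_bigsum _ _ _ _ (fun j u => l j u *: K (e j)) w (fun j => let: DiffDef p _ := dl j in p).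
  exact: differentiable_continuous d.
move=> v; rewrite KE /k.
pose v' : 'rV[R]_2 := \row_j (if j == 0 then v.1 else v.2).
have -> : L v = v' *m A by rewrite LA !mxE /=; case: (v).
by rewrite -mulmxA mulmxVp// mulmx1 !mxE /=; case: (v).
Qed.

(** A left inverse of the differential reduces this to a map whose differential is
    the identity. *)
Lemma immersion_path n (G : @plane R -> 'rV[R]_n) (gam : R -> @plane R) (t : R) :
  differentiable G (gam t) -> injective ('d G (gam t)) -> {for t, continuous gam} ->
  derivable (G \o gam) t 1 -> derivable gam t 1.
Proof.
move=> dG iG cg dGg.
have [K cK KL] := linear_left_inverse iG.
have dK w : differentiable K w by exact: linear_differentiable.
apply: (@near_identity_path _ (K \o G)) => //.
  split; first exact: differentiable_comp.
  rewrite (diff_comp dG (dK _)) (diff_lin _ cK); apply/funext => v /=.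
  exact: KL.
apply/derivable1_diffP; apply: (@differentiable_comp _ _ _ _ (G \o gam) K) => //.
by apply/derivable1_diffP.
Qed.

End Immersion.

(** * Horizontal lifts over the boundary *)

Section Lifts.
Context {R : realType} {E F : normedModType R} {M : charted E} {P : charted F}.
Local Notation plane := (@plane R).
Local Notation mu := (@lebesgue_measure R).
Variables (proj : P -> M) (act : P -> S1 R -> P) (phi : form1 P).
Hypotheses (cE0 : fin_coord E) (cF : fin_coord F).
Hypotheses (hM : is_manifold M) (hP : is_manifold P).
Hypotheses (hb : is_circle_bundle proj act) (hphi : is_connection act phi).
Let cM := has_charts_manifold hM.
Let cR := @has_charts_model R R^o.

Lemma is_diff_path (E1 : normedModType R) (c : R^o -> E1) (t : R^o) : derivable c t 1 ->
  is_diff t c (fun h : R^o => h *: 'D_1 c t).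
Proof.
move=> /derivable1_diffP dc; split => //; apply/funext => h.
by rewrite deriveE// -linearZ /= /GRing.scale /= mulr1.
Qed.

Lemma smooth_antiderivative (q : R^o -> R^o) (t0 : R^o) : smooth_near q t0 ->
  exists2 w : R^o -> R^o, smooth_near w t0 & \forall t \near t0, is_derive (t : R^o) 1 w (q t).
Proof.
move=> [U [oU Ut] qU].
have /nbhs_ballP[r /= r0 rU] : nbhs t0 U by apply: open_nbhs_nbhs; split.
pose d := r / 2; have d0 : 0 < d by rewrite /d; lra.
pose k (x : R) : R := clamp (t0 - d) (t0 + d) x.
have kU x : U (k x).
  apply: rU; rewrite /ball /= /k.
  have := @clamp_itv R (t0 - d) (t0 + d) x ltac:(lra).
  by rewrite /d => /andP[? ?]; rewrite ltr_norml; apply/andP; split; lra.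
have cqk : continuous (q \o k : R -> R).
  move=> x; apply: (@continuous_comp _ _ _ k q); first exact: clamp_continuous.
  exact: (qU 0%N _ (kU x)).
pose w (x : R^o) : R^o := \int[mu]_(t in `[t0 - r, x]) (q \o k) t.
have dw x : ball t0 d x -> is_derive x 1 w (q x).
  rewrite /ball /= ltr_norml => /andP[x1 x2].
  have := @antiderivative R (q \o k) (t0 - r) x cqk ltac:(rewrite /d in x2; lra).
  by rewrite /= /k clamp_id//; apply/andP; split; lra.
exists w; last by apply: filterS (nbhsx_ballx t0 d d0).
exists (ball t0 d); first by split; [exact: ball_open|exact: ballxx].
move=> j; apply: CkS; apply: (@Ck_derive R j (ball t0 d) w q) => //; first exact: ball_open.
apply: Ck_sub (qU j) => x; rewrite /ball /= => h; apply: rU.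
by apply: lt_trans h _; rewrite /d; lra.
Qed.

Lemma within_near_const (k : R -> R) (a b t0 : R) : a <= t0 <= b ->
  (\forall t \near t0, (a <= t <= b -> k @ within `[a, b]%classic (nbhs t) --> k t) /\
     (a < t < b -> is_derive t 1 k 0)) ->
  \forall t \near t0, a <= t <= b -> k t = k t0.
Proof.
move=> t0ab /nbhs_ballP[r /= r0 rN].
have sub x y : a <= x -> y <= b -> t0 - r < x -> y < t0 + r -> {within `[x, y], continuous k}.
  move=> ax yb rx yr; apply/subspace_continuousP => z; rewrite /= in_itv /= => zxy.
  have [ck _] := rN z ltac:(by rewrite /ball /= ltr_norml; apply/andP; split; lra).
  apply: cvg_trans (ck ltac:(lra)); apply: cvg_app; apply: within_subset.
  by move=> w; rewrite /= !in_itv /=; lra.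
apply/nbhs_ballP; exists r => //= t; rewrite /ball /= ltr_norml => /andP[h1 h2] tab.
have [tt|tt] := leP t0 t.
  apply: (derive0_const tt); first by apply: sub; lra.
  move=> s st; have [_ dk] := rN s ltac:(by rewrite /ball /= ltr_norml; apply/andP; split; lra).
  by apply: dk; lra.
symmetry; apply: (derive0_const (ltW tt)); first by apply: sub; lra.
move=> s st; have [_ dk] := rN s ltac:(by rewrite /ball /= ltr_norml; apply/andP; split; lra).
by apply: dk; lra.
Qed.

Lemma mdiff_path (f : model plane -> P) (gam : R^o -> plane) (c : model R^o -> P) (t : R^o) :
  smooth_at f (gam t) -> derivable gam t 1 -> (\forall s \near t, c s = f (gam s)) ->
  mdiff c t 1 = mdiff f (gam t) ('D_1 gam t).
Proof.
move=> sf dg cE; have ct := nbhs_singleton cE.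
have [dg1 dg2] := is_diff_path dg.
have df : differentiable (in_charts f (gam t)) (gam t) := smooth_at_differentiable sf.
have nE : \forall s \near t, (in_charts f (gam t) \o gam) s = in_charts c t s.
  by apply: filterS cE => s e; rewrite /in_charts /= e ct.
have [_ dE] := near_eq_diff nE (differentiable_comp dg1 df).
by rewrite /mdiff [LHS](congr1 (fun h => h 1) dE) (diff_comp dg1 df) /= dg2 scale1r.
Qed.

Section OverCurve.
Variables (a b : R) (c : model R^o -> M).
Hypothesis ab : a < b.
Hypothesis hc : forall t, a <= t <= b -> smooth_at c t.

(** By the gauge rule the angle between two horizontal lifts has derivative zero. *)
Lemma lift_unique (e1 e2 : model R^o -> P) : is_horizontal_lift proj phi a b c e1 ->
  is_horizontal_lift proj phi a b c e2 ->
  exists z, forall t, a <= t <= b -> e2 t = act (e1 t) z.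
Proof.
move=> h1 h2.
pose Q (x y : R) := exists z, forall t, x <= t <= y -> e2 t = act (e1 t) z.
apply: (@interval_chain R Q a b (ltW ab)).
  move=> x y z ax xy yz zb [v hv] [w hw]; exists v => t /andP[xt tz].
  have vw : v = w.
    apply: (act_free hb (p := e1 y)); rewrite -hv ?xy ?lexx//.
    by rewrite -hw ?yz ?lexx.
  have [ty|yt] := leP t y; first by apply: hv; rewrite xt ty.
  by rewrite vw; apply: hw; rewrite (ltW yt).
move=> t0 t0ab; have [s1 p1 _] := h1 t0 t0ab; have [s2 p2 _] := h2 t0 t0ab.
have [k sk kE] := local_angle cE0 cF hM hP hb s2 s1 (etrans p2 (esym p1)).
have {}kE : \forall t \near t0, a <= t <= b -> e2 t = act (e1 t) (expi (k t)).
  apply: filterS kE => t h tab; apply: h.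
  by have [_ -> _] := h1 t tab; have [_ -> _] := h2 t tab.
have nk : \forall t \near (t0 : R), smooth_near k t /\
    \forall t \near t, a <= t <= b -> e2 t = act (e1 t) (expi (k t)).
  exact: (filterI (smooth_near_near sk) (near_join kE)).
have kc : \forall t \near t0, a <= t <= b -> k t = k t0.
  apply: within_near_const => //.
  apply: filterS nk => t [skt kt].
  have dk := smooth_near_differentiable skt.
  split => tab; first by apply: cvg_within_filter; exact: differentiable_continuous.
  have tab' : a <= t <= b by lra.
  have [s1t p1t h1t] := h1 t tab'; have [s2t p2t h2t] := h2 t tab'.
  have eq : \forall x \near t, e2 x = act (e1 x) (expi (k x)).
    apply: filterS (filterI (near_itvoo tab) kt) => x [xab h]; apply: h; lra.
  have dk0 : 'd k t 1 = 0.
    have := twist_pullback cF hP hb hphi s1t skt (1 : R^o).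
    rewrite -(@pullback1_eq _ _ _ _ _ _ phi t (1 : R^o) s2t eq).
    by rewrite [pullback1 e2 _ _ _]h2t [pullback1 e1 _ _ _]h1t add0r => <-.
  by rewrite -dk0 -deriveE//; apply: DeriveDef => //; apply/derivable1_diffP.
have kk : \forall t \near t0, (a <= t <= b -> e2 t = act (e1 t) (expi (k t))) /\
    (a <= t <= b -> k t = k t0).
  exact: (filterI kE kc).
have /nbhs_ballP[e /= e0 eP] := kk.
exists e => // x y ax /andP[xt ty] yb ex ey; exists (expi (k t0)) => t /andP[xt' ty'].
have [] := eP t; first by rewrite /ball /= ltr_norml; lra.
have tab : a <= t <= b by lra.
by move=> h h'; rewrite h// h'.
Qed.

Variables (Psi : model plane -> M) (f : plane -> R) (s : plane -> P).
Hypothesis hs : flat_on (flat proj act phi Psi f) std_triangle s.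
Variables (gam : R -> plane) (th : R -> R).
Hypothesis gamT : forall t, a <= t <= b -> std_triangle (gam t).
Hypothesis cgam : forall t, a <= t <= b -> c t = Psi (gam t).
Hypothesis gam_cont : {within `[a, b], continuous gam}.
Hypothesis th_cont : {within `[a, b], continuous th}.
Hypothesis dgam : forall t, a < t < b -> derivable gam t 1.
Hypothesis dth : forall t, a < t < b -> is_derive t 1 th (f (gam t) * ('D_1 gam t).1).

Local Notation form_in S := (pullback1 (S \o Psi : model plane -> P) phi).
Local Notation form_along S t := (pullback1 (S \o c : model R^o -> P) phi t (1 : R^o)).

Definition boundary_lift t := act (s (gam t)) (expi (- th t)).

Definition horizontal_near (z : model R^o -> P) (t0 : R) : Prop :=
  \forall t \near (t0 : R^o), [/\ smooth_at z t, proj (z t) = c t & phi (z t) (velocity z t) = 0].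

(** By the gauge rule the angle has to be an antiderivative of minus the connection
    form along S o c, which is a smooth function of time. *)
Lemma rotated_section_horizontal (S : M -> P) t0 : a <= t0 <= b -> local_section proj S (c t0) ->
  exists2 w : R^o -> R^o, smooth_near w t0 & (forall v : R, horizontal_near (fun t => act (S (c t)) (expi (w t + v))) t0)
    /\ \forall t \near t0, is_derive (t : R^o) 1 w (- form_along S t).
Proof.
move=> t0ab lS; have sc := hc t0ab.
have [w1 _ _] := hphi.
have nS : \forall t \near (t0 : R^o), smooth_at (S \o c : model R^o -> P) t /\ proj (S (c t)) = c t.
  have n1 : \forall t \near (t0 : R^o), smooth_at c t by exact: (smooth_at_near hM cE0 sc).
  have n2 : \forall t \near (t0 : R^o), smooth_at S (c t) /\ proj (S (c t)) = c t by exact: (sc.1 _ lS).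
  apply: filterS (filterI n1 n2) => t [st [sS pS]]; split => //.
  exact: (smooth_at_comp cR cM st sS cE0).
have [sS0 _] := nbhs_singleton nS.
have sp := pullback1_smooth cF hP w1 sS0 (1 : R^o).
have sq : smooth_near (fun t : R^o => - form_along S t : R^o) t0.
  have h := smooth_nearZ (smooth_near_cst (-1 : R^o) t0) sp.
  rewrite (_ : (fun t => _) = fun t : R^o => cst (-1 : R^o) t *: (form_along S t : R^o)) //.
  by apply/funext => t; rewrite /= scaleN1r.
have [w sw dw] := smooth_antiderivative sq.
exists w => //; split => // v.
apply: filterS (filterI (smooth_near_near sw) (filterI nS dw)) => t [swt [[sSt pSt] dwt]].
have swv : smooth_near (fun t : R^o => w t + v : R^o) t.
  exact: (smooth_nearD swt (smooth_near_cst (v : R^o) t)).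
split.
- exact: (twist_smooth_at cF hP hb sSt swv).
- by rewrite (proj_act cF hP hb) pSt.
- have := twist_pullback cF hP hb hphi sSt swv (1 : R^o).
  rewrite /pullback1 /velocity => ->; rewrite -[phi _ _]/(form_along S t).
  have dwd := smooth_near_differentiable swt.
  have -> : 'd (fun t : R^o => w t + v : R^o) t = 'd w t :> (R^o -> R^o).
    by have := diff_subr (- v : R^o) dwd; under eq_fun do rewrite opprK.
  by rewrite -deriveE//; have [_ ->] := dwt; rewrite subrr.
Qed.

(** The angle - g (gam t) - th t of the lift in the section S is merely known to be
    differentiable inside ]a, b[, but its derivative is that of the smooth angle of
    rotated_section_horizontal, so that the two differ by a constant. *)
Lemma local_lift t0 : a <= t0 <= b -> exists2 z : model R^o -> P, horizontal_near z t0 &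
  \forall t \near t0, a <= t <= b -> boundary_lift t = z t.
Proof.
move=> t0ab.
have [tau [S [g [sPsi lS gP]]] sE] := hs (gamT t0ab).
have lSc : local_section proj S (c t0) by rewrite cgam.
have [w sw [hw dw]] := rotated_section_horizontal t0ab lSc.
pose k (t : R) : R := - g (gam t) - th t - w t.
have gin A t : a <= t <= b -> (\forall y \near gam t, A y) -> \forall s \near t, a <= s <= b -> A (gam s).
  move=> tab nA; have /subspace_continuousP /(_ t) := gam_cont.
  rewrite /= in_itv /= => /(_ tab) cg.
  have : within `[a, b]%classic (nbhs t) (fun x => A (gam x)) by exact: (cg A nA).
  rewrite /within /=; apply: filterS => x h xab; apply: h.
  by rewrite /= in_itv.
have n1 : \forall t \near t0, a <= t <= b ->
    (\forall y \near gam t, is_diff y g (fun v => form_in S y v - f y * v.1 : R^o)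
     /\ tau y = act (S (Psi y)) (expi (- g y))) /\
    smooth_at (S \o Psi : model plane -> P) (gam t) /\ (std_triangle (gam t) -> s (gam t) = tau (gam t)).
  apply: (gin (fun y : plane => (\forall y \near y, is_diff y g (fun v => form_in S y v - f y * v.1 : R^o)
     /\ tau y = act (S (Psi y)) (expi (- g y))) /\
    smooth_at (S \o Psi : model plane -> P) y /\ (std_triangle y -> s y = tau y)) t0) => //.
  apply: filterI; first exact: (near_join gP).
  by apply: filterI sE; apply: filterS (section_near cE0 hM sPsi lS) => y [].
have kc : \forall t \near t0, a <= t <= b -> k t = k t0.
  apply: within_near_const => //.
  have nw : \forall t \near (t0 : R), smooth_near w t /\ is_derive (t : R^o) 1 w (- form_along S t).
    exact: (filterI (smooth_near_near sw) dw).
  apply: filterS (filterI n1 nw) => t [h [swt dwt]]; split => tab.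
    have [gt [_ _]] := h tab.
    have [[dg _] _] := nbhs_singleton gt.
    have cg : {for gam t, continuous g} by exact: differentiable_continuous.
    have cw : {for t, continuous w} by apply: differentiable_continuous; exact: smooth_near_differentiable.
    have /subspace_continuousP /(_ t) := gam_cont; have /subspace_continuousP /(_ t) := th_cont.
    rewrite /= in_itv /= => /(_ tab) c1 /(_ tab) c2.
    apply: cvgB; last by apply: cvg_within_filter; exact: cw.
    apply: cvgB; last exact: c1.
    by apply: cvgN; exact: (cvg_comp gam g c2 cg).
  have tab' : a <= t <= b by lra.
  have [gt [sSt _]] := h tab'.
  have [dg _] := nbhs_singleton gt.
  have dgt := dgam tab.
  have dgg : is_derive t 1 (g \o gam) ('d g (gam t) ('D_1 gam t)).
    have [dg1 _] := dg.
    exact: (is_derive_path dg1 (is_diff_path dgt)).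
  have cE : \forall x \near (t : R^o), (S \o c) x = (S \o Psi) (gam x).
    apply: filterS (near_itvoo tab) => x xab; congr S; apply: cgam; lra.
  have e : form_along S t =
      form_in S (gam t) ('D_1 gam t).
    by rewrite /pullback1 (mdiff_path sSt dgt cE) /= cgam.
  have := is_deriveB (is_deriveB (is_deriveN dgg) (dth tab)) dwt.
  have [_ ->] := dg; rewrite e => d.
  have -> : (0 : R) = - (form_in S (gam t) ('D_1 gam t) - f (gam t) * ('D_1 gam t).1) -
     f (gam t) * ('D_1 gam t).1 - - form_in S (gam t) ('D_1 gam t) by ring.
  exact: d.
exists (fun t => act (S (c t)) (expi (w t + k t0))); first exact: hw.
apply: filterS (filterI n1 kc) => t [h1 h2] tab.
have [gt [_ st]] := h1 tab; have [_ tE] := nbhs_singleton gt.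
rewrite /boundary_lift st; last exact: gamT.
rewrite tE (actA hb) -expiD cgam//; congr (act _ (expi _)).
by rewrite -(h2 tab) /k; ring.
Qed.

(** Beyond the endpoints the lift is continued by its local form there. *)
Lemma lift_exists : exists2 eta, is_horizontal_lift proj phi a b c eta &
  forall t, a <= t <= b -> eta t = boundary_lift t.
Proof.
have [za ha ea] : exists2 z : model R^o -> P, horizontal_near z a &
    \forall t \near a, a <= t <= b -> boundary_lift t = z t.
  by apply: local_lift; rewrite lexx ltW.
have [zb hzb eb] : exists2 z : model R^o -> P, horizontal_near z b &
    \forall t \near b, a <= t <= b -> boundary_lift t = z t.
  by apply: local_lift; rewrite lexx ltW.
pose eta (t : R) := if t < a then za t else if b < t then zb t else boundary_lift t.
have etaE t : a <= t <= b -> eta t = boundary_lift t.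
  by move=> /andP[t1 t2]; rewrite /eta ltNge t1 /= ltNge t2.
exists eta => // t0 t0ab.
have [z hz ez] : exists2 z : model R^o -> P, horizontal_near z t0 & \forall t \near (t0 : R^o), z t = eta t.
  have [ta|ta] := eqVneq t0 a.
    exists za; rewrite ta//.
    have n : \forall t \near a, t < b by exact: lt_nbhsl.
    apply: filterS (filterI n ea) => t [tb h]; rewrite /eta.
    by case: ltP => // at_; rewrite ltNge (ltW tb) /= h// at_ ltW.
  have [tb|tb] := eqVneq t0 b.
    exists zb; rewrite tb//.
    have n : \forall t \near b, a < t by exact: lt_nbhsr.
    apply: filterS (filterI n eb) => t [at_ h]; rewrite /eta ltNge (ltW at_) /=.
    by case: ltP => // tb'; rewrite h// tb' ltW.
  have [z hz ez] := local_lift t0ab; exists z => //.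
  have tab : a < t0 < b by move: t0ab; rewrite !lt_neqAle [a == _]eq_sym ta tb.
  apply: filterS (filterI (near_itvoo tab) ez) => t [tab' h].
  have tab2 : a <= t <= b by lra.
  by rewrite etaE// h.
have [sz pz vz] := nbhs_singleton hz; have z0 := nbhs_singleton ez.
split.
- exact: (smooth_at_eq cR ez sz).
- by rewrite -z0.
- by rewrite -z0 /velocity (mdiff_eq cR ez sz).
Qed.

(** The flat section takes the same value at both ends of the circuit, so the lift
    turns by the change of the angle th. Rotations commute, and therefore every
    other lift turns by the same amount. *)
Lemma holonomy_from_boundary (alpha : R) : gam b = gam a -> th b = th a - alpha ->
  is_holonomy proj act phi a b c (expi alpha).
Proof.
move=> gE tE; have [eta heta etaE] := lift_exists.
split; first by exists eta.
move=> e2 he2; have [z zE] := lift_unique heta he2.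
rewrite !zE ?lexx ?(ltW ab)// !etaE ?lexx ?(ltW ab)// /boundary_lift gE tE.
rewrite !(actA hb); congr act.
rewrite (_ : - (th a - alpha) = - th a + alpha); last by ring.
by rewrite expiD -!circle_mulA [circle_mul z _]circle_mulC.
Qed.

End OverCurve.
End Lifts.

(** * The parametrized triangle *)

Section TriangleParameter.
Context {R : realType} {E : normedModType R} {M : charted E}.
Local Notation plane := (@plane R).
Variables (A B C : plane).
Let cpl := @has_charts_model R plane.
Let fpl : fin_coord plane := fin_coord_prod (@fin_coordR R) (@fin_coordR R).

Let det_eq : (B.1 - A.1) * (C.2 - B.2) - (B.2 - A.2) * (C.1 - B.1) = det2 (B - A) (C - A).
Proof. by rewrite /det2 /=; ring. Qed.

Let tri_chartE : (tri_chart A B C : plane -> plane) =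
  fun z => A + (z.1 *: (B - A) + z.2 *: (C - B)).
Proof.
apply/funext => z; rewrite /tri_chart /GRing.add /= /add_pair /GRing.scale /= /scale_pair /GRing.scale /=.
by congr pair; rewrite ![_ * _.1]mulrC ![_ * _.2]mulrC addrA; congr (_ + _ + _); rewrite mulrC.
Qed.

Lemma smooth_tri_chart z : smooth_near (tri_chart A B C : plane -> plane) z.
Proof.
have cf : continuous (fst : plane -> R^o) by move=> y; exact: cvg_fst.
have cs : continuous (snd : plane -> R^o) by move=> y; exact: cvg_snd.
rewrite tri_chartE; apply: smooth_nearD; first exact: smooth_near_cst.
by apply: smooth_nearD; apply: smooth_nearZ; [exact: smooth_near_lin|exact: smooth_near_cst|exact: smooth_near_lin|exact: smooth_near_cst].
Qed.

Lemma diff_tri_chart z v : 'd (tri_chart A B C : plane -> plane) z v = v.1 *: (B - A) + v.2 *: (C - B).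
Proof.
pose l (z : plane) : plane := z.1 *: (B - A) + z.2 *: (C - B).
have ll : linear l.
  have sA (x : R) (y : R^o) (V : plane) : (x *: y) *: V = x *: (y *: V) by rewrite scalerA.
  move=> x u w; rewrite /l -[(x *: u + w).1]/(x *: u.1 + w.1) -[(x *: u + w).2]/(x *: u.2 + w.2).
  by rewrite scalerDl scalerDl !sA addrACA -scalerDr.
have cl : continuous l.
  by move=> y; apply: cvgD; apply: cvgZr_tmp; [exact: cvg_fst|exact: cvg_snd].
have [k kE] := linear_pack ll; rewrite -kE in cl.
have dk : is_diff z (k : plane -> plane) (k : plane -> plane).
  by split; [exact: linear_differentiable|exact: diff_lin].
have [_ dE] := @is_diffD _ _ _ (cst A) (k : plane -> plane) 0 (k : plane -> plane) z _ dk.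
have -> : (tri_chart A B C : plane -> plane) = cst A + (k : plane -> plane) by rewrite kE tri_chartE.
rewrite dE.
by rewrite add0r kE.
Qed.

Lemma tri_chart_triangle z : det2 (B - A) (C - A) != 0 -> std_triangle z ->
  triangle A B C (tri_chart A B C z).
Proof. by move=> D0 Tz; rewrite -det_eq in D0; have e := tri_chart_preimage D0; move: Tz; rewrite -e. Qed.

Variable i : model plane -> M.
Let Psi : model plane -> M := i \o tri_chart A B C.

Lemma smooth_param z : smooth_at i (tri_chart A B C z) -> smooth_at Psi z.
Proof.
move=> si; apply: (smooth_at_comp cpl cpl _ si fpl).
by apply: smooth_at_model; exact: smooth_tri_chart.
Qed.

Lemma mdiff_param z v : smooth_at i (tri_chart A B C z) ->
  mdiff Psi z v = mdiff i (tri_chart A B C z) (v.1 *: (B - A) + v.2 *: (C - B)).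
Proof.
move=> si; rewrite (mdiff_comp cpl cpl _ si); last first.
  by apply: smooth_at_model; exact: smooth_tri_chart.
by rewrite /= mdiff_model diff_tri_chart.
Qed.

Lemma param_immersion z : det2 (B - A) (C - A) != 0 -> smooth_at i (tri_chart A B C z) ->
  injective (mdiff i (tri_chart A B C z)) -> injective (mdiff Psi z).
Proof.
move=> D0 si inj [u1 u2] [v1 v2]; rewrite !mdiff_param// => /inj /= [].
rewrite /GRing.scale /= => h1 h2.
rewrite -det_eq in D0; have [||e1 e2] := linear_system2 (x := u1 - v1) (y := u2 - v2) D0.
- by move/eqP: h1; rewrite -subr_eq0 => /eqP h1; rewrite -[RHS]h1; ring.
- by move/eqP: h2; rewrite -subr_eq0 => /eqP h2; rewrite -[RHS]h2; ring.
by move/eqP: e1; move/eqP: e2; rewrite !subr_eq0 => /eqP -> /eqP ->.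
Qed.

(** Psi has differential v |-> v.1 (B - A) + v.2 (C - B) before i, and alternating
    forms scale by its determinant. *)
Lemma pullback2_param (Omega : form2 M) z : is_form2 Omega -> smooth_at i (tri_chart A B C z) ->
  pullback2 Psi Omega z (1, 0) (0, 1) =
  det2 (B - A) (C - A) * pullback2 i Omega (tri_chart A B C z) (1, 0) (0, 1).
Proof.
move=> [l1 l2 alt _] si; rewrite /pullback2 !mdiff_param// -[Psi z]/(i (tri_chart A B C z)) /=.
rewrite !scale1r !scale0r addr0 add0r.
have LD0 u v : mdiff i (tri_chart A B C z) (u + v) = mdiff i (tri_chart A B C z) u + mdiff i (tri_chart A B C z) v.
  exact: mdiffD.
have LZ0 x u : mdiff i (tri_chart A B C z) (x *: u) = x *: mdiff i (tri_chart A B C z) u.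
  exact: mdiffZ.
move: (i (tri_chart A B C z)) (mdiff i (tri_chart A B C z)) LD0 LZ0 => p L LD LZ.
have bas (v : plane) : L v = v.1 *: L (1, 0) + v.2 *: L (0, 1).
  by rewrite -!LZ -LD -plane_basis.
rewrite (bas (B - A)) (bas (C - B)).
move: (L (1, 0)) (L (0, 1)) => e1 e2.
have z1 w : Omega p 0 w = 0 by have := l1 p 1 0 0 w; rewrite scaler0 addr0; lra.
have z2 w : Omega p w 0 = 0 by have := l2 p 1 0 0 w; rewrite scaler0 addr0; lra.
have s1 x u w : Omega p (x *: u) w = x * Omega p u w by have := l1 p x u 0 w; rewrite addr0 z1 addr0.
have s2 x u w : Omega p w (x *: u) = x * Omega p w u by have := l2 p x u 0 w; rewrite addr0 z2 addr0.
have sym : Omega p e2 e1 = - Omega p e1 e2.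
  have := alt p (1 *: e1 + e2); rewrite l1 !l2 !alt; lra.
rewrite l1 !l2 !s1 !s2 !alt sym -det_eq /=; ring.
Qed.

End TriangleParameter.

(** * Holonomy of the boundary *)

Theorem theorem1 (R : realType) (n m : nat)
  (M : charted 'rV[R]_n) (P : charted 'rV[R]_m)
  (proj : P -> M) (act : P -> S1 R -> P)
  (phi : form1 P) (Omega : form2 M)
  (hM : is_manifold M) (hP : is_manifold P)
  (hbundle : is_circle_bundle proj act)
  (hphi : is_connection act phi)
  (hOmega : is_curvature proj phi Omega)
  (A B C : plane) (i : model plane -> M)
  (hT : is_smooth_triangle A B C i)
  (a b : R) (hab : a < b) (c : model R^o -> M)
  (hc : forall t : R, a <= t <= b -> smooth_at c t)
  (hclosed : c a = c b)
  (hcT : is_boundary_curve A B C i a b c) :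
  let alpha := triangle_integral A B C (pullback2 i Omega) in
  is_holonomy proj act phi a b c (expi alpha) /\
  is_holonomy_angle proj act phi a b c alpha.
Proof.
move=> alpha; rewrite /is_holonomy_angle.
suff h : is_holonomy proj act phi a b c (expi alpha) by split.
have [D0 [si inji _ _]] := hT.
have [sigma [csig msig sigb cE]] := hcT.
have cE0 := @fin_coord_rV R n; have cF := @fin_coord_rV R m.
pose Psi : model plane -> M := i \o tri_chart A B C.
have siT z : std_triangle z -> smooth_at i (tri_chart A B C z).
  by move=> Tz; apply: si; exact: tri_chart_triangle.
have sPsi z : std_triangle z -> smooth_at Psi z.
  by move=> Tz; exact: smooth_param (siT z Tz).
have iPsi z : std_triangle z -> injective (mdiff Psi z).
  move=> Tz; apply: param_immersion => //; first exact: siT.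
  by apply: inji; exact: tri_chart_triangle.
have [W [f [s [cW WE [cf f0] fd fs]]]] :=
  flat_section_exists cE0 cF hM hP hbundle hphi hOmega sPsi.
have alphaE : alpha = \int[@lebesgue_measure R]_(x in `[0, 1]) f (x, x).
  rewrite /alpha (triangle_integral_std D0 cW); last first.
    by move=> z Tz; rewrite WE// pullback2_param//; [case: hOmega|exact: siT].
  rewrite -[RHS]opprK; congr (- _).
  rewrite -mulN1r -RintegralZl//; last first.
    apply: continuous_itv_integrable => x.
    apply: (@continuous_comp _ _ _ (fun x : R => (x, x)) f); last exact: cf.
    by apply: pair_continuous => z.
  apply: eq_Rintegral => x; rewrite inE /= in_itv /= => /andP[x0 x1].
  by rewrite fd// mulN1r opprK.
pose gam := boundary_path sigma a; pose th := boundary_angle sigma a f.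
have gamP t : a <= t <= b -> std_triangle (gam t) /\ circuit A B C (sigma t) = tri_chart A B C (gam t).
  exact: (boundary_path_std hab msig sigb A B C).
have cgam t : a <= t <= b -> c t = Psi (gam t).
  by move=> tab; rewrite cE//; have [_ ->] := gamP t tab.
have cg : {within `[a, b], continuous gam} := boundary_path_continuous csig.
have cth : {within `[a, b], continuous th} := boundary_angle_continuous csig cf.
have nab t : a < t < b -> \forall x \near t, a <= x <= b.
  by move=> tab; apply: filterS (near_itvoo tab) => x; lra.
have dgam t : a < t < b -> derivable gam t 1.
  move=> tab; have tab' : a <= t <= b by lra.
  have [Tg _] := gamP t tab'.
  have [cgi _ _] := (continuous_within_itvP gam hab).1 cg.
  apply: (@immersion_path R n (in_charts Psi (gam t))).
  - exact: (smooth_at_differentiable (sPsi _ Tg)).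
  - exact: iPsi.
  - by apply: cgi; rewrite in_itv.
  - have dc := smooth_at_differentiable (hc t tab').
    apply/derivable1_diffP.
    have nE : \forall x \near (t : R^o), in_charts c t x = (in_charts Psi (gam t) \o gam) x.
      apply: filterS (nab t tab) => x xab.
      by rewrite /in_charts /= (cgam t tab') (cgam x xab).
    by have [] := near_eq_diff nE dc.
have fstE t : a < t < b -> is_derive t 1 (fun t => (gam t).1) ('D_1 gam t).1.
  move=> tab; have cfst : continuous (fst : plane -> R^o) by move=> y; exact: cvg_fst.
  have df : differentiable (fst : plane -> R^o) (gam t) by exact: linear_differentiable.
  have := is_derive_path df (is_diff_path (dgam t tab)).
  by rewrite diff_lin.
have dth t : a < t < b -> is_derive t 1 th (f (gam t) * ('D_1 gam t).1).
  move=> tab.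
  have := @boundary_angle_derive R sigma a b f hab csig msig sigb cf f0 _ t tab.
  have [_ <-] := fstE t tab; apply.
  by move=> x /fstE[].
have [ge te] := boundary_closed sigb cf.
apply: (holonomy_from_boundary cE0 cF hM hP hbundle hphi hab hc fs
  (fun t tab => (gamP t tab).1) cgam cg cth dgam dth ge).
by rewrite /th te alphaE.
Qed.
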